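(* Consider the dead leaves model in dimension $d=1$, with notation as in the context. Suppose that $\mathbb Q$ is concentrated on connected sets (i.e., on intervals), that $F(0)=0$ and that $\lambda<\infty$. Then the second factorial moment measure $\alpha_2$ of the point process $\eta$ is given for $x<y$ by $$\alpha_2(d(x,y))=4\,(1+F(y-x))\,(\lambda\lambda_{y-x})^{-1}\,dy\,dx+\lambda_{y-x}^{-1}\,\mathbb P[H+x\in dy]\,dx.$$ If $\nu$ has a probability density function $f$, then the pair correlation function $\rho_2$ of $\eta$ is given by $$\rho_2(z)=\frac{\lambda(1+F(z))}{\lambda_z}+\frac{\lambda^2f(z)}{4\lambda_z},\qquad z>0.$$ In the particular case where $\nu=\delta_\lambda$ for some $\lambda>0$, we have for $x<y$ that $$\alpha_2(d(x,y))=\frac{4\,\mathbf 1_{(0,\lambda)}(y-x)}{\lambda(\lambda+y-x)}\,dy\,dx+4\lambda^{-2}\,\mathbf 1_{(\lambda,\infty)}(y-x)\,dy\,dx+(2\lambda)^{-1}\,\delta_{\lambda+x}(dy)\,dx.$$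
   Context: Notation: $\mathcal H_k$ is $k$-dimensional Hausdorff measure ($\mathcal H_0$ is counting measure, $\mathcal H_1$ on $\mathbb R$ is Lebesgue measure). For $A\subset\mathbb R$, $A^o$ is its interior and $\partial A=\overline A\setminus A^o$ its topological boundary; $A+x:=\{a+x:a\in A\}$. Dead leaves model in $d=1$: Let $\mathcal C$ be the space of compact subsets of $\mathbb R$, with the $\sigma$-algebra generated by the Fell topology (generated by all sets $\{F\in\mathcal C:F\cap G\ne\emptyset\}$ with $G$ open and $\{F\in\mathcal C:F\cap K=\emptyset\}$ with $K$ compact). Let $\mathbb Q$ be a probability measure on $\mathcal C$ (the grain distribution) assigning strictly positive measure to the collection of sets having non-empty interior. $S$ denotes a random element of $\mathcal C$ with distribution $\mathbb Q$; $\lambda:=\mathbb E[\mathcal H_1(S)]$. Let $\sum_{i=1}^\infty\delta_{(x_i,t_i)}$ be a homogeneous Poisson process of unit intensity in $\mathbb R\times\mathbb R$ and, independently of it, let $(S_i)_{i\ge1}$ be independent random elements of $\mathcal C$ with distribution $\mathbb Q$. (Leaf $i$ is $S_i+x_i$, arriving at time $t_i$.) The boundary of the time-reversed DLM tessellation is $$\Phi:=\bigcup_{i:t_i\ge0}\Big[(\partial S_i+x_i)\setminus\bigcup_{j:0\le t_j<t_i}(S_j^o+x_j)\Big],$$ and $\eta:=\mathcal H_0(\Phi\cap\cdot)$ is the (simple) point process of its points. Let $\nu$ be the distribution of the Lebesgue measure $\mathcal H_1(S)$ of a leaf, $H$ a random variable with distribution $\nu$, $F(x)=\mathbb P[H\le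 x]$, and for $x>0$ let $\lambda_x:=\mathbb E[H+\min(x,H)]$. The second factorial moment measure $\alpha_2$ of a simple point process $\eta$ is the Borel measure on $\mathbb R\times\mathbb R$ giving to each Borel set $D$ the expected number of ordered pairs $(x,y)\in D$ of distinct points of $\eta$; thus $\alpha_2(A\times B)=\mathbb E[\eta(A)\eta(B)]$ for disjoint Borel $A,B$. If $\alpha_2(d(x,y))=\rho(y-x)\,dx\,dy$ for a Borel function $\rho$, the pair correlation function is $\rho_2(z):=\rho(z)/\gamma^2$, where $\gamma$ is the intensity of $\eta$. $\delta_a$ denotes the Dirac measure at $a$. *)

(* Defs.v *)
From HB Require Import structures.
From mathcomp Require Import all_boot all_order all_algebra finmap.
From mathcomp Require Import all_classical all_reals all_analysis.
From mathcomp Require Import measurable_realfun.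

Set Implicit Arguments.
Unset Strict Implicit.
Unset Printing Implicit Defensive.

Import Order.TTheory GRing.Theory Num.Theory.
Import numFieldNormedType.Exports.

Local Open Scope classical_set_scope.
Local Open Scope ring_scope.

Record compacts (R : realType) := Compacts {
  compacts_set : set R ;
  compactsP : compact compacts_set }.

HB.instance Definition _ (R : realType) := gen_eqMixin (compacts R).
HB.instance Definition _ (R : realType) := gen_choiceMixin (compacts R).
HB.instance Definition _ (R : realType) :=
  isPointed.Build (compacts R) (Compacts (@compact0 R)).

Definition fell_subbase (R : realType) : set (set (compacts R)) :=
  [set [set F : compacts R | compacts_set F `&` G !=set0] |
    G in [set G : set R | open G]]
  `|` [set [set F : compacts R | compacts_set F `&` K = set0] |
        K in [set K : set R | compact K]].

HB.instance Definition _ (R : realType) :=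
  isSubBaseTopological.Build (compacts R) (@fell_subbase R) id.

Notation grain R := (g_sigma_algebraType [set U : set (compacts R) | open U]).

Section leaf_length.
Variable R : realType.
Local Notation mu := (@lebesgue_measure R).

Definition leaf_length (F : grain R) : R := fine (mu (compacts_set F)).

Lemma fell_subbase_measurable (U : set (compacts R)) :
  fell_subbase U -> measurable (U : set (grain R)).
Proof.
move=> sU; apply: sub_sigma_algebra; exists [set U]; last by rewrite bigcup_set1.
by move=> _ ->; apply: finI_from1.
Qed.

Lemma measurable_grain_graph :
  measurable [set Fx : grain R * R | compacts_set Fx.1 Fx.2].
Proof.
pose I (pq : rat * rat) : set R := `[ratr pq.1, ratr pq.2]%classic.
pose J (pq : rat * rat) : set R := `]ratr pq.1, ratr pq.2[%classic.
rewrite -[X in measurable X]setCK; apply: measurableC.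
rewrite (_ : ~` _ = \bigcup_pq
  ([set F : grain R | compacts_set F `&` I pq = set0] `*` J pq)).
  apply: countable_bigcupT_measurable; first exact: countableP.
  move=> pq; apply: measurableX; last exact: measurable_itv.
  apply: fell_subbase_measurable; right.
  by exists (I pq) => //; exact: segment_compact.
apply/seteqP; split=> [[F x] /= Fx|[F x] /= [pq _ [FI Jx]] Fx]; last first.
  have : (compacts_set F `&` I pq) x by split=> //; exact: subset_itv_oo_cc.
  by rewrite FI.
have : closed (compacts_set F).
  by apply: compact_closed; [exact: norm_hausdorff|exact: compactsP].
rewrite -openC openE => /(_ _ Fx) /nbhs_ballP[e /= e0 xe].
have /rat_in_itvoo[p /itvP pe] : x - e < x by rewrite ltrBlDr ltrDl.
have /rat_in_itvoo[q /itvP qe] : x < x + e by rewrite ltrDl.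
exists (p, q) => //; split; last by rewrite /J /= in_itv/= pe qe.
apply/seteqP; split=> // y [Fy]; rewrite /I /= in_itv/= => /andP[py yq].
apply: (xe y) => //; rewrite /ball/= ltr_norml; apply/andP; split.
  by rewrite ltrBrDl -ltrBrDr opprK (le_lt_trans yq)// qe.
by rewrite ltrBlDr -ltrBlDl (lt_le_trans _ py)// pe.
Qed.

Lemma measurable_leaf_length : measurable_fun [set: grain R] leaf_length.
Proof.
have mmu : @measurable_fun _ _ (grain R) (\bar R) setT
      (fun F => mu (compacts_set F)).
  have := measurable_fun_xsection mu measurable_grain_graph.
  apply: eq_measurable_fun => F _ /=.
  by congr (mu _); apply/seteqP; split => x; rewrite /xsection /= inE.
by apply: (measurableT_comp _ mmu).
Qed.

HB.instance Definition _ :=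
  isMeasurableFun.Build _ _ _ _ leaf_length measurable_leaf_length.

End leaf_length.

Section leaf_law.
Local Open Scope ereal_scope.
Context (R : realType).
Variable Q : probability (grain R) R.

Definition leaf_law : probability R R :=
  distribution Q (@leaf_length R : {mfun grain R >-> R}).

Definition leaf_cdf (z : R) : R := fine (leaf_law `]-oo, z]%classic).

Definition leaf_mean : \bar R := 'E_Q[@leaf_length R].

(* Only meant for [0 < z] and [leaf_mean < +oo]. *)
Definition leaf_mean_cover (z : R) : R :=
  fine 'E_Q[(fun K => leaf_length K + Num.min z (leaf_length K))%R].

Definition shifted_leaf_law (x : R) : set R -> \bar R :=
  pushforward leaf_law (fun h : R => h + x)%R.

End leaf_law.

Section independence.
Local Open Scope ereal_scope.
Context d (Omega : measurableType d) (R : realType).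
Variable P : probability Omega R.

Definition mutually_independent (I : choiceType)
    (G : I -> set_system Omega) : Prop :=
  forall (J : {fset I}) (A : I -> set Omega),
    (forall i, i \in J -> G i (A i)) ->
    P (\bigcap_(i in [set` J]) A i) = \prod_(i <- J) P (A i).

Definition independent2 (G H : set_system Omega) : Prop :=
  forall A B, G A -> H B -> P (A `&` B) = P A * P B.

Definition g_sigma_algebra_family d' (T : measurableType d')
    (X : nat -> Omega -> T) : set_system Omega :=
  <<s \bigcup_i g_sigma_algebra_preimage (X i) >>.

Definition point_count (T : Type) (X : nat -> Omega -> T) (B : set T)
    (w : Omega) : \bar R :=
  counting [set i | B (X i w)].

(* The masses are spelled out since the library's [poisson_pmf r] is the
   constant 1 when [r = 0]. *)
Definition poisson_process d' (T : measurableType d')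
    (mu : set T -> \bar R) (X : nat -> Omega -> T) : Prop :=
  (forall (B : set T) (k : nat), measurable B -> mu B < +oo ->
     P [set w | point_count X B w = k%:R%:E] =
     (fine (mu B) ^+ k / k`!%:R * expR (- fine (mu B)))%:E) /\
  (forall (n : nat) (B : 'I_n -> set T),
     (forall i, measurable (B i)) -> trivIset setT B ->
     mutually_independent
       (fun i => g_sigma_algebra_preimage (point_count X (B i)))).

End independence.

Section dead_leaves.
Local Open Scope ereal_scope.
Context d (Omega : measurableType d) (R : realType).
Variable P : probability Omega R.
Local Notation mu := (@lebesgue_measure R).

(* The enumeration of the points may not depend on the grains: the latter are
   independent of the sequence [(x_i, t_i)_i], not just of its counting
   measure. *)
Definition dead_leaves_model (Q : probability (grain R) R)
    (x t : nat -> {RV P >-> R}) (S : nat -> {RV P >-> grain R}) : Prop :=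
  [/\ poisson_process P (mu \x mu) (fun i w => (x i w, t i w)),
      forall i (A : set (grain R)), measurable A ->
        distribution P (S i) A = Q A,
      mutually_independent P (fun i => g_sigma_algebra_preimage (S i)) &
      independent2 P
        (g_sigma_algebra_family (fun i w => (x i w, t i w)))
        (g_sigma_algebra_family S)].

End dead_leaves.

Section tessellation.
Context (R : realType).

Definition boundary (A : set R) : set R := closure A `\` A°.

Definition translate (A : set R) (x : R) : set R := [set a + x | a in A].

Definition tessellation_boundary (x t : nat -> R) (S : nat -> compacts R)
    : set R :=
  \bigcup_(i in [set i | 0 <= t i])
    (translate (boundary (compacts_set (S i))) (x i) `\`
     \bigcup_(j in [set j | 0 <= t j < t i])
       translate (compacts_set (S j))° (x j)).

End tessellation.

Section point_processes.
Local Open Scope ereal_scope.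
Context d (Omega : measurableType d) (R : realType).
Variable P : probability Omega R.
Local Notation mu := (@lebesgue_measure R).

Definition counting_process (Phi : Omega -> set R) (w : Omega) (A : set R)
    : \bar R :=
  counting (Phi w `&` A).

Definition points (eta : Omega -> set R -> \bar R) (w : Omega) : set R :=
  [set z | 0 < eta w [set z]].

Definition intensity (eta : Omega -> set R -> \bar R) (g : R) : Prop :=
  forall A : set R, measurable A -> \int[P]_w eta w A = g%:E * mu A.

(* For simple [eta] only: points are not counted with multiplicity. *)
Definition factorial_moment2 (eta : Omega -> set R -> \bar R)
    (D : set (R * R)) : \bar R :=
  \int[P]_w counting
    [set p | [/\ D p, p.1 != p.2, points eta w p.1 & points eta w p.2]].

(* A relation rather than a function: [rho], hence [rho2], is determined by
   [eta] only up to a Lebesgue-null set. *)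
Definition pair_correlation (eta : Omega -> set R -> \bar R) (rho2 : R -> R)
    : Prop :=
  exists (rho : R -> R) (g : R),
    [/\ measurable_fun setT rho,
        intensity eta g,
        forall D : set (R * R), measurable D ->
          factorial_moment2 eta D =
          \int[mu]_x \int[mu]_(y in xsection D x) (rho (y - x))%:E &
        forall z, rho2 z = (rho z / g ^+ 2)%R].

End point_processes.

Definition dead_leaves_points d (Omega : measurableType d) (R : realType)
    (P : probability Omega R) (x t : nat -> {RV P >-> R})
    (S : nat -> {RV P >-> grain R}) : Omega -> set R -> \bar R :=
  counting_process (fun w =>
    tessellation_boundary (x ^~ w) (t ^~ w) (S ^~ w)).

(* Main.v *)
From HB Require Import structures.
Require Import Defs.
From mathcomp Require Import all_boot all_order all_algebra finmap.
From mathcomp Require Import all_classical all_reals all_analysis.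
From mathcomp Require Import measurable_realfun.
From mathcomp Require Import ring lra.

Set Implicit Arguments.
Unset Strict Implicit.
Unset Printing Implicit Defensive.

Import Order.TTheory GRing.Theory Num.Theory.
Import numFieldNormedType.Exports.
Import HBNNSimple.

Local Open Scope classical_set_scope.
Local Open Scope ring_scope.
Local Open Scope ereal_scope.

(** A leaf that is an interval is recorded by its left end [l], its arrival time
    [s] and its length [h]. Marking the Poisson process of locations and times
    with the grains, and moving each location by the left end of its grain,
    gives a Poisson process in (l, s, h) with intensity Lebesgue x Lebesgue x
    the law [nu] of the length ([leaf_point_has_pgfl]). An edge at [u] of a leaf
    that arrives at [s >= 0] is visible when no leaf that arrives in [0, s[
    covers [u] in its interior, that is, when the process has no point in
    [shadow s u]. The points of the tessellation are the visible edges.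

    The second factorial moment measure sums the probabilities that two edges
    are both visible. By the Mecke formula ([mecke_one_leaf],
    [mecke_two_leaves]) such a sum is the integral over one or two leaves of
    exp(- m), where [m] is the intensity of the union of the two shadows: for
    0 <= s <= s',
        m = s lam_(v - u) + (s' - s) lam  ([leaf_intensity_shadowU]),
    since E[H + min(|v - u|, H)] is the mean length of the union of the two
    intervals of left ends for which a leaf covers [u] or [v].
    - Two edges of one leaf share the arrival time, and integrating
      exp(- s lam_h) over [s] gives 1 / lam_h. Their displacement has the law
      of [H]: this is the second term of the formula.
    - For edges of two leaves the two times integrate to
      1 / (lam lam_(v - u)). The earlier leaf must in addition not cover the
      edge of the later one: for v - u = z > 0 this has probability F(z) if
      the edge of the earlier leaf at [u] is a left one and 1 if it is a right
      one. There are two choices for the edge of the later leaf, and two for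
      which of [u], [v] belongs to the earlier leaf: hence the factor
      4 (1 + F(z)).

    The Mecke formulas are derived from generating functionals, E prod_i g(z_i)
    = exp(- integral of 1 - g), which follow from the Poisson counts
    ([poisson_has_pgfl]) and are stable under images and independent marking.
    Differentiating at g = 1 on small sets gives the probabilities that there
    are points in given disjoint sets and none in a third one
    ([pgfl_two_points]); as the shadow depends on the points, it is
    approximated by finitely many rational tests, and the general formula
    follows by induction on the tests and a limit ([mecke_formula]).

    It remains that almost surely the expected number of pairs is such a sum
    ([generic_sample]): all grains are segments, arrival times are different,
    and visible edges of different leaves are at different places. *)

(** * Measurability, monotone limits and Lebesgue integrals *)

Lemma measurable_preimageT d d' (T : measurableType d) (T' : measurableType d')
    (f : T -> T') (B : set T') :
  measurable_fun setT f -> measurable B -> measurable (f @^-1` B).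
Proof. by move=> mf mB; rewrite -[_ @^-1` _]setTI; exact: mf. Qed.

Lemma nondecreasing_le_cvg (R : realType) (u : (\bar R)^nat) (l : \bar R) n :
  nondecreasing_seq u -> u @ \oo --> l -> u n <= l.
Proof.
move=> ndu ul; rewrite -(cvg_lim _ ul)// (cvg_lim _ (ereal_nondecreasing_cvgn ndu))//.
by apply: ereal_sup_ubound; exists n.
Qed.

Lemma nondecreasing_limits_interchange (R : realType)
    (e : nat -> nat -> \bar R) (f r : nat -> \bar R) (l : \bar R) :
  (forall n, nondecreasing_seq (e ^~ n)) ->
  (forall m, nondecreasing_seq (e m)) ->
  (forall n, e ^~ n @ \oo --> r n) -> (forall m, e m @ \oo --> f m) ->
  r @ \oo --> l -> f @ \oo --> l.
Proof.
move=> ndl ndr er ef rl.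
have le_er m n : e m n <= r n.
  by exact: nondecreasing_le_cvg (er n).
have le_ef m n : e m n <= f m.
  by exact: nondecreasing_le_cvg (ef m).
have ndf : nondecreasing_seq f.
  move=> m m' mm'; rewrite -(cvg_lim _ (ef m))//; apply: lime_le.
    by apply/cvg_ex; exists (f m).
  by apply: nearW => n; apply: le_trans (le_ef m' n); exact: ndl.
have ndr' : nondecreasing_seq r.
  move=> n n' nn'; rewrite -(cvg_lim _ (er n))//; apply: lime_le.
    by apply/cvg_ex; exists (r n).
  by apply: nearW => m; apply: le_trans (le_er m n'); exact: ndr.
have le_rl n : r n <= l.
  by exact: nondecreasing_le_cvg rl.
have fs := ereal_nondecreasing_cvgn ndf.
suff -> : l = ereal_sup (range f) by [].
apply/eqP; rewrite eq_le; apply/andP; split.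
  rewrite -(cvg_lim _ rl)//; apply: lime_le; first by apply/cvg_ex; exists l.
  apply: nearW => n; rewrite -(cvg_lim _ (er n))//; apply: lime_le.
    by apply/cvg_ex; exists (r n).
  apply: nearW => m; apply: le_trans (le_ef m n) _.
  by apply: ereal_sup_ubound; exists m.
apply: ge_ereal_sup => _ [m _ <-]; rewrite -(cvg_lim _ (ef m))//; apply: lime_le.
  by apply/cvg_ex; exists (f m).
by apply: nearW => n; exact: le_trans (le_er m n) (le_rl n).
Qed.

Lemma nonincreasing_limits_interchange (R : realType)
    (e : nat -> nat -> \bar R) (f r : nat -> \bar R) (l : \bar R) :
  (forall n, nonincreasing_seq (e ^~ n)) ->
  (forall m, nonincreasing_seq (e m)) ->
  (forall n, e ^~ n @ \oo --> r n) -> (forall m, e m @ \oo --> f m) ->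
  r @ \oo --> l -> f @ \oo --> l.
Proof.
move=> nil nir er ef rl.
rewrite -[l]oppeK (_ : f = (fun m => - - f m)); last by apply/funext=> m; rewrite oppeK.
apply: cvgeN.
apply: (@nondecreasing_limits_interchange _ (fun m n => - e m n) _ (fun n => - r n)).
- by move=> n m m' mm'; rewrite leeN2; exact: nil.
- by move=> n m m' mm'; rewrite leeN2; exact: nir.
- by move=> n; apply: cvgeN; exact: er.
- by move=> n; apply: cvgeN; exact: ef.
- exact: cvgeN.
Qed.

Section density_map.
Context d d' (T : measurableType d) (T' : measurableType d') (R : realType).
Variables (m : {measure set T -> \bar R}) (n : {measure set T' -> \bar R}).
Variables (X : T -> T') (W : T -> \bar R).
Hypotheses (mX : measurable_fun setT X) (mW : measurable_fun setT W).
Hypothesis W0 : forall x, 0 <= W x.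
Hypothesis nE : forall B, measurable B -> n B = \int[m]_(x in X @^-1` B) W x.

Let density_map_nnsfun (g : {nnsfun T' >-> R}) :
  \int[n]_y (g y)%:E = \int[m]_x ((g (X x))%:E * W x).
Proof.
have mgX r : measurable (X @^-1` (g @^-1` [set r])).
  exact: measurable_preimageT.
rewrite integral_nnsfun// patch_setT sintegralE.
transitivity (\int[m]_x (\sum_(r \in range g)
    (r%:E * ((\1_(X @^-1` (g @^-1` [set r])) x)%:E * W x)))); last first.
  apply: eq_integral => x _; rewrite [in RHS](fimfunE g) -fsumEFin//.
  rewrite ge0_mule_fsuml; last by move=> r; rewrite nnfun_muleindic_ge0.
  by apply: eq_fsbigr => r _; rewrite EFinM muleA.
have mi r : measurable_fun [set: T] (fun x => (\1_(X @^-1` (g @^-1` [set r])) x)%:E * W x).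
  by apply: emeasurable_funM => //; apply/measurable_EFinP; exact: measurable_indic.
have i0 r x : 0 <= (\1_(X @^-1` (g @^-1` [set r])) x)%:E * W x.
  by rewrite mule_ge0// lee_fin.
rewrite ge0_integral_fsum//; last 2 first.
- by move=> r; apply: emeasurable_funM => //; exact: measurable_cst.
- move=> r x _; have [r0|r0] := leP 0%R r; first by rewrite mule_ge0.
  rewrite (_ : g @^-1` [set r] = set0) ?preimage_set0 ?indic0 ?mul0e ?mule0//.
  by apply/seteqP; split => // y /= gy; move: r0; rewrite -gy ltNge fun_ge0.
apply: eq_fsbigr => r _.
have [r0|r0] := leP 0%R r; last first.
  have g0 : g @^-1` [set r] = set0.
    by apply/seteqP; split => // y /= gy; move: r0; rewrite -gy ltNge fun_ge0.
  rewrite g0 measure0 mule0 integral0_eq// => x _.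
  by rewrite preimage_set0 indic0 mul0e mule0.
rewrite ge0_integralZl//; congr (_ * _); rewrite nE// integral_mkcond.
apply: eq_integral => x _; rewrite /patch indicE.
by case: ifP => _; rewrite ?mul1e ?mul0e.
Qed.

(** The density and the change of variables are done at once: with [X] the
    identity this is integration against a measure with density [W], with [W]
    constant it is integration against an image measure. *)
Lemma ge0_integral_density_map (f : T' -> \bar R) :
  measurable_fun setT f -> (forall y, 0 <= f y) ->
  \int[n]_y f y = \int[m]_x (f (X x) * W x).
Proof.
move=> mf f0; pose f_ := nnsfun_approx measurableT mf.
have ndf y : nondecreasing_seq (fun k => (f_ k y)%:E).
  by move=> a b ab; rewrite lee_fin; exact/lefP/nd_nnsfun_approx.
transitivity (limn (fun k => \int[n]_y (f_ k y)%:E)).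
  rewrite -monotone_convergence//.
  - by apply: eq_integral => y _; apply/esym/cvg_lim => //; exact: cvg_nnsfun_approx.
  - by move=> k; exact/measurable_EFinP/measurable_funP.
  - by move=> k y _; rewrite lee_fin.
under eq_fun do rewrite density_map_nnsfun.
rewrite -monotone_convergence//.
- apply: eq_integral => x _; apply/cvg_lim => //.
  have fc : (fun k => (f_ k (X x))%:E) @ \oo --> f (X x) by exact: cvg_nnsfun_approx.
  have [Wx|Wx] := boolP (W x \is a fin_num); first exact: cvgeZr.
  have {}Wx : W x = +oo.
    by apply/eqP; move: Wx (W0 x); rewrite fin_numE; case: (W x).
  rewrite Wx; have [fx0|fx0] := eqVneq (f (X x)) 0.
    rewrite fx0 mul0e; apply: cvg_near_cst; apply: nearW => k.
    have : (f_ k (X x))%:E <= 0.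
      by rewrite -fx0; exact: nondecreasing_le_cvg fc.
    rewrite lee_fin => ?; have -> : f_ k (X x) = 0%R by apply/eqP; rewrite eq_le fun_ge0 andbT.
    by rewrite mul0e.
  have fx : 0 < f (X x) by rewrite lt0e fx0 f0.
  rewrite gt0_muley//; apply: cvg_near_cst.
  have [N HN] : exists N, 0 < (f_ N (X x))%:E.
    apply: contrapT => /forallNP fN; move: fx; rewrite ltNge => /negP; apply.
    rewrite -(cvg_lim _ fc)//; apply: lime_le; first by apply/cvg_ex; exists (f (X x)).
    by apply: nearW => k; rewrite leNgt; exact/negP.
  exists N => // k /= Nk; rewrite gt0_muley//; apply: lt_le_trans HN _; exact: ndf.
- move=> k; apply: emeasurable_funM => //; apply/measurable_EFinP.
  by apply: measurableT_comp => //; exact: measurable_funP.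
- by move=> k x _; rewrite mule_ge0// lee_fin.
- by move=> x _ a b ab; rewrite lee_wpmul2r// ndf.
Qed.

End density_map.

Section lebesgue_tools.
Context (R : realType).
Local Notation mu := (@lebesgue_measure R).

Lemma measurable_shift (a : R) : measurable_fun [set: R] (fun x : R => (x + a)%R).
Proof. by apply: measurable_funD => //; exact: measurable_cst. Qed.

Lemma lebesgue_measure_shift (a : R) (A : set R) : measurable A ->
  mu ((fun x : R => (x + a)%R) @^-1` A) = mu A.
Proof.
move=> mA; apply/esym.
pose phi : measurableTypeR R -> measurableTypeR R := fun x : R => (x + a)%R.
apply: (@lebesgue_measure_unique _ (pushforward mu phi)) => //.
  exact: measurable_shift.
move=> mphi _ [[b c]] _ <-.
rewrite /pushforward [X in _ = mu X](_ : _ = `](b - a)%R, (c - a)%R]%classic); last first.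
  by apply/seteqP; split => x; rewrite /phi /= !in_itv/= ltrBlDr lerBrDr.
rewrite !lebesgue_measure_itv/= !lte_fin.
by rewrite ltrD2r; case: ifP => // _; rewrite -!EFinB; congr EFin; ring.
Qed.

Lemma ge0_lebesgue_integral_shift (f : R -> \bar R) (a : R) :
  measurable_fun setT f -> (forall x, 0 <= f x) ->
  \int[mu]_x f (x + a)%R = \int[mu]_x f x.
Proof.
move=> mf f0.
rewrite [RHS](@ge0_integral_density_map _ _ _ _ _ mu mu
  (fun x : R => (x + a)%R) (fun => 1))//.
- by apply: eq_integral => x _; rewrite mule1.
- exact: measurable_shift.
- move=> B mB; rewrite integral_cst ?mul1e; first by exact/esym/lebesgue_measure_shift.
  exact: measurable_preimageT (measurable_shift a) mB.
Qed.

Lemma integral_expRN (a : R) : (0 < a)%R ->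
  \int[mu]_(t in `[0%R, +oo[) (expR (- a * t))%:E = (a^-1)%:E.
Proof.
move=> a0; have := integral_exponential_pdf a0.
have -> : (fun x => (exponential_pdf a x)%:E) =
    (fun x => a%:E * (((fun t => (expR (- a * t))%:E) \_ `[0%R, +oo[) x)).
  apply/funext => x; rewrite /exponential_pdf /patch.
  by case: ifP => _; rewrite ?mule0// EFinM.
have me : measurable_fun [set: R] (fun t : R => (expR (- a * t))%:E).
  by apply/measurable_EFinP; apply: measurableT_comp => //.
rewrite ge0_integralZl//; last 3 first.
- apply/(measurable_restrictT _ _).1; [exact: measurable_itv|exact: measurable_funTS].
- by move=> x _; rewrite /patch; case: ifP => // _; rewrite lee_fin expR_ge0.
- by rewrite lee_fin ltW.
rewrite -integral_mkcond => h.
have : a^-1%:E * (a%:E * \int[mu]_(t in `[0%R, +oo[) (expR (- a * t))%:E) = a^-1%:E * 1 by rewrite h.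
by rewrite muleA -EFinM mulVf ?gt_eqF// mul1e mule1.
Qed.

End lebesgue_tools.

(** * Products of independent random variables *)

Lemma ge0_integral_probability_le1 d (T : measurableType d) (R : realType)
    (P : probability T R) (f : T -> R) :
  measurable_fun setT f -> (forall w, (0 <= f w <= 1)%R) ->
  0 <= \int[P]_w (f w)%:E <= 1.
Proof.
move=> mf f01; rewrite integral_ge0/=; last first.
  by move=> w _; rewrite lee_fin; have /andP[] := f01 w.
apply: (@le_trans _ _ (\int[P]_w (cst 1 w))); last first.
  by rewrite integral_cst// mul1e probability_le1.
apply: ge0_le_integral => //.
- by move=> w _; rewrite lee_fin; have /andP[] := f01 w.
- exact/measurable_EFinP.
- by move=> w _; rewrite lee_fin; have /andP[] := f01 w.
Qed.

Lemma integral_probability_fin_num d (T : measurableType d) (R : realType)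
    (P : probability T R) (f : T -> R) :
  measurable_fun setT f -> (forall w, (0 <= f w <= 1)%R) ->
  \int[P]_w (f w)%:E \is a fin_num.
Proof.
move=> mf /(ge0_integral_probability_le1 P mf)/andP[h0 h1].
by rewrite ge0_fin_numE// (le_lt_trans h1)// ltry.
Qed.

Section independent_expectations.
Context d d' (Omega : measurableType d) (T : measurableType d') (R : realType).
Variable P : probability Omega R.
Variables (I : choiceType) (X : I -> Omega -> T).
Hypothesis mX : forall i, measurable_fun setT (X i).
Hypothesis indX : mutually_independent P (fun i => g_sigma_algebra_preimage (X i)).

Let indep_indic (r : seq I) (A : I -> set T) :
  (forall i, measurable (A i)) -> uniq r ->
  \int[P]_w (\prod_(i <- r) \1_(A i) (X i w))%:E =
  \prod_(i <- r) P (X i @^-1` A i).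
Proof.
move=> mA ur.
have pr : perm_eq [fset i | i in r]%fset r.
  by apply: uniq_perm => // i; rewrite !inE.
rewrite (_ : (fun w => _) = (fun w => (\1_(\bigcap_(i in [set` [fset i | i in r]%fset]) (X i @^-1` A i)) w)%:E)); last first.
  apply/funext => w; congr EFin; rewrite -(perm_big _ pr)/= indicE.
  have [/set_mem h|h] := boolP (w \in _).
    rewrite big_seq big1// => i ir; rewrite indicE mem_set//; exact: (h i).
  apply/eqP; rewrite prodf_seq_eq0; apply/hasP.
  move: h; rewrite notin_setE => /existsNP[i /not_implyP[ir /= Aiw]].
  by exists i => //=; rewrite indicE memNset.
rewrite integral_indic ?setIT//; last first.
  by apply: fin_bigcap_measurable => // i _; exact: measurable_preimageT.
rewrite -(perm_big _ pr)/=; apply: (indX (A := fun i => X i @^-1` A i)).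
move=> i _; exists (A i) => //.
by rewrite setTI.
Qed.

Lemma expectation_prod_independent (phi : I -> T -> R) (s : seq I) :
  (forall i, measurable_fun setT (phi i)) ->
  (forall i y, (0 <= phi i y <= 1)%R) -> uniq s ->
  \int[P]_w (\prod_(i <- s) phi i (X i w))%:E =
  \prod_(i <- s) \int[P]_w (phi i (X i w))%:E.
Proof.
move=> mphi phi01 us.
have m_phi i : measurable_fun setT (fun w => phi i (X i w)).
  exact: measurableT_comp.
have m1 A i : measurable A -> measurable_fun setT (fun w => \1_A (X i w) : R).
  move=> mA; apply: measurableT_comp => //; exact: measurable_indic.
(* the functions are introduced one index at a time, the remaining indices
   carrying indicators *)
suff {us} H r (A : I -> set T) : (forall i, measurable (A i)) -> uniq (s ++ r) ->
    \int[P]_w ((\prod_(i <- s) phi i (X i w)) * \prod_(i <- r) \1_(A i) (X i w))%:E =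
    (\prod_(i <- s) \int[P]_w (phi i (X i w))%:E) * \prod_(i <- r) P (X i @^-1` A i).
  have := H [::] (fun=> setT) (fun=> measurableT).
  by rewrite cats0 => /(_ us); rewrite !big_nil mule1; under eq_integral do rewrite big_nil mulr1.
elim: s r A => [|i s ih] r A mA /=.
  by move=> ur; under eq_integral do rewrite big_nil mul1r; rewrite indep_indic// big_nil mul1e.
move=> /andP[isr usr].
pose W w := ((\prod_(j <- s) phi j (X j w)) * \prod_(j <- r) \1_(A j) (X j w))%R.
have W01 w : (0 <= W w <= 1)%R.
  rewrite /W mulr_ge0 ?prodr_ge0//=; last 1 first.
  - by move=> j _; have /andP[] := phi01 j (X j w).
  rewrite mulr_ile1 ?prodr_ge0// ?prodr_ile1//.
  - by move=> j _; have /andP[] := phi01 j (X j w).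
  - by move=> j _; rewrite indicE; case: (_ \in _); rewrite ?lexx ?ler01.
have mW : measurable_fun setT W.
  by apply: measurable_funM; apply: measurable_prod => // j _; exact: m1.
have W0 w : 0 <= (W w)%:E by rewrite lee_fin; have /andP[] := W01 w.
have fW : \int[P]_w (W w)%:E \is a fin_num.
  exact: integral_probability_fin_num.
have c0 : (0 <= fine (\int[P]_w (W w)%:E))%R by rewrite fine_ge0// integral_ge0.
have key B : measurable B ->
    mscale (NngNum c0) (pushforward P (X i)) B = \int[P]_(w in X i @^-1` B) (W w)%:E.
  move=> mB; rewrite /mscale /= fineK// /pushforward.
  pose A' j := if j == i then B else A j.
  have mA' j : measurable (A' j) by rewrite /A'; case: ifP.
  have uisr : uniq (s ++ i :: r) by rewrite uniq_catC/= mem_cat uniq_catC usr andbT orbC -mem_cat.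
  have -> : \int[P]_w (W w)%:E = (\prod_(i <- s) \int[P]_w (phi i (X i w))%:E) * \prod_(i <- r) P (X i @^-1` A i).
    by rewrite ih.
  move: isr; rewrite mem_cat negb_or => /andP[_ ir].
  have A'i : A' i = B by rewrite /A' eqxx.
  have A'r j : j \in r -> A' j = A j.
    by rewrite /A'; case: eqP => // -> ij; rewrite ij in ir.
  have := ih (i :: r) A' mA' uisr; rewrite [\prod_(j <- i :: r) _]big_cons A'i.
  rewrite (_ : \prod_(j <- r) P (X j @^-1` A' j) = \prod_(j <- r) P (X j @^-1` A j)); last first.
    by apply: eq_big_seq => j jr; rewrite A'r.
  rewrite (muleC (P (X i @^-1` B))) muleA => <-; rewrite [RHS]integral_mkcond.
  apply: eq_integral => w _; rewrite /patch (_ : (w \in X i @^-1` B) = (X i w \in B)); last by apply/idP/idP; rewrite !inE.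
  rewrite big_cons A'i.
  rewrite (_ : \prod_(j <- r) \1_(A' j) (X j w) = \prod_(j <- r) \1_(A j) (X j w))%R; last first.
    by apply: eq_big_seq => j jr; rewrite A'r.
  by rewrite indicE; case: ifP => _; rewrite ?mul1r// mul0r mulr0.
transitivity (\int[P]_w ((phi i (X i w))%:E * (W w)%:E)).
  by apply: eq_integral => w _; rewrite big_cons -mulrA EFinM.
rewrite -(@ge0_integral_density_map _ _ _ _ _ P
  (mscale (NngNum c0) (pushforward P (X i))) (X i) (EFin \o W) (mX i) _ W0 (key (mX i)) (EFin \o phi i))//; last 2 first.
- exact/measurable_EFinP.
- by move=> y; rewrite lee_fin; have /andP[] := phi01 i y.
rewrite ge0_integral_mscale//; last 2 first.
- exact/measurable_EFinP.
- by move=> y _; rewrite lee_fin; have /andP[] := phi01 i y.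
rewrite ge0_integral_pushforward//; last 2 first.
- exact/measurable_EFinP.
- by move=> y _; rewrite lee_fin; have /andP[] := phi01 i y.
  by rewrite /= fineK// ih// big_cons muleC muleA.
exact/measurable_EFinP.
Qed.

End independent_expectations.

(** * The generating functional of a Poisson process *)

(** The generating functional of a Poisson process of intensity [m], as a
    limit of finite products: the points need not be finitely many, and as [g
    <= 1] the products decrease, so that no infinite product has to be
    defined. For [m] infinite, [g] must be close enough to 1 for the right
    hand side not to degenerate. *)
Definition has_poisson_pgfl d d' (Omega : measurableType d)
    (T : measurableType d') (R : realType) (P : probability Omega R)
    (m : set T -> \bar R) (z : nat -> Omega -> T) : Prop :=
  forall g : T -> R, measurable_fun setT g -> (forall y, (0 <= g y <= 1)%R) ->
    \int[m]_y (1 - g y)%:E < +oo ->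
    (fun M => \int[P]_w (\prod_(i < M) g (z i w))%:E) @ \oo -->
    (expR (- fine (\int[m]_y (1 - g y)%:E)))%:E.

Section pgf.
Context (R : realType).

(** The power of [s] with exponent the number of points of a set, which may be
    infinite; for [s < 1] the exponent +oo gives 0. *)
Definition ereal_pow (s : R) (x : \bar R) : R :=
  fine (\sum_(k <oo) (s ^+ k * \1_[set k%:R%:E] x)%:E).

Lemma ereal_pow_nat (s : R) n : ereal_pow s n%:R%:E = (s ^+ n)%R.
Proof.
rewrite /ereal_pow (_ : \sum_(k <oo) _ = (s ^+ n)%:E)//.
apply: lim_near_cst => //; exists n.+1 => // M /= nM.
rewrite big_mkord (bigD1 (Ordinal nM))//= big1 ?adde0.
  by rewrite indicE mem_set// mulr1.
move=> k /eqP kn; rewrite indicE memNset ?mulr0//= => -[/eqP].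
by rewrite eqr_nat => /eqP nk; apply: kn; apply/val_inj.
Qed.

Lemma ereal_powy (s : R) : ereal_pow s +oo = 0%R.
Proof.
rewrite /ereal_pow eseries0// => k _ _.
by rewrite indicE memNset ?mulr0.
Qed.

Lemma ereal_pow_ninfty (s : R) (x : \bar R) :
  (forall n, x <> n%:R%:E) -> ereal_pow s x = 0%R.
Proof.
move=> xn; rewrite /ereal_pow eseries0// => k _ _.
by rewrite indicE memNset ?mulr0//; exact: xn.
Qed.

Lemma ereal_pow01 (s : R) (x : \bar R) :
  (0 <= s <= 1)%R -> (0 <= ereal_pow s x <= 1)%R.
Proof.
move=> /andP[s0 s1].
have [[n ->]|/forallNP xn] := pselect (exists n, x = n%:R%:E).
  by rewrite ereal_pow_nat exprn_ge0// exprn_ile1.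
by rewrite ereal_pow_ninfty// lexx ler01.
Qed.

Lemma measurable_ereal_pow (s : R) : (0 <= s)%R ->
  measurable_fun setT (ereal_pow s).
Proof.
move=> s0; apply: measurableT_comp => //.
apply: ge0_emeasurable_sum => [k x _ _|k _].
  by rewrite lee_fin mulr_ge0// exprn_ge0.
apply/measurable_EFinP; apply: measurable_funM; first exact: measurable_cst.
by apply: measurable_indic; exact: emeasurable_set1.
Qed.

Lemma cvg_ereal_pow_counting (s : R) (A : set nat) : (0 <= s < 1)%R ->
  (fun M => s ^+ (\sum_(i < M) (val i \in A)))%R @ \oo --> ereal_pow s (counting A).
Proof.
move=> /andP[s0 s1].
have cA : (fun M => (\sum_(i < M) (val i \in A))%:R%:E) @ \oo --> (counting A : \bar R).
  rewrite counting_dirac.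
  rewrite (_ : (fun M => _) = (fun M => \sum_(0 <= i < M) \d_i A)); last first.
    apply/funext => M; rewrite big_mkord natr_sum -sumEFin.
    by apply: eq_bigr => i _; rewrite diracE.
  exact: is_cvg_nneseries.
rewrite /counting in cA *; case: asboolP cA => [fA|_] cA; last first.
  rewrite ereal_powy.
  apply/cvgrPdist_lt => e e0.
  have [N _ HN] : \forall n \near \oo, (`|0 - s ^+ n| < e)%R.
    have : (fun n => s ^+ n)%R @ \oo --> (0:R)%R by apply: cvg_expr; rewrite ger0_norm.
    by move/cvgrPdist_lt; apply.
  move/cvgeyPgt : cA => /(_ N%:R)[K _ HK]; exists K => // M /= /HK /=.
  by rewrite lte_fin ltr_nat => /ltnW /HN.
rewrite ereal_pow_nat.
apply: cvg_near_cst.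
move/fine_cvgP : cA => [_ /cvgrPdist_lt /(_ 1%R ltr01)].
apply: filterS => M /=; rewrite -[(_%:R - _)%R]opprB normrN.
move: (\sum_(i < M) _)%N #|` _|%fset => a b ab.
suff -> : a = b by [].
apply/eqP; rewrite eqn_leq -(ltnS a) -(ltnS b).
move: ab; rewrite ltr_norml => /andP[h1 h2]; apply/andP; split.
  by rewrite -(@ltr_nat R) -[X in (_ < X)%R]natr1; lra.
by rewrite -(@ltr_nat R) -[X in (_ < X)%R]natr1; lra.
Qed.

End pgf.

Lemma cvg_prodr (R : realType) (I : Type) (s : seq I) (u : I -> R^nat)
    (l : I -> R) :
  (forall i, u i @ \oo --> l i) ->
  (fun n => \prod_(i <- s) u i n)%R @ \oo --> (\prod_(i <- s) l i)%R.
Proof.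
move=> ul; elim: s => [|i s ih].
  rewrite big_nil; apply: cvg_near_cst; apply: nearW => n; exact: big_nil.
rewrite big_cons; under eq_fun do rewrite big_cons.
exact: cvgM.
Qed.

Section poisson_pgfl.
Context d d' (Omega : measurableType d) (T : measurableType d') (R : realType).
Variables (P : probability Omega R) (m : {measure set T -> \bar R}).
Variable z : nat -> Omega -> T.
Hypothesis mz : forall i, measurable_fun setT (z i).
Hypothesis poisson_z : poisson_process P m z.

Let measurable_point_count (B : set T) : measurable B ->
  measurable_fun setT (point_count R z B : Omega -> \bar R).
Proof.
move=> mB; rewrite (_ : point_count R z B =
    (fun w => \sum_(n <oo) (\1_B (z n w))%:E)); last first.
  by apply/funext => w; rewrite /point_count counting_dirac.
apply: ge0_emeasurable_sum => [k x _ _|k _]; first by rewrite lee_fin.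
by apply/measurable_EFinP; apply: measurableT_comp => //; exact: measurable_indic.
Qed.

Let expectation_pow_point_count (B : set T) (s : R) :
  measurable B -> m B < +oo -> (0 <= s <= 1)%R ->
  \int[P]_w (ereal_pow s (point_count R z B w))%:E =
  (expR (- ((1 - s) * fine (m B))))%:E.
Proof.
move=> mB mBoo s01; have /andP[s0 s1] := s01.
pose N := point_count R z B : Omega -> \bar R.
have mN : measurable_fun setT N by exact: measurable_point_count.
have E1 w : (ereal_pow s (N w))%:E = \sum_(k <oo) (s ^+ k * \1_(N @^-1` [set k%:R%:E]) w)%:E.
  have [[n Nn]|/forallNP xn] := pselect (exists n, N w = n%:R%:E).
    rewrite Nn ereal_pow_nat; apply/esym.
    apply: lim_near_cst => //; exists n.+1 => // M /= nM.
    rewrite big_mkord (bigD1 (Ordinal nM))//= big1 ?adde0.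
      by rewrite indicE mem_set// mulr1.
    move=> k /eqP kn; rewrite indicE memNset ?mulr0//= Nn => -[/eqP].
    by rewrite eqr_nat => /eqP nk; apply: kn; apply/val_inj.
  rewrite ereal_pow_ninfty// eseries0// => k _ _.
  by rewrite indicE memNset ?mulr0//=; exact: xn.
have mNk k : measurable (N @^-1` [set k%:R%:E]).
  by apply: measurable_preimageT => //; exact: emeasurable_set1.
under eq_integral do rewrite E1.
rewrite integral_nneseries//; last 2 first.
- move=> k; apply/measurable_EFinP; apply: measurable_funM; first exact: measurable_cst.
  exact: measurable_indic.
- by move=> k w _; rewrite lee_fin mulr_ge0// exprn_ge0.
pose a := fine (m B).
have E2 k : \int[P]_w (s ^+ k * \1_(N @^-1` [set k%:R%:E]) w)%:E =
    (expR (- a) * exp_coeff (s * a) k)%:E.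
  under eq_integral do rewrite EFinM.
  rewrite ge0_integralZl//; last 2 first.
  - by apply/measurable_EFinP; exact: measurable_indic.
  - by rewrite lee_fin exprn_ge0.
  rewrite integral_indic ?setIT//.
  have [/(_ B k mB mBoo) PN _] := poisson_z.
  transitivity ((s ^+ k)%:E * (a ^+ k / k`!%:R * expR (- a))%:E).
    by congr (_ * _); exact: PN.
  rewrite -EFinM; congr EFin; rewrite /exp_coeff /= -/a exprMn; ring.
under eq_eseriesr do rewrite E2.
have c : (fun n => \sum_(0 <= i < n) (expR (- a) * exp_coeff (s * a) i)%R%:E) @ \oo -->
    (expR (- a) * expR (s * a))%:E.
  rewrite (_ : (fun n => _) = EFin \o (fun n => expR (- a) * series (exp_coeff (s * a)) n)%R).
    apply: cvg_EFin; first by apply: nearW.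
    by apply: cvgMr; exact: is_cvg_series_exp_coeff.
  by apply/funext => n /=; rewrite sumEFin /series/= mulr_sumr.
rewrite (cvg_lim _ c)// -expRD; congr (expR _)%:E; rewrite -/a; ring.
Qed.

Let poisson_pgfl_simple (n : nat) (B : 'I_n -> set T) (c : 'I_n -> R)
    (f : T -> R) :
  (forall j, measurable (B j)) -> trivIset setT B ->
  (forall j, m (B j) < +oo) -> (forall j, (0 < c j <= 1)%R) ->
  (forall y, (1 - f y = \prod_(j < n) (1 - c j) ^+ (y \in B j))%R) ->
  (fun M => \int[P]_w (\prod_(i < M) (1 - f (z i w)))%:E) @ \oo -->
  (expR (- \sum_(j < n) c j * fine (m (B j))))%:E.
Proof.
move=> mB tB mBoo c01 fE.
have s01 j : (0 <= 1 - c j < 1)%R by have := c01 j; lra.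
have s01' j : (0 <= 1 - c j <= 1)%R by have := c01 j; lra.
pose N j := point_count R z (B j) : Omega -> \bar R.
pose K M j w := (\sum_(i < M) (z i w \in B j))%N.
have prodE M w : (\prod_(i < M) (1 - f (z i w)) = \prod_(j < n) (1 - c j) ^+ K M j w)%R.
  under eq_bigr do rewrite fE.
  by rewrite exchange_big/=; apply: eq_bigr => j _; rewrite expr_sum.
have mK M j : measurable_fun setT (fun w => (1 - c j) ^+ K M j w)%R.
  rewrite (_ : (fun w => _) = (fun w => \prod_(i < M) (1 - c j * \1_(B j) (z i w)))%R); last first.
    apply/funext => w; rewrite expr_sum; apply: eq_bigr => i _; rewrite indicE.
    by case: (_ \in _); rewrite ?expr1 ?expr0 ?mulr1 ?mulr0 ?subr0.
  apply: measurable_prod => // i _; apply: measurable_funB; first exact: measurable_cst.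
  apply: measurable_funM; first exact: measurable_cst.
  by apply: measurableT_comp => //; exact: measurable_indic.
have -> : (expR (- \sum_(j < n) c j * fine (m (B j))))%:E =
    \int[P]_w (\prod_(j < n) ereal_pow (1 - c j) (N j w))%:E.
  rewrite (@expectation_prod_independent _ _ _ _ _ P _ N _ _ (fun j => ereal_pow (1 - c j)))//.
  - under [RHS]eq_bigr do rewrite expectation_pow_point_count//.
    rewrite prodEFin -sumrN expR_sum; congr EFin; apply: eq_bigr => j _.
    by congr expR; ring.
  - by move=> j; exact: measurable_point_count.
  - by have [_ /(_ n B mB tB)] := poisson_z.
  - by move=> j; apply: measurable_ereal_pow; have := c01 j; lra.
  - by move=> j y; exact: ereal_pow01.
  - exact: index_enum_uniq.
have prod01 M w : (0 <= \prod_(i < M) (1 - f (z i w)) <= 1)%R.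
  rewrite prodE; apply/andP; split.
    by apply: prodr_ge0 => j _; rewrite exprn_ge0//; have := c01 j; lra.
  apply: prodr_ile1 => j _; have /andP[h1 h2] := s01' j.
  by rewrite exprn_ge0//= exprn_ile1.
have mprod M : measurable_fun setT (fun w => \prod_(i < M) (1 - f (z i w)))%R.
  under eq_fun do rewrite prodE.
  exact: measurable_prod.
apply: (@dominated_cvg _ _ _ P setT measurableT _ _ (cst 1)) => //.
- by move=> M; exact/measurable_EFinP.
- move=> w _; apply: cvg_EFin; first exact: nearW.
  rewrite [X in X @ _ --> _](_ : _ = (fun M => \prod_(j < n) (1 - c j) ^+ K M j w)%R); last first.
    by apply/funext => M /=; rewrite prodE.
  apply: cvg_prodr => j.
  exact: cvg_ereal_pow_counting.
- by apply: finite_measure_integrable_cst.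
- move=> M w _ /=; rewrite lee_fin ger0_norm; by have /andP[] := prod01 M w.
Qed.

Let poisson_pgfl_nnsfun (f : {nnsfun T >-> R}) :
  (forall y, (f y <= 1)%R) -> \int[m]_y (f y)%:E < +oo ->
  (fun M => \int[P]_w (\prod_(i < M) (1 - f (z i w)))%:E) @ \oo -->
  (expR (- fine (\int[m]_y (f y)%:E)))%:E.
Proof.
move=> f1 foo; pose rs := [seq r <- fset_set (range f) | r != 0%R].
have urs : uniq rs by apply: filter_uniq; exact: fset_uniq.
have rsP y : (f y \in rs) = (f y != 0%R).
  by rewrite mem_filter in_fset_set// mem_set ?andbT//; exists y.
pose c (j : 'I_(size rs)) := nth 0%R rs j.
pose B (j : 'I_(size rs)) := f @^-1` [set c j].
have c01 j : (0 < c j <= 1)%R.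
  have : c j \in rs by rewrite mem_nth.
  rewrite mem_filter in_fset_set// => /andP[c0 /set_mem[y _ fy]].
  by rewrite -fy f1 andbT lt_neqAle eq_sym fy c0 -fy fun_ge0.
have mB j : measurable (B j).
  by apply: measurable_preimageT => //; exact: measurable_set1.
have fE : \int[m]_y (f y)%:E = \sum_(j < size rs) (c j)%:E * m (B j).
  rewrite integral_nnsfun// patch_setT sintegralE fsbig_finite//=.
  rewrite (bigID (fun r => r != 0%R))/= [X in _ + X]big1 ?adde0; last first.
    by move=> r /negPn/eqP ->; rewrite mul0e.
  by rewrite -big_filter (big_nth 0%R) big_mkord.
have mBoo j : m (B j) < +oo.
  have cB : (c j)%:E * m (B j) < +oo.
    apply: le_lt_trans foo; rewrite fE (bigD1 j)//= leeDl// sume_ge0// => k _.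
    by rewrite mule_ge0// lee_fin ltW//; have /andP[] := c01 k.
  rewrite ltNge leye_eq; apply/eqP => mBj; move: cB; rewrite mBj gt0_muley ?ltxx//.
  by rewrite lte_fin; have /andP[] := c01 j.
have -> : fine (\int[m]_y (f y)%:E) = (\sum_(j < size rs) c j * fine (m (B j)))%R.
  rewrite fE (eq_bigr (fun j => (c j * fine (m (B j)))%:E)) ?sumEFin// => j _.
  by rewrite EFinM fineK// ge0_fin_numE.
apply: poisson_pgfl_simple => //.
- apply/trivIsetP => j k _ _ jk; apply/seteqP; split => // y [/= fyj fyk].
  have /eqP : c j = c k by rewrite -fyj -fyk.
  by rewrite nth_uniq// => /eqP jk'; case/eqP: jk; exact/val_inj.
- move=> y; have [fy0|fy0] := eqVneq (f y) 0%R.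
    rewrite fy0 subr0 big1// => j _; rewrite memNset ?expr0//= /B /= fy0 => cj.
    by have /andP[] := c01 j; rewrite -cj ltxx.
  have yrs : f y \in rs by rewrite rsP.
  have ylt : (index (f y) rs < size rs)%N by rewrite index_mem.
  have cy : c (Ordinal ylt) = f y by rewrite /c /= nth_index.
  rewrite (bigD1 (Ordinal ylt))//= mem_set ?expr1 ?cy//= big1 ?mulr1// => j /eqP jy.
  rewrite memNset ?expr0//= /B /= -cy /c => /eqP; rewrite nth_uniq// => /eqP h.
  by apply: jy; apply/val_inj.
Qed.

(** For [g] simple with values s_j the product is the product of the [s_j ^+
    N_j], whose factors are independent with means exp(- (1 - s_j) m_j), by
    the Poisson counts [N_j] of the level sets. A general [g] is a limit of
    simple functions, and the limits in [g] and in the number of factors may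
    be exchanged since both are monotone. *)
Lemma poisson_has_pgfl : has_poisson_pgfl P m z.
Proof.
move=> g mg g01 goo; pose f y := (1 - g y)%:E.
have mf : measurable_fun setT f.
  by apply/measurable_EFinP; apply: measurable_funB => //; exact: measurable_cst.
have f0 y : 0 <= f y by rewrite lee_fin subr_ge0; have /andP[] := g01 y.
pose f_ := nnsfun_approx measurableT mf.
have f_f y : (fun k => (f_ k y)%:E) @ \oo --> f y by exact: cvg_nnsfun_approx.
have ndf y : nondecreasing_seq (fun k => (f_ k y)%:E).
  by move=> a b ab; rewrite lee_fin; exact/lefP/nd_nnsfun_approx.
have f_le k y : (f_ k y)%:E <= f y by exact: nondecreasing_le_cvg (f_f y).
have f_le1 k y : (f_ k y <= 1)%R.
  rewrite -lee_fin (le_trans (f_le k y))// lee_fin lerBlDr lerDl.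
  by have /andP[] := g01 y.
have mf_ k : measurable_fun setT (EFin \o f_ k).
  by apply/measurable_EFinP; exact: measurable_funP.
have If_oo k : \int[m]_y (f_ k y)%:E < +oo.
  by apply: le_lt_trans goo; apply: ge0_le_integral => [//|y _|||y _]; [by rewrite lee_fin|exact: mf_|exact: mf|exact: f_le].
have mprod (h : T -> R) : measurable_fun setT h ->
    forall M, measurable_fun setT (fun w => \prod_(i < M) (h (z i w)))%R.
  by move=> mh M; apply: measurable_prod => // i _; exact: measurableT_comp.
pose e M k := \int[P]_w (\prod_(i < M) (1 - f_ k (z i w)))%:E.
have p01 k M w : (0 <= \prod_(i < M) (1 - f_ k (z i w)) <= 1)%R.
  rewrite prodr_ge0 ?prodr_ile1//= => i _; last by rewrite subr_ge0.
  by rewrite subr_ge0 f_le1 lerBlDr lerDl fun_ge0.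
have mp k M : measurable_fun setT (fun w => (\prod_(i < M) (1 - f_ k (z i w)))%:E).
  apply/measurable_EFinP; apply: (mprod (fun y => 1 - f_ k y)%R).
  by apply: measurable_funB => //; exact: measurable_cst.
apply: (@nonincreasing_limits_interchange _ e _
    (fun k => (expR (- fine (\int[m]_y (f_ k y)%:E)))%:E)).
- move=> k M M' MM'; apply: ge0_le_integral; [exact: measurableT| |exact: mp|exact: mp|].
  + by move=> w _; rewrite lee_fin; have /andP[] := p01 k M' w.
  + move=> w _; rewrite lee_fin -!(big_mkord xpredT (fun i => 1 - f_ k (z i w))%R).
    rewrite (big_cat_nat (leq0n M) MM')/= ler_piMr//.
      by rewrite big_mkord; have /andP[] := p01 k M w.
    by apply: prodr_ile1 => i _; rewrite subr_ge0 f_le1 lerBlDr lerDl fun_ge0.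
- move=> M k k' kk'; apply: ge0_le_integral; [exact: measurableT| |exact: mp|exact: mp|].
  + by move=> w _; rewrite lee_fin; have /andP[] := p01 k' M w.
  + move=> w _; rewrite lee_fin; apply: ler_prod => i _.
    by rewrite subr_ge0 f_le1/= lerB// -lee_fin; exact: ndf.
- by move=> k; exact: poisson_pgfl_nnsfun.
- move=> M; apply: (@dominated_cvg _ _ _ P setT measurableT _ _ (cst 1)) => //.
  + move=> w _; apply: cvg_EFin; first exact: nearW.
    apply: (@cvg_prodr R 'I_M (index_enum _) (fun (i : 'I_M) k => 1 - f_ k (z i w))%R (fun i : 'I_M => g (z i w))) => i.
    rewrite -[g (z i w)](subKr 1%R); apply: cvgB; first exact: cvg_cst.
    by have /fine_cvgP[_] := f_f (z i w).
  + by apply: finite_measure_integrable_cst.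
  + by move=> k w _; rewrite lee_fin ger0_norm; have /andP[] := p01 k M w.
- apply: cvg_EFin; first exact: nearW.
  apply: (@cvg_comp _ _ _ (fun k => - fine (\int[m]_y (f_ k y)%:E))%R expR _ (nbhs (- fine (\int[m]_y f y))%R)); last exact: continuous_expR.
  apply: cvgN; apply: fine_cvg; rewrite fineK; last first.
    by rewrite ge0_fin_numE// integral_ge0.
  have := @cvg_monotone_convergence _ _ _ m setT measurableT (fun k y => (f_ k y)%:E).
  rewrite (_ : \int[m]_x limn _ = \int[m]_y f y); last first.
    by apply: eq_integral => y _; apply/cvg_lim.
  by apply=> // k y _; rewrite lee_fin.
Qed.

End poisson_pgfl.

(** * Images and independent markings *)

Section pgfl_image.
Context d d1 d2 (Omega : measurableType d) (T1 : measurableType d1)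
  (T2 : measurableType d2) (R : realType) (P : probability Omega R).
Variables (m1 : set T1 -> \bar R) (m2 : set T2 -> \bar R).
Variables (z : nat -> Omega -> T1) (phi : T1 -> T2).

Lemma has_poisson_pgfl_map :
  measurable_fun setT phi ->
  (forall h : T2 -> \bar R, measurable_fun setT h -> (forall y, 0 <= h y) ->
    \int[m2]_y h y = \int[m1]_y h (phi y)) ->
  has_poisson_pgfl P m1 z ->
  has_poisson_pgfl P m2 (fun i w => phi (z i w)).
Proof.
move=> mphi m2E pz g mg g01.
rewrite m2E; last 2 first.
- by apply/measurable_EFinP; apply: measurable_funB => //; exact: measurable_cst.
- by move=> y; rewrite lee_fin subr_ge0; have /andP[] := g01 y.
move=> goo; apply: (pz (fun y => g (phi y))) => //.
exact: measurableT_comp.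
Qed.

End pgfl_image.

Section independent_sigma_algebras.
Context d (Omega : measurableType d) (R : realType) (P : probability Omega R).
Variables (G H : set_system Omega).
Hypotheses (mG : G `<=` measurable) (mH : H `<=` measurable).
Hypothesis indGH : independent2 P <<s G >> <<s H >>.

Let GT : measurableType _ := g_sigma_algebraType G.
Let HT : measurableType _ := g_sigma_algebraType H.

Let measurable_idG : measurable_fun setT (id : Omega -> GT).
Proof.
move=> _ A mA; rewrite setTI; apply: mA; split => //.
exact: sigma_algebra_measurable.
Qed.

Let measurable_idH : measurable_fun setT (id : Omega -> HT).
Proof.
move=> _ A mA; rewrite setTI; apply: mA; split => //.
exact: sigma_algebra_measurable.
Qed.

(** Independence of two sigma-algebras says that the diagonal map sends [P] to
    a product measure on the square of the sample space, one factor carrying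
    each of the two sigma-algebras; hence the two occurrences of [w] may be
    integrated separately. *)
Lemma ge0_integral_independent2 (h : Omega -> Omega -> \bar R) :
  measurable_fun setT (fun ww : GT * HT => h ww.1 ww.2) ->
  (forall w w', 0 <= h w w') ->
  \int[P]_w h w w = \int[P]_w \int[P]_w' h w w'.
Proof.
move=> mh h0.
pose iG : {mfun Omega >-> GT} := mfun_Sub (mem_set measurable_idG).
pose iH : {mfun Omega >-> HT} := mfun_Sub (mem_set measurable_idH).
have mdiag : @measurable_fun _ _ Omega (GT * HT)%type [set: Omega] (fun w : Omega => (w, w)).
  by apply/measurable_fun_pairP; split.
pose iGH : {mfun Omega >-> (GT * HT)%type} := mfun_Sub (mem_set mdiag).
have prodE : forall X : set (GT * HT), measurable X ->
    (distribution P iG \x distribution P iH) X = distribution P iGH X.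
  apply: product_measure_unique => A B mA mB.
  exact: indGH.
transitivity (\int[distribution P iGH]_ww h ww.1 ww.2).
  by rewrite ge0_integral_pushforward.
transitivity (\int[distribution P iG \x distribution P iH]_ww h ww.1 ww.2).
  by apply: eq_measure_integral => X mX _; exact/esym/prodE.
rewrite fubini_tonelli1//.
rewrite ge0_integral_pushforward//; last 2 first.
- by apply: measurable_fun_fubini_tonelli_F.
- by move=> w _; apply: integral_ge0 => *; exact: h0.
apply: eq_integral => w _; rewrite /= /fubini_F ge0_integral_pushforward//.
- by apply: measurableT_comp mh _; exact: measurable_pair1.
Qed.

End independent_sigma_algebras.

Section marking.
Context d d1 d2 (Omega : measurableType d) (T1 : measurableType d1)
  (T2 : measurableType d2) (R : realType) (P : probability Omega R).
Variables (m : {sigma_finite_measure set T1 -> \bar R}) (Q : probability T2 R).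
Variables (z : nat -> Omega -> T1) (S : nat -> Omega -> T2).
Hypotheses (mz : forall i, measurable_fun setT (z i))
           (mS : forall i, measurable_fun setT (S i)).
Hypothesis lawS : forall i A, measurable A -> P (S i @^-1` A) = Q A.
Hypothesis indS : mutually_independent P (fun i => g_sigma_algebra_preimage (S i)).
Hypothesis indzS : independent2 P (g_sigma_algebra_family z) (g_sigma_algebra_family S).

Let g_family_measurable d' (T : measurableType d') (X : nat -> Omega -> T) :
  (forall i, measurable_fun setT (X i)) ->
  (\bigcup_i g_sigma_algebra_preimage (X i)) `<=` measurable.
Proof.
by move=> mX A [i _ [B mB <-]]; exact: mX.
Qed.

Let measurable_g_family d' (T : measurableType d') (X : nat -> Omega -> T) i :
  measurable_fun setT
    (X i : g_sigma_algebraType (\bigcup_i g_sigma_algebra_preimage (X i)) -> T).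
Proof.
by move=> _ A mA; apply: sub_sigma_algebra; exists i => //; exists A.
Qed.

(** Marking: given the points, the factors [g (z i, S i)] are independent, so
    that the generating functional of the marked points is the one of the
    unmarked points at the average of [g] over the marks. *)
Lemma has_poisson_pgfl_marking :
  has_poisson_pgfl P m z ->
  has_poisson_pgfl P (m \x Q) (fun i w => (z i w, S i w)).
Proof.
move=> pz g mg g01 goo.
have g0 x y : 0 <= (g (x, y))%:E by rewrite lee_fin; have /andP[] := g01 (x, y).
have mgx x : measurable_fun setT (fun y => g (x, y)).
  by apply: measurableT_comp mg _; exact: measurable_pair1.
pose gb x := fine (\int[Q]_y (g (x, y))%:E).
have gbE x : (gb x)%:E = \int[Q]_y (g (x, y))%:E.
  by rewrite fineK// integral_probability_fin_num.
have gb01 x : (0 <= gb x <= 1)%R.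
  by rewrite -!lee_fin gbE; apply: ge0_integral_probability_le1.
have mgb : measurable_fun setT gb.
  apply: measurableT_comp => //.
  apply: (measurable_fun_fubini_tonelli_F (m2 := Q) (EFin \o g)).
    exact/measurable_EFinP.
  by move=> [x y]; exact: g0.
have prodE M : \int[P]_w (\prod_(i < M) g (z i w, S i w))%:E =
    \int[P]_w (\prod_(i < M) gb (z i w))%:E.
  rewrite (@ge0_integral_independent2 _ _ _ P
    (\bigcup_i g_sigma_algebra_preimage (z i)) (\bigcup_i g_sigma_algebra_preimage (S i)) _ _ _
    (fun w w' => (\prod_(i < M) g (z i w, S i w'))%:E))//; last 4 first.
  - exact: g_family_measurable.
  - exact: g_family_measurable.
  - apply/measurable_EFinP; apply: measurable_prod => // i _.
    apply: (measurableT_comp mg); apply: measurable_fun_pair.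
      by apply: (measurableT_comp (@measurable_g_family _ _ z i)); exact: measurable_fst.
    by apply: (measurableT_comp (@measurable_g_family _ _ S i)); exact: measurable_snd.
  - by move=> w w'; rewrite lee_fin; apply: prodr_ge0 => i _; have /andP[] := g01 (z i w, S i w').
  apply: eq_integral => w _.
  under eq_integral do rewrite -(big_mkord xpredT (fun i => g (z i w, S i _))).
  rewrite (expectation_prod_independent mS indS (phi := fun i y => g (z i w, y)))//; last exact: iota_uniq.
  rewrite big_mkord -prodEFin; apply: eq_bigr => i _; rewrite gbE.
  rewrite -(@ge0_integral_pushforward _ _ _ _ _ (S i) (mS i) P setT (fun y => (g (z i w, y))%:E))//.
  - by apply: eq_measure_integral => A mA _; exact: lawS.
  - exact/measurable_EFinP.
under eq_fun do rewrite prodE.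
have oneB x : (1 - gb x)%:E = \int[Q]_y (1 - g (x, y))%:E.
  under [RHS]eq_integral do rewrite EFinB.
  rewrite integralB_EFin//; last 2 first.
  - by apply: finite_measure_integrable_cst.
  - apply/integrableP; split; first exact/measurable_EFinP.
    rewrite (eq_integral (fun y => (g (x, y))%:E)); first by rewrite -gbE ltry.
    by move=> y _ /=; rewrite ger0_norm// -lee_fin.
  rewrite -gbE EFinB; congr (_ - _).
  transitivity (\int[Q]_y (cst 1 y)) => //.
  by rewrite integral_cst// mul1e; apply/esym; exact: probability_setT.
have intE : \int[m \x Q]_y (1 - g y)%:E = \int[m]_x (1 - gb x)%:E.
  rewrite fubini_tonelli1//.
  - by apply: eq_integral => x _; rewrite oneB.
  - by apply/measurable_EFinP; apply: measurable_funB => //; exact: measurable_cst.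
  - by move=> y; rewrite lee_fin subr_ge0; have /andP[] := g01 y.
rewrite intE in goo *.
exact: pz.
Qed.

End marking.

(** * Moments of a point process from its generating functional *)

Section discounted_sums.
Context (R : realType).
Implicit Types (s : R) (a : nat -> R).

(** [(1 - \prod_(i < M) (1 - s * a i)) / s] in a form that still makes sense at
    [s = 0], where it is the plain sum of the [a i]. *)
Definition discounted_sum s a M : R :=
  (\sum_(i < M) a i * \prod_(k < i) (1 - s * a k))%R.

Lemma discounted_sumE s a M :
  (s * discounted_sum s a M = 1 - \prod_(i < M) (1 - s * a i))%R.
Proof.
elim: M => [|M ih]; first by rewrite /discounted_sum !big_ord0 mulr0 subrr.
rewrite /discounted_sum !big_ord_recr/= mulrDr -/(discounted_sum _ _ _) ih.
ring.
Qed.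

Lemma discounted_sum0 a M : discounted_sum 0 a M = (\sum_(i < M) a i)%R.
Proof.
apply: eq_bigr => i _; rewrite big1 ?mulr1// => k _.
by rewrite mul0r subr0.
Qed.

Section bounds.
Variable a : nat -> R.
Hypothesis a01 : forall i, (0 <= a i <= 1)%R.

Let factor01 s i : (0 <= s <= 1)%R -> (0 <= 1 - s * a i <= 1)%R.
Proof.
move=> s01; have := a01 i; move: (a i) => x x01.
by apply/andP; split; nra.
Qed.

Lemma discounted_sum_ge0 s M : (0 <= s <= 1)%R -> (0 <= discounted_sum s a M)%R.
Proof.
move=> s01; apply: sumr_ge0 => i _; rewrite mulr_ge0//.
  by have /andP[] := a01 i.
by apply: prodr_ge0 => k _; have /andP[] := factor01 k s01.
Qed.

Lemma discounted_sum_homo s : (0 <= s <= 1)%R -> nondecreasing_seq (discounted_sum s a).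
Proof.
move=> s01; apply/nondecreasing_seqP => M.
rewrite /discounted_sum big_ord_recr/= lerDl mulr_ge0//.
  by have /andP[] := a01 M.
by apply: prodr_ge0 => k _; have /andP[] := factor01 k s01.
Qed.

Lemma discounted_sum_anti s s' M : (0 <= s)%R -> (s <= s' <= 1)%R ->
  (discounted_sum s' a M <= discounted_sum s a M)%R.
Proof.
move=> s0 ss'; apply: ler_sum => i _; rewrite ler_wpM2l//.
  by have /andP[] := a01 i.
apply: ler_prod => k _; have := a01 k; move: (a k) => x x01.
by apply/andP; split; nra.
Qed.

Lemma discounted_sum_le s M : (0 < s <= 1)%R -> (discounted_sum s a M <= s^-1)%R.
Proof.
move=> /andP[s0 s1]; rewrite -[leRHS]mulr1 ler_pdivlMl// discounted_sumE gerBl.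
by apply: prodr_ge0 => k _; have s01 : (0 <= s <= 1)%R; [rewrite s1 ltW|have /andP[] := factor01 k s01].
Qed.

End bounds.

Lemma cvg_discounted_sum (s_ : R^nat) a M : s_ @ \oo --> (0 : R)%R ->
  (fun n => discounted_sum (s_ n) a M) @ \oo --> (\sum_(i < M) a i)%R.
Proof.
move=> s0; rewrite -discounted_sum0 /discounted_sum.
elim: M => [|M ih].
  under eq_fun do rewrite big_ord0.
  by rewrite big_ord0; exact: cvg_cst.
under eq_fun do rewrite big_ord_recr/=.
rewrite big_ord_recr/=; apply: cvgD => //; apply: cvgMr.
apply: (@cvg_prodr R 'I_M (index_enum _) (fun (k : 'I_M) n => 1 - s_ n * a k)%R (fun k : 'I_M => 1 - 0 * a k)%R) => k.
by apply: cvgB; [exact: cvg_cst|exact: cvgMl].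
Qed.

Lemma cvg_one_minus_expR (m : R) : (0 <= m)%R ->
  (fun n => n.+1%:R * (1 - expR (- (n.+1%:R^-1 * m))))%R @ \oo --> m.
Proof.
move=> m0.
have h n : (m - m ^+ 2 * n.+1%:R^-1 <= n.+1%:R * (1 - expR (- (n.+1%:R^-1 * m))) <= m)%R.
  have n0 : (0 < n.+1%:R :> R)%R by rewrite ltr0n.
  set x := (n.+1%:R^-1 * m)%R.
  have mE : m = (n.+1%:R * x)%R by rewrite /x mulrA mulfV ?mul1r// gt_eqF.
  have x0 : (0 <= x)%R by rewrite mulr_ge0// invr_ge0 ltW.
  have e1 : (1 + - x <= expR (- x))%R by exact: expR_ge1Dx.
  have e2 : (1 + x <= expR x)%R by exact: expR_ge1Dx.
  have e3 : (expR (- x) <= 1 - x + x ^+ 2)%R.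
    rewrite expRN -[leLHS]mul1r ler_pdivrMr ?expR_gt0//.
    apply: (@le_trans _ _ ((1 - x + x ^+ 2) * (1 + x))%R); first by nra.
    by rewrite ler_wpM2l//; nra.
  have -> : (m - m ^+ 2 * n.+1%:R^-1 = n.+1%:R * (x - x ^+ 2))%R.
    by rewrite mE; field; rewrite gt_eqF// ltr0n.
  apply/andP; split; last rewrite [X in (_ <= X)%R]mE; rewrite ler_wpM2l ?(ltW n0)//; nra.
apply: (@squeeze_cvgr _ _ _ _ (fun n => m - m ^+ 2 * n.+1%:R^-1)%R (cst m)).
- exact: nearW.
- rewrite -[X in _ --> X]subr0 -[X in (_ - X)%R](mulr0 (m ^+ 2)%R).
  apply: cvgB; first exact: cvg_cst.
  by apply: cvgMr; exact: cvg_harmonic.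
- exact: cvg_cst.
Qed.

End discounted_sums.

(** The squares [0, M[ x [0, M[ exhaust the pairs of indices. *)
Lemma nneseries_square (R : realType) (x : nat -> nat -> \bar R) (r : \bar R) :
  (forall i j, 0 <= x i j) ->
  (fun M => \sum_(i < M) \sum_(j < M) x i j) @ \oo --> r ->
  \sum_(i <oo) \sum_(j <oo) x i j = r.
Proof.
move=> x0 xr.
have nds : nondecreasing_seq (fun M => \sum_(i < M) \sum_(j < M) x i j).
  apply/nondecreasing_seqP => M.
  rewrite [leRHS]big_ord_recr/= -[leLHS]adde0; apply: leeD; last exact: sume_ge0.
  by apply: lee_sum => i _; rewrite [leRHS]big_ord_recr/= leeDl.
have sr M : \sum_(i < M) \sum_(j < M) x i j <= r by exact: nondecreasing_le_cvg xr.
have le_rect M N : \sum_(i < M) \sum_(j < N) x i j <= r.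
  apply: le_trans (sr (maxn M N)).
  rewrite -(big_mkord xpredT (fun i => \sum_(j < N) x i j)).
  rewrite -(big_mkord xpredT (fun i => \sum_(j < maxn M N) x i j)).
  rewrite [leRHS](big_cat_nat (leq0n M) (leq_maxl M N))/=.
  rewrite -[leLHS]adde0; apply: leeD; last by apply: sume_ge0 => i _; exact: sume_ge0.
  apply: lee_sum => i _.
  rewrite -(big_mkord xpredT (fun j => x i j)) -[leRHS](big_mkord xpredT (fun j => x i j)).
  rewrite [leRHS](big_cat_nat (leq0n N) (leq_maxr M N))/= leeDl//.
  exact: sume_ge0.
apply/eqP; rewrite eq_le; apply/andP; split.
  apply: lime_le.
    by apply: is_cvg_nneseries => i _ _; exact: nneseries_ge0.
  apply: nearW => M; rewrite big_mkord.
  rewrite -nneseries_sum//; apply: lime_le.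
    by apply: is_cvg_nneseries => j _ _; exact: sume_ge0.
  by apply: nearW => N; rewrite big_mkord exchange_big/=; exact: le_rect.
rewrite -(cvg_lim _ xr)//; apply: lime_le; first by apply/cvg_ex; exists r.
apply: nearW => M.
apply: (@le_trans _ _ (\sum_(i < M) \sum_(j <oo) x i j)).
  apply: lee_sum => i _; rewrite -(big_mkord xpredT (x i)).
  by apply: nneseries_lim_ge.
rewrite -(big_mkord xpredT (fun i => \sum_(j <oo) x i j)).
by apply: nneseries_lim_ge => i _ _; exact: nneseries_ge0.
Qed.

Section product_moment.
Context d (Omega : measurableType d) (R : realType) (P : probability Omega R).
Variables a b c : nat -> set Omega.
Hypotheses (ma : forall i, measurable (a i)) (mb : forall i, measurable (b i))
  (mc : forall i, measurable (c i)).

Let A n M (w : Omega) : R :=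
  discounted_sum n.+1%:R^-1 (fun i => \1_(a i) w) M.
Let B n M (w : Omega) : R :=
  discounted_sum n.+1%:R^-1 (fun i => \1_(b i) w) M.
Let V M (w : Omega) : R := (\prod_(i < M) (1 - \1_(c i) w))%R.
Let Voo (w : Omega) : R := \1_(~` \bigcup_i c i) w.

Let indic01 (s : set Omega) (w : Omega) : (0 <= (\1_s w : R) <= 1)%R.
Proof. by rewrite indicE; case: (_ \in _); rewrite ?lexx ler01. Qed.

Let invn01 n : (0 < (n.+1%:R^-1 : R) <= 1)%R.
Proof. by rewrite invr_gt0 ltr0n/= invf_le1// ler1n. Qed.

Let invn01' n : (0 <= (n.+1%:R^-1 : R) <= 1)%R.
Proof. by have := invn01 n => /andP[/ltW -> ->]. Qed.

Let invn_anti n n' : (n <= n')%N -> ((n'.+1%:R^-1 : R) <= (n.+1%:R^-1 : R) <= 1)%R.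
Proof.
by move=> nn'; have /andP[_ ->] := invn01 n; rewrite andbT lef_pV2 ?posrE ?ltr0n// ler_nat.
Qed.

Let measurable_discounted (s : nat -> set Omega) n M :
  (forall i, measurable (s i)) ->
  measurable_fun setT (fun w => discounted_sum n.+1%:R^-1 (fun i => \1_(s i) w : R) M).
Proof.
move=> ms; apply: measurable_sum => i.
apply: measurable_funM; first exact: measurable_indic.
apply: measurable_prod => // k _; apply: measurable_funB; first exact: measurable_cst.
by apply: measurable_funM; [exact: measurable_cst|exact: measurable_indic].
Qed.

Let mV M : measurable_fun setT (V M).
Proof.
apply: measurable_prod => // k _; apply: measurable_funB; first exact: measurable_cst.
exact: measurable_indic.
Qed.

Let mVoo : measurable_fun setT Voo.
Proof.
by apply: measurable_indic; apply: measurableC; exact: bigcupT_measurable.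
Qed.

Let V01 M w : (0 <= V M w <= 1)%R.
Proof.
rewrite prodr_ge0 ?prodr_ile1//= => i _; have := indic01 (c i) w; lra.
Qed.

Let Voo_le M w : (Voo w <= V M w)%R.
Proof.
rewrite /Voo indicE; have [/set_mem h|_] := boolP (w \in _); last first.
  by have /andP[] := V01 M w.
rewrite /V big1// => i _; rewrite indicE memNset ?subr0// => ci.
by apply: h; exists i.
Qed.

Let cvgV w : (V ^~ w) @ \oo --> Voo w.
Proof.
apply: cvg_near_cst; rewrite /Voo indicE.
have [/set_mem h|/negP h] := boolP (w \in _).
  apply: nearW => M; rewrite /V big1// => i _; rewrite indicE memNset ?subr0// => ci.
  by apply: h; exists i.
have {h} [i _ ciw] : (\bigcup_i c i) w by apply: contrapT => ?; apply: h; rewrite inE.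
exists i.+1 => // M /= iM; rewrite /V (bigD1 (Ordinal iM))//= indicE mem_set//.
by rewrite subrr mul0r.
Qed.

Let A0 n M w : (0 <= A n M w)%R.
Proof. by apply: discounted_sum_ge0 => // i; exact: indic01. Qed.

Let B0 n M w : (0 <= B n M w)%R.
Proof. by apply: discounted_sum_ge0 => // i; exact: indic01. Qed.

Let AV n M w : (A n M w <= n.+1%:R)%R.
Proof.
rewrite -[leRHS]invrK; apply: discounted_sum_le => // i; exact: indic01.
Qed.

Let BV n M w : (B n M w <= n.+1%:R)%R.
Proof.
rewrite -[leRHS]invrK; apply: discounted_sum_le => // i; exact: indic01.
Qed.

Let Voo0 w : (0 <= Voo w)%R.
Proof. by have /andP[] := indic01 (~` \bigcup_i c i) w. Qed.

Let prod_moment_limit (r_ : R^nat) n :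
  (fun M => \int[P]_w (A n M w * B n M w * V M w)%:E) @ \oo --> (r_ n)%:E ->
  (fun M => \int[P]_w (A n M w * B n M w * Voo w)%:E) @ \oo --> (r_ n)%:E.
Proof.
move=> Hr.
pose D M w := (A n M w * B n M w * (V M w - Voo w))%R.
have mA M : measurable_fun setT (A n M) by exact: measurable_discounted.
have mB M : measurable_fun setT (B n M) by exact: measurable_discounted.
have mD M : measurable_fun setT (D M).
  by apply: measurable_funM; [exact: measurable_funM|exact: measurable_funB].
have mABV M : measurable_fun setT (fun w => A n M w * B n M w * Voo w)%R.
  by apply: measurable_funM => //; exact: measurable_funM.
have D0 M w : (0 <= D M w)%R by rewrite mulr_ge0 ?mulr_ge0// subr_ge0.
have ABV0 M w : (0 <= A n M w * B n M w * Voo w)%R by rewrite !mulr_ge0.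
have Dle M w : (D M w <= n.+1%:R * n.+1%:R)%R.
  rewrite -[leRHS]mulr1 ler_pM// ?mulr_ge0// ?subr_ge0//; first by rewrite ler_pM.
  by have := V01 M w; have := Voo0 w; lra.
have splitE M : \int[P]_w (A n M w * B n M w * V M w)%:E =
    \int[P]_w (A n M w * B n M w * Voo w)%:E + \int[P]_w (D M w)%:E.
  rewrite -ge0_integralD//; last 4 first.
  - by move=> w _; rewrite lee_fin.
  - exact/measurable_EFinP.
  - by move=> w _; rewrite lee_fin.
  - exact/measurable_EFinP.
  by apply: eq_integral => w _; rewrite -EFinD /D; congr EFin; ring.
have Doo : (fun M => \int[P]_w (D M w)%:E) @ \oo --> 0.
  rewrite -(@integral0 _ _ _ P setT).
  apply: (@dominated_cvg _ _ _ P setT measurableT _ _ (cst (n.+1%:R * n.+1%:R)%:E)) => //.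
  - by move=> M; exact/measurable_EFinP.
  - move=> w _; apply: cvg_EFin; first exact: nearW.
    apply: (@squeeze_cvgr _ _ _ _ (cst 0%R) (fun M => n.+1%:R * n.+1%:R * (V M w - Voo w))%R).
    + apply: nearW => M /=; rewrite D0 /D /= ler_wpM2r ?subr_ge0//.
      by rewrite ler_pM.
    + exact: cvg_cst.
    + rewrite -[X in _ --> X](mulr0 (n.+1%:R * n.+1%:R)%R) -(subrr (Voo w)).
      by apply: cvgMr; apply: cvgB => //; exact: cvg_cst.
  - by apply: finite_measure_integrable_cst.
  - by move=> M w _ /=; rewrite lee_fin ger0_norm.
have Dfin M : \int[P]_w (D M w)%:E \is a fin_num.
  rewrite ge0_fin_numE ?integral_ge0//; last by move=> w _; rewrite lee_fin.
  apply: (@le_lt_trans _ _ (\int[P]_w (cst (n.+1%:R * n.+1%:R)%:E w))).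
    apply: ge0_le_integral => [//|w _|||w _]; rewrite ?lee_fin//.
    exact/measurable_EFinP.
  rewrite integral_cst// ltey_eq; apply/orP; left.
  by rewrite fin_numM// fin_num_measure.
rewrite (_ : (fun M => _) = (fun M => \int[P]_w (A n M w * B n M w * V M w)%:E - \int[P]_w (D M w)%:E)); last first.
  by apply/funext => M; rewrite splitE addeK.
by rewrite -[X in _ --> X]sube0; apply: cvgeB.
Qed.

(** The number of [i] with [w \in a i] is not bounded, but the discounted sums
    are, and they increase to it as the discount rate tends to [0]. *)
Lemma product_moment (r_ : R^nat) (r : R) :
  (forall n, (fun M => \int[P]_w
    (discounted_sum n.+1%:R^-1 (fun i => \1_(a i) w) M *
     discounted_sum n.+1%:R^-1 (fun i => \1_(b i) w) M *
     \prod_(i < M) (1 - \1_(c i) w))%:E) @ \oo --> (r_ n)%:E) ->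
  r_ @ \oo --> r ->
  \sum_(i <oo) \sum_(j <oo) P (a i `&` b j `&` ~` \bigcup_k c k) = r%:E.
Proof.
move=> Hr rr.
have mI i j : measurable (a i `&` b j `&` ~` \bigcup_k c k).
  apply: measurableI; first exact: measurableI.
  by apply: measurableC; exact: bigcupT_measurable.
apply: nneseries_square => //.
have IE M : \sum_(i < M) \sum_(j < M) P (a i `&` b j `&` ~` \bigcup_k c k) =
    \int[P]_w ((\sum_(i < M) \1_(a i) w) * (\sum_(j < M) \1_(b j) w) * Voo w)%:E.
  transitivity (\int[P]_w (\sum_(i < M) \sum_(j < M) (\1_(a i `&` b j `&` ~` \bigcup_k c k) w)%:E)).
    rewrite ge0_integral_sum//; last first.
    - by move=> i w _; apply: sume_ge0 => j _; rewrite lee_fin.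
    - by move=> i; apply: emeasurable_sum => j; apply/measurable_EFinP; exact: measurable_indic.
    apply: eq_bigr => i _; rewrite ge0_integral_sum//; last first.
      by move=> j; apply/measurable_EFinP; exact: measurable_indic.
    by apply: eq_bigr => j _; rewrite integral_indic// setIT.
  apply: eq_integral => w _.
  rewrite -mulrA mulr_suml -sumEFin; apply: eq_bigr => i _.
  rewrite mulr_suml mulr_sumr -sumEFin; apply: eq_bigr => j _.
  by rewrite !indicI /Voo /=; congr EFin; ring.
under eq_fun do rewrite IE.
apply: (@nondecreasing_limits_interchange _
  (fun M n => \int[P]_w (A n M w * B n M w * Voo w)%:E) _ (fun n => (r_ n)%:E)).
- move=> n M M' MM'; apply: ge0_le_integral => //.
  + by move=> w _; rewrite lee_fin !mulr_ge0.
  + by apply/measurable_EFinP; apply: measurable_funM => //; apply: measurable_funM; exact: measurable_discounted.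
  + by apply/measurable_EFinP; apply: measurable_funM => //; apply: measurable_funM; exact: measurable_discounted.
  + move=> w _; rewrite lee_fin ler_wpM2r// ler_pM//.
      by apply: discounted_sum_homo => // i; exact: indic01.
    by apply: discounted_sum_homo => // i; exact: indic01.
- move=> M n n' nn'.
  apply: ge0_le_integral => //.
  + by move=> w _; rewrite lee_fin !mulr_ge0.
  + by apply/measurable_EFinP; apply: measurable_funM => //; apply: measurable_funM; exact: measurable_discounted.
  + by apply/measurable_EFinP; apply: measurable_funM => //; apply: measurable_funM; exact: measurable_discounted.
  + move=> w _; rewrite lee_fin ler_wpM2r// ler_pM//.
      by apply: discounted_sum_anti => //; exact: invn_anti.
    by apply: discounted_sum_anti => //; exact: invn_anti.
- by move=> n; apply: prod_moment_limit; exact: Hr.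
- move=> M.
  have := @cvg_monotone_convergence _ _ _ P setT measurableT (fun n w => (A n M w * B n M w * Voo w)%:E).
  have lE w : (fun n => (A n M w * B n M w * Voo w)%:E) @ \oo -->
      ((\sum_(i < M) \1_(a i) w) * (\sum_(j < M) \1_(b j) w) * Voo w)%:E.
    apply: cvg_EFin; first exact: nearW.
    apply: cvgMl; apply: cvgM; apply: cvg_discounted_sum; exact: cvg_harmonic.
  rewrite (_ : \int[P]_x limn _ = \int[P]_w ((\sum_(i < M) \1_(a i) w) * (\sum_(j < M) \1_(b j) w) * Voo w)%:E); last first.
    by apply: eq_integral => w _; apply/cvg_lim.
  apply.
  + by move=> n; apply/measurable_EFinP; apply: measurable_funM => //; apply: measurable_funM; exact: measurable_discounted.
  + by move=> n w _; rewrite lee_fin !mulr_ge0.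
  + move=> w _ n n' nn'.
      rewrite lee_fin ler_wpM2r// ler_pM//.
      by apply: discounted_sum_anti => //; exact: invn_anti.
    by apply: discounted_sum_anti => //; exact: invn_anti.
- by apply: cvg_EFin => //; exact: nearW.
Qed.

End product_moment.

Lemma bounded01_integrable d (T : measurableType d) (R : realType)
    (P : probability T R) (f : T -> R) :
  measurable_fun setT f -> (forall w, (0 <= f w <= 1)%R) ->
  P.-integrable setT (EFin \o f).
Proof.
move=> mf f01; apply/integrableP; split; first exact/measurable_EFinP.
rewrite (eq_integral (EFin \o f)); last first.
  by move=> w _ /=; rewrite ger0_norm//; have /andP[] := f01 w.
have := integral_probability_fin_num P mf f01.
by rewrite ge0_fin_numE// integral_ge0// => w _; rewrite lee_fin; have /andP[] := f01 w.
Qed.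

Definition no_point (Omega T : Type) (z : nat -> Omega -> T) (C : set T) : set Omega :=
  [set w | forall k, ~ C (z k w)].

Lemma no_pointE (Omega T : Type) (z : nat -> Omega -> T) (C : set T) :
  no_point z C = ~` \bigcup_k (z k @^-1` C).
Proof.
apply/seteqP; split => [w h [k _]|w h k Ck]; first exact: h.
by apply: h; exists k.
Qed.

Section pgfl_moments.
Context d d' (Omega : measurableType d) (T : measurableType d') (R : realType).
Variables (P : probability Omega R) (m : {measure set T -> \bar R}).
Variable z : nat -> Omega -> T.
Hypothesis mz : forall i, measurable_fun setT (z i).
Hypothesis pz : has_poisson_pgfl P m z.

Let ind (B : set T) s M w : R := (\prod_(i < M) (1 - s * \1_(z i @^-1` B) w))%R.

Let ind01 (B : set T) s M w : (0 <= s <= 1)%R -> (0 <= ind B s M w <= 1)%R.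
Proof.
move=> s01; rewrite /ind prodr_ge0 ?prodr_ile1//= => i _; rewrite indicE;
  case: (_ \in _); rewrite /=; lra.
Qed.

Let mind (B : set T) s M : measurable B -> measurable_fun setT (ind B s M).
Proof.
move=> mB; apply: measurable_prod => // i _; apply: measurable_funB; first exact: measurable_cst.
apply: measurable_funM; first exact: measurable_cst.
by apply: measurable_indic; exact: measurable_preimageT.
Qed.

Let ind0 (B : set T) M w : ind B 0 M w = 1%R.
Proof. by rewrite /ind big1// => i _; rewrite mul0r subr0. Qed.

Section three_sets.
Variables B1 B2 B3 : set T.
Hypotheses (mB1 : measurable B1) (mB2 : measurable B2) (mB3 : measurable B3).
Hypotheses (B12 : B1 `&` B2 = set0) (B13 : B1 `&` B3 = set0) (B23 : B2 `&` B3 = set0).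
Hypotheses (fB1 : m B1 < +oo) (fB2 : m B2 < +oo) (fB3 : m B3 < +oo).
Let x1 := fine (m B1).
Let x2 := fine (m B2).
Let x3 := fine (m B3).

Let fin (B : set T) : m B < +oo -> m B = (fine (m B))%:E.
Proof. by move=> h; rewrite fineK// ge0_fin_numE. Qed.

(** The function is 1 outside the three sets and 1 - s1, 1 - s2, 0 on them;
    the third factor forces [B3] to be empty of points, and differentiating in
    [s1] and [s2] at 0 counts the points in [B1] and [B2]. *)
Lemma pgfl_three_sets s1 s2 : (0 <= s1 <= 1)%R -> (0 <= s2 <= 1)%R ->
  (fun M => \int[P]_w (ind B1 s1 M w * ind B2 s2 M w * ind B3 1 M w)%:E) @ \oo -->
  (expR (- (s1 * x1 + s2 * x2 + x3)))%:E.
Proof.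
move=> s101 s201.
pose g y : R := ((1 - s1 * \1_B1 y) * (1 - s2 * \1_B2 y) * (1 - 1 * \1_B3 y))%R.
have mfac (s : R) (B : set T) : measurable B -> measurable_fun setT (fun y => 1 - s * \1_B y)%R.
  move=> mB; apply: measurable_funB; first exact: measurable_cst.
  by apply: measurable_funM; [exact: measurable_cst|exact: measurable_indic].
have mg : measurable_fun setT g.
  by apply: measurable_funM; [apply: measurable_funM|]; exact: mfac.
have oneB y : (1 - g y = s1 * \1_B1 y + s2 * \1_B2 y + \1_B3 y)%R.
  have h1 : B1 y -> B2 y -> False by move=> ? ?; have : (B1 `&` B2) y by []; rewrite B12.
  have h2 : B1 y -> B3 y -> False by move=> ? ?; have : (B1 `&` B3) y by []; rewrite B13.
  have h3 : B2 y -> B3 y -> False by move=> ? ?; have : (B2 `&` B3) y by []; rewrite B23.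
  rewrite /g !indicE.
  case: (boolP (y \in B1)); case: (boolP (y \in B2)); case: (boolP (y \in B3));
    rewrite ?inE ?notin_setE => /= k3 k2 k1; rewrite ?mulr1 ?mulr0 ?subr0;
    first [by exfalso; tauto|by ring].
have g01 y : (0 <= g y <= 1)%R.
  rewrite /g !indicE.
  by case: (_ \in B1); case: (_ \in B2); case: (_ \in B3); rewrite /=; apply/andP; split; nra.
have ms (s : R) (B : set T) : measurable B -> measurable_fun setT (fun y => (s * \1_B y)%:E).
  by move=> mB; apply/measurable_EFinP; apply: measurable_funM; [exact: measurable_cst|exact: measurable_indic].
have s10 : (0 <= s1)%R by have /andP[] := s101.
have s20 : (0 <= s2)%R by have /andP[] := s201.
have iscale (s : R) (B : set T) : (0 <= s)%R -> measurable B -> m B < +oo ->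
    \int[m]_y (s * \1_B y)%:E = (s * fine (m B))%:E.
  move=> s0 mB fB; under eq_integral do rewrite EFinM.
  rewrite ge0_integralZl ?lee_fin//; last by apply/measurable_EFinP; exact: measurable_indic.
  by rewrite integral_indic// setIT EFinM {1}(fin fB).
have intE : \int[m]_y (1 - g y)%:E = (s1 * x1 + s2 * x2 + x3)%:E.
  under eq_integral do rewrite oneB 2!EFinD.
  rewrite ge0_integralD//; last 3 first.
  - by move=> y _; rewrite -EFinD lee_fin addr_ge0// mulr_ge0.
  - by apply: emeasurable_funD; exact: ms.
  - by apply/measurable_EFinP; exact: measurable_indic.
  rewrite ge0_integralD//; last 4 first.
  - by move=> y _; rewrite lee_fin mulr_ge0.
  - exact: ms.
  - by move=> y _; rewrite lee_fin mulr_ge0.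
  - exact: ms.
  by rewrite !iscale// integral_indic// setIT !EFinD /x3 -fin.
have := pz mg g01; rewrite intE /= => /(_ (ltry _)).
rewrite [X in X @ _ --> _](_ : _ = (fun M => \int[P]_w (ind B1 s1 M w * ind B2 s2 M w * ind B3 1 M w)%:E))//.
apply/funext => M; apply: eq_integral => w _; congr EFin.
by rewrite /ind -!big_split.
Qed.

Let N_A (B : set T) n M w :
  discounted_sum n.+1%:R^-1 (fun i => \1_(z i @^-1` B) w) M =
  (n.+1%:R * (1 - ind B n.+1%:R^-1 M w))%R.
Proof. by rewrite -(discounted_sumE _ (fun i => \1_(z i @^-1` B) w)) mulrA mulfV ?mul1r// pnatr_eq0. Qed.

Let ind3 M w : (\prod_(i < M) (1 - \1_(z i @^-1` B3) w))%R = ind B3 1 M w.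
Proof. by apply: eq_bigr => i _; rewrite mul1r. Qed.

Let inv01 n : (0 <= (n.+1%:R^-1 : R) <= 1)%R.
Proof. by rewrite invr_ge0 ler0n/= invf_le1// ler1n. Qed.

Let z01 : (0 <= (0:R) <= 1)%R.
Proof. by rewrite lexx ler01. Qed.

Let prod01 (a b : R) : (0 <= a <= 1)%R -> (0 <= b <= 1)%R -> (0 <= a * b <= 1)%R.
Proof. by move=> ? ?; apply/andP; split; nra. Qed.

Let W s1 s2 M w := (ind B1 s1 M w * ind B2 s2 M w * ind B3 1 M w)%R.

Let mW s1 s2 M : measurable_fun setT (W s1 s2 M).
Proof. by apply: measurable_funM; [apply: measurable_funM|]; exact: mind. Qed.

Let W01 s1 s2 M w : (0 <= s1 <= 1)%R -> (0 <= s2 <= 1)%R -> (0 <= W s1 s2 M w <= 1)%R.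
Proof.
move=> h1 h2; apply: prod01; first by apply: prod01; exact: ind01.
by apply: ind01; rewrite ler01 lexx.
Qed.

Let iW s1 s2 M : (0 <= s1 <= 1)%R -> (0 <= s2 <= 1)%R ->
  P.-integrable setT (EFin \o W s1 s2 M).
Proof. by move=> h1 h2; apply: bounded01_integrable => // w; exact: W01. Qed.

(** Divide by [s1 * s2] the inclusion-exclusion of the four functionals with
    [s1], [s2] in {0, s}, and let [s] tend to 0. *)
Lemma pgfl_two_points :
  \sum_(i <oo) \sum_(j <oo)
    P (z i @^-1` B1 `&` z j @^-1` B2 `&` no_point z B3) =
  m B1 * m B2 * (expR (- fine (m B3)))%:E.
Proof.
rewrite no_pointE (fin fB1) (fin fB2) -!EFinM.
apply: (@product_moment _ _ _ P (fun i => z i @^-1` B1) (fun i => z i @^-1` B2)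
  (fun i => z i @^-1` B3) _ _ _
  (fun n => n.+1%:R * (1 - expR (- (n.+1%:R^-1 * x1))) *
    (n.+1%:R * (1 - expR (- (n.+1%:R^-1 * x2)))) * expR (- x3))%R);
  try by [move=> i; exact: measurable_preimageT].
- move=> n; set s : R := (n.+1%:R^-1)%R.
  have intE M : \int[P]_w (discounted_sum s (fun i => \1_(z i @^-1` B1) w) M *
       discounted_sum s (fun i => \1_(z i @^-1` B2) w) M *
       \prod_(i < M) (1 - \1_(z i @^-1` B3) w))%:E =
     (n.+1%:R * n.+1%:R)%:E *
     ((\int[P]_w (W 0 0 M w)%:E - \int[P]_w (W s 0 M w)%:E) -
      (\int[P]_w (W 0 s M w)%:E - \int[P]_w (W s s M w)%:E)).
    have i00 := iW M z01 z01; have is0 := iW M (inv01 n) z01.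
    have i0s := iW M z01 (inv01 n); have iss := iW M (inv01 n) (inv01 n).
    rewrite -(integralB _ i00 is0)// -(integralB _ i0s iss)//.
    rewrite -(integralB _ (integrableB _ i00 is0) (integrableB _ i0s iss))//.
    rewrite -integralZl//; last first.
      by apply: integrableB => //; apply: integrableB.
    apply: eq_integral => w _; rewrite -!EFinB -EFinM; congr EFin.
    rewrite /s !N_A ind3 /W !ind0; ring.
  under eq_fun do rewrite intE.
  have -> : (n.+1%:R * (1 - expR (- (s * x1))) * (n.+1%:R * (1 - expR (- (s * x2)))) *
      expR (- x3))%:E = (n.+1%:R * n.+1%:R)%:E *
      ((expR (- (0 * x1 + 0 * x2 + x3)))%:E - (expR (- (s * x1 + 0 * x2 + x3)))%:E -
       ((expR (- (0 * x1 + s * x2 + x3)))%:E - (expR (- (s * x1 + s * x2 + x3)))%:E)).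
    rewrite -!EFinB -EFinM; congr EFin.
    rewrite !mul0r !add0r addr0 !opprD !expRD; ring.
  apply: cvgeZl => //; apply: cvgeB => //.
    by apply: cvgeB => //; [exact: (pgfl_three_sets z01 z01)|exact: (pgfl_three_sets (inv01 n) z01)].
  by apply: cvgeB => //; [exact: (pgfl_three_sets z01 (inv01 n))|exact: (pgfl_three_sets (inv01 n) (inv01 n))].
- by apply: cvgMl; apply: cvgM; apply: cvg_one_minus_expR; rewrite fine_ge0.
Qed.

(** A sequence of events whose only member is the whole space turns the double
    sum into a simple one. *)
Lemma pgfl_one_point_disjoint :
  \sum_(i <oo) P (z i @^-1` B1 `&` no_point z B3) =
  m B1 * (expR (- fine (m B3)))%:E.
Proof.
rewrite no_pointE (fin fB1) -!EFinM.
pose b j : set Omega := if j is 0%N then setT else set0.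
transitivity (\sum_(i <oo) \sum_(j <oo)
    P (z i @^-1` B1 `&` b j `&` ~` \bigcup_k z k @^-1` B3)).
  apply: eq_eseriesr => i _; apply/esym; apply: lim_near_cst => //.
  exists 1%N => // M /= M0; rewrite big_mkord (bigD1 (Ordinal M0))//= setIT big1 ?adde0//.
  by move=> [[|k] kM] //= _; rewrite setI0 set0I measure0.
have mb j : measurable (b j).
  by case: j => [|j]; [exact: measurableT|exact: measurable0].
have bM (s : R) M w : discounted_sum s (fun j => \1_(b j) w) M.+1 = 1%R.
  rewrite /discounted_sum big_ord_recl/= big_ord0 indicE in_setT mulr1 big1 ?addr0// => k _.
  by rewrite indicE in_set0 mul0r.
apply: (@product_moment _ _ _ P (fun i => z i @^-1` B1) b
  (fun i => z i @^-1` B3) _ mb _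
  (fun n => n.+1%:R * (1 - expR (- (n.+1%:R^-1 * x1))) * expR (- x3))%R);
  try by [move=> i; exact: measurable_preimageT].
- move=> n; set s : R := (n.+1%:R^-1)%R.
  have intE M : \int[P]_w (discounted_sum s (fun i => \1_(z i @^-1` B1) w) M *
       discounted_sum s (fun i => \1_(b i) w) M *
       \prod_(i < M) (1 - \1_(z i @^-1` B3) w))%:E =
     n.+1%:R%:E * (\int[P]_w (W 0 0 M w)%:E - \int[P]_w (W s 0 M w)%:E).
    have i00 := iW M z01 z01; have is0 := iW M (inv01 n) z01.
    rewrite -(integralB _ i00 is0)// -integralZl//; last exact: integrableB.
    apply: eq_integral => w _; rewrite -!EFinB -EFinM; congr EFin.
    rewrite /s !N_A ind3 /W !ind0; case: M {i00 is0} => [|M]; last by rewrite bM; ring.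
    by rewrite /ind /discounted_sum !big_ord0; ring.
  under eq_fun do rewrite intE.
  have -> : (n.+1%:R * (1 - expR (- (s * x1))) * expR (- x3))%:E = n.+1%:R%:E *
      ((expR (- (0 * x1 + 0 * x2 + x3)))%:E - (expR (- (s * x1 + 0 * x2 + x3)))%:E).
    rewrite -!EFinB -EFinM; congr EFin.
    rewrite !mul0r !add0r addr0 !opprD !expRD; ring.
  apply: cvgeZl => //; apply: cvgeB => //.
    exact: (pgfl_three_sets z01 z01).
  exact: (pgfl_three_sets (inv01 n) z01).
- by apply: cvgMl; apply: cvg_one_minus_expR; rewrite fine_ge0.
Qed.

End three_sets.

Lemma pgfl_one_point (B1 B3 : set T) : measurable B1 -> measurable B3 ->
  B1 `&` B3 = set0 -> m B1 < +oo -> m B3 < +oo ->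
  \sum_(i <oo) P (z i @^-1` B1 `&` no_point z B3) =
  m B1 * (expR (- fine (m B3)))%:E.
Proof.
move=> mB1 mB3 B13 fB1 fB3; apply: (@pgfl_one_point_disjoint B1 set0 B3) => //.
- exact: setI0.
- exact: set0I.
- by rewrite measure0.
Qed.

End pgfl_moments.

(** * The Mecke formula for countably many tests *)

Section mecke.
Context d dY dZ (Omega : measurableType d) (Y : measurableType dY)
  (Z : measurableType dZ) (R : realType).
Variables (m : {measure set (Y * Omega) -> \bar R})
  (rho : {measure set Y -> \bar R}) (mu : {measure set Z -> \bar R}).
Variables (z : nat -> Omega -> Z) (f1 f2 : Y -> Z).
Variables (T : nat -> set Y) (C : nat -> set Z) (G : nat -> set Y).
Hypotheses (mz : forall i, measurable_fun setT (z i))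
  (mf1 : measurable_fun setT f1)
  (mT : forall r, measurable (T r)) (mC : forall r, measurable (C r))
  (mG : forall k, measurable (G k)).

Definition tested (y : Y) : set Z := \bigcup_(r in [set r | T r y]) C r.

Definition survival (c : set Z) (y : Y) : R :=
  (\1_(~` c) (f1 y) * expR (- fine (mu c)))%R.

Hypothesis Coo : forall r, mu (C r) < +oo.
Hypothesis tested_oo : forall k y, G k y -> mu (tested y) < +oo.
Hypothesis rhoG : forall k, rho (G k) < +oo.
Hypothesis TC : forall k r y, G k y -> T r y -> ~ C r (f2 y).
Hypothesis campbell : forall k E c, measurable E -> E `<=` G k ->
  measurable c -> mu c < +oo -> (forall y, E y -> ~ c (f2 y)) ->
  m (E `*` no_point z c) = rho (E `&` f1 @^-1` (~` c)) * (expR (- fine (mu c)))%:E.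

Let tested_n n (y : Y) : set Z := \bigcup_(r in [set r | (r < n)%N /\ T r y]) C r.

Let tested_n0 y : tested_n 0 y = set0.
Proof. by apply/seteqP; split => // u [r [/= ]]; rewrite ltn0. Qed.

Let tested_nS n y : tested_n n.+1 y = (if `[< T n y >] then C n else set0) `|` tested_n n y.
Proof.
apply/seteqP; split => [u [r [/=]]|u [|[r [/= rn Tr] Cr]]].
- rewrite ltnS leq_eqVlt => /orP[/eqP -> Tn Cn|rn Tr Cr]; last by right; exists r.
  by left; case: asboolP.
- by case: asboolP => // Tn Cn; exists n => //=; rewrite ltnSn.
- by exists r => //=; split => //; exact: ltnW.
Qed.

Let event n c0 (E : set Y) : set (Y * Omega) :=
  [set yw | E yw.1 /\ no_point z (c0 `|` tested_n n yw.1) yw.2].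

Let event0 c0 E : event 0 c0 E = E `*` no_point z c0.
Proof.
by apply/seteqP; split => -[y w] [/= Ey h]; split => //=; move: h; rewrite tested_n0 setU0.
Qed.

Let eventS n c0 E :
  event n.+1 c0 E = event n (c0 `|` C n) (E `&` T n) `|` event n c0 (E `\` T n).
Proof.
apply/seteqP; split => -[y w].
  move=> [/= Ey]; rewrite tested_nS; case: asboolP => Tny; rewrite setUA => h.
    by left; split.
  by right; split => //=; rewrite setU0 in h.
move=> [|] [/= [Ey Tny] h]; split => //=; rewrite tested_nS.
  by case: asboolP => // _; rewrite setUA.
by case: asboolP => // _; rewrite set0U.
Qed.

Let measurable_no_point c : measurable c -> measurable (no_point z c).
Proof.
move=> mc; rewrite no_pointE; apply: measurableC; apply: bigcupT_measurable => k.
exact: measurable_preimageT.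
Qed.

Let measurable_event n c0 E : measurable c0 -> measurable E -> measurable (event n c0 E).
Proof.
elim: n c0 E => [|n ih] c0 E mc0 mE.
  by rewrite event0; apply: measurableX => //; exact: measurable_no_point.
rewrite eventS; apply: measurableU; apply: ih => //.
- exact: measurableU.
- exact: measurableI.
- exact: measurableD.
Qed.

Let W n c0 y := survival (c0 `|` tested_n n y) y.

Let W0E c0 y : W 0 c0 y = survival c0 y.
Proof. by rewrite /W tested_n0 setU0. Qed.

Let WS n c0 y : W n.+1 c0 y = if y \in T n then W n (c0 `|` C n) y else W n c0 y.
Proof.
rewrite /W tested_nS -/(asbool _) (_ : `[< T n y >] = (y \in T n)); last first.
  by apply/asboolP/idP; rewrite inE.
by case: ifP => _; rewrite ?setUA// setU0.
Qed.

Let survival01 c y : (0 <= survival c y <= 1)%R.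
Proof.
rewrite /survival indicE; set e := expR _.
have e0 : (0 <= e)%R by exact: expR_ge0.
have e1 : (e <= 1)%R by rewrite /e -expR0 ler_expR lerNl oppr0 fine_ge0.
by case: (_ \in _); rewrite /=; apply/andP; split; nra.
Qed.

Let mW n c0 : measurable c0 -> measurable_fun setT (W n c0).
Proof.
elim: n c0 => [|n ih] c0 mc0.
  rewrite (_ : W 0 c0 = survival c0); last by apply/funext => y; exact: W0E.
  apply: measurable_funM; last exact: measurable_cst.
  by apply: measurableT_comp => //; apply: measurable_indic; exact: measurableC.
rewrite (_ : W n.+1 c0 = fun y => if y \in T n then W n (c0 `|` C n) y else W n c0 y); last first.
  by apply/funext => y; exact: WS.
apply: measurable_fun_ifT; [|apply: ih; exact: measurableU|exact: ih].
apply: (measurable_fun_bool true); rewrite setTI (_ : _ @^-1` _ = T n)//.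
by apply/seteqP; split => y /= Ty; [exact/set_mem|exact/mem_set].
Qed.

Let event_integral k n c0 E : measurable c0 -> mu c0 < +oo ->
  measurable E -> E `<=` G k -> (forall y, E y -> ~ c0 (f2 y)) ->
  m (event n c0 E) = \int[rho]_(y in E) (W n c0 y)%:E.
Proof.
elim: n c0 E => [|n ih] c0 E mc0 c0oo mE EG Ec0.
  rewrite event0 (campbell mE EG)//.
  transitivity (\int[rho]_(y in E) ((\1_(f1 @^-1` (~` c0)) y)%:E * (expR (- fine (mu c0)))%:E)).
    rewrite ge0_integralZr//.
      rewrite integral_indic//; last by apply: measurable_preimageT => //; exact: measurableC.
      by rewrite (setIC E).
    by apply/measurable_EFinP; apply: measurable_indic; apply: measurable_preimageT => //; exact: measurableC.
  by apply: eq_integral => y _; rewrite W0E /survival EFinM.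
have mWn c0' : measurable c0' -> forall D, measurable_fun D (fun y => (W n c0' y)%:E).
  by move=> mc0' D; apply/measurable_EFinP; apply: measurable_funTS; exact: mW.
rewrite eventS measureU; last 3 first.
- by apply: measurable_event; [exact: measurableU|exact: measurableI].
- by apply: measurable_event => //; exact: measurableD.
- by apply/seteqP; split => // -[y w] [[/= [_ Ty] _] [/= [_ nTy] _]].
transitivity (\int[rho]_(y in E `&` T n) (W n (c0 `|` C n) y)%:E +
    \int[rho]_(y in E `\` T n) (W n c0 y)%:E).
  congr (_ + _); apply: ih.
  - exact: measurableU.
  - by apply: le_lt_trans (measureU2 _ _ _) _ => //; apply: lte_add_pinfty => //; exact: Coo.
  - exact: measurableI.
  - by move=> y [/EG].
  - by move=> y [Ey Ty] [|]; [exact: Ec0|exact: (TC (EG _ Ey) Ty)].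
  - by [].
  - by [].
  - exact: measurableD.
  - by move=> y [/EG].
  - by move=> y [/Ec0].
rewrite -[in RHS](setUIDK E (T n)) ge0_integral_setU//=.
- congr (_ + _); apply: eq_integral => y; rewrite inE => -[Ey Ty].
    by rewrite WS mem_set.
  by rewrite WS memNset.
- exact: measurableI.
- exact: measurableD.
- by apply/measurable_EFinP; apply: measurable_funTS; exact: mW.
- by move=> y _; rewrite lee_fin; have /andP[] := survival01 (c0 `|` tested_n n.+1 y) y.
- by apply/disj_setPS => y [[_ Ty] [_ nTy]].
Qed.
Let event_oo (E : set Y) : set (Y * Omega) :=
  [set yw | E yw.1 /\ no_point z (tested yw.1) yw.2].

Let testedE y : tested y = \bigcup_n tested_n n y.
Proof.
apply/seteqP; split => [u [r Tr Cr]|u [n _ [r [/= rn Tr] Cr]]]; last by exists r.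
by exists r.+1 => //; exists r.
Qed.

Let event_ooE E : event_oo E = \bigcap_n event n set0 E.
Proof.
apply/seteqP; split => [[y w] [/= Ey h] n _|[y w] h].
  split => //= k; rewrite set0U => hk; apply: (h k); rewrite testedE; by exists n.
split; first by have [] := h 0%N I.
move=> k /=; rewrite testedE => -[n _ hk].
by have [_ /(_ k)] := h n I; apply; right.
Qed.

Let measurable_tested_n n y : measurable (tested_n n y).
Proof. by apply: bigcup_measurable => r _; exact: mC. Qed.

Let measurable_tested y : measurable (tested y).
Proof. by apply: bigcup_measurable => r _; exact: mC. Qed.

Let measurable_event_oo E : measurable E -> measurable (event_oo E).
Proof.
by move=> mE; rewrite event_ooE; apply: bigcapT_measurable => n; exact: measurable_event.
Qed.

Let cvg_W y : mu (tested y) < +oo ->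
  (fun n => W n set0 y) @ \oo --> survival (tested y) y.
Proof.
move=> yoo; have nd n n' : (n <= n')%N -> tested_n n y `<=` tested_n n' y.
  by move=> nn' u [r [/= rn Tr] Cr]; exists r => //; split => //; exact: leq_trans nn'.
rewrite (_ : (fun n => W n set0 y) = (fun n => survival (tested_n n y) y)); last first.
  by apply/funext => n; rewrite /W set0U.
apply: cvgM.
  have iC c : \1_(~` c) (f1 y) = (if pselect (c (f1 y)) then 0 else 1)%R :> R.
    by rewrite indicE; case: pselect => h; [rewrite memNset//=; apply|rewrite mem_set].
  under eq_fun do rewrite iC.
  rewrite iC; apply: cvg_near_cst; case: (pselect (tested y _)) => h.
    have [N _ hN] : (\bigcup_n tested_n n y) (f1 y) by rewrite -testedE.
    exists N => // n /= Nn.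
    by case: pselect => // h'; exfalso; apply: h'; exact: nd hN.
  apply: nearW => n; case: pselect => // h'; exfalso; apply: h.
  by rewrite testedE; exists n.
apply: (@cvg_comp _ _ _ (fun n => - fine (mu (tested_n n y)))%R expR _ (nbhs (- fine (mu (tested y)))%R)); last exact: continuous_expR.
apply: cvgN; apply: fine_cvg; rewrite fineK; last by rewrite ge0_fin_numE.
rewrite testedE; apply: nondecreasing_cvg_mu => //.
- by rewrite -testedE; exact: measurable_tested.
- by move=> n n' nn'; apply/subsetPset; exact: nd.
Qed.

Let mecke_local k E : measurable E -> E `<=` G k ->
  m (event_oo E) = \int[rho]_(y in E) (survival (tested y) y)%:E.
Proof.
move=> mE EG.
have Eoo : rho E < +oo.
  by apply: le_lt_trans (rhoG k); apply: le_measure => //; rewrite inE.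
have set0oo : mu set0 < +oo by rewrite measure0.
have EE n : m (event n set0 E) = \int[rho]_(y in E) (W n set0 y)%:E.
  by apply: (event_integral (k := k)) => // y _ [].
have cm : (fun n => m (event n set0 E)) @ \oo --> m (event_oo E).
  rewrite event_ooE; apply: nonincreasing_cvg_mu.
  - rewrite EE; apply: le_lt_trans Eoo; rewrite -[leRHS]mul1e -integral_cst//.
    apply: ge0_le_integral => //.
    + by move=> y _; rewrite lee_fin; have /andP[] := survival01 (set0 `|` tested_n 0 y) y.
    + by apply/measurable_EFinP; apply: measurable_funTS; exact: mW.
    + by move=> y _; rewrite lee_fin; have /andP[] := survival01 (set0 `|` tested_n 0 y) y.
  - by move=> n; exact: measurable_event.
  - by rewrite -event_ooE; exact: measurable_event_oo.
  - move=> n n' nn'; apply/subsetPset => -[y w] [/= Ey h]; split => //= i; rewrite set0U => hi.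
    apply: (h i); right; move: hi => [r [/= rn Tr] Cr]; exists r => //; split => //.
    exact: leq_trans nn'.
have ci : (fun n => m (event n set0 E)) @ \oo --> \int[rho]_(y in E) (survival (tested y) y)%:E.
  under eq_fun do rewrite EE.
  apply: (@dominated_cvg _ _ _ rho E mE _ _ (cst 1)) => //.
  - by move=> n; apply/measurable_EFinP; apply: measurable_funTS; exact: mW.
  - move=> y Ey; apply: cvg_EFin; first exact: nearW.
    by apply: cvg_W; exact: tested_oo (EG _ Ey).
  - apply/integrableP; split; first exact: measurable_cst.
    under eq_integral do rewrite /= normr1.
    by rewrite integral_cst// mul1e.
  - move=> n y _ /=; have := survival01 (set0 `|` tested_n n y) y => /andP[h0 h1].
    by rewrite lee_fin ger0_norm.
by rewrite -(cvg_lim _ cm)// (cvg_lim _ ci).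
Qed.

(** A Mecke formula. For [y] in the cell [{y | y passes exactly the tests in K}]
    of the partition generated by finitely many tests, [tested y] does not
    depend on [y], so that the hypothesis, which is about a fixed set [c],
    applies; the number of tests then goes to infinity. *)
Theorem mecke_formula E : measurable E -> E `<=` \bigcup_k G k ->
  m [set yw | E yw.1 /\ no_point z (tested yw.1) yw.2] =
  \int[rho]_(y in E) (survival (tested y) y)%:E.
Proof.
move=> mE EG.
pose D := seqDU (fun k => E `&` G k).
have mD k : measurable (D k).
  by apply: measurableD; [exact: measurableI|apply: bigsetU_measurable => i _; exact: measurableI].
have DG k : D k `<=` G k by move=> y [[]].
have ED : E = \bigcup_k D k.
  rewrite /D -seqDU_bigcup_eq; apply/seteqP; split => [y Ey|y [k _ []]//].
  by have [k _ Gk] := EG _ Ey; exists k.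
have tD : trivIset setT D by exact: trivIset_seqDU.
have msurv : measurable_fun (\bigcup_k D k) (fun y => (survival (tested y) y)%:E).
  apply: (@emeasurable_fun_cvg _ _ _ _ (fun n y => (W n set0 y)%:E)).
  - by move=> n; apply/measurable_EFinP; apply: measurable_funTS; exact: mW.
  - move=> y [k _ Dk]; apply: cvg_EFin; first exact: nearW.
    by apply: cvg_W; exact: tested_oo (DG _ _ Dk).
rewrite -/(event_oo E) [in RHS]ED ge0_integral_bigcup//; last first.
  by move=> y _; rewrite lee_fin; have /andP[] := survival01 (tested y) y.
have eD : event_oo E = \bigcup_k event_oo (D k).
  apply/seteqP; split => [[y w] [/= Ey h]|[y w] [k _ [/= Dk h]]].
    by move: Ey; rewrite ED => -[k _ Dk]; exists k.
  by split => //=; rewrite ED; exists k.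
rewrite eD measure_bigcup//; last 2 first.
- by move=> k _; exact: measurable_event_oo.
- apply/trivIsetP => i j _ _ ij; apply/seteqP; split => // -[y w] [[/= Di _] [/= Dj _]].
  move/trivIsetP : tD => /(_ _ _ I I ij) DD.
  suff : (D i `&` D j) y by rewrite DD.
  by split.
rewrite (eq_eseriesl (Q := xpredT)); last by move=> i; rewrite in_setT.
by apply: eq_eseriesr => i _; exact: mecke_local (DG i).
Qed.

End mecke.

Section mecke_points.
Context d dZ (Omega : measurableType d) (Z : measurableType dZ) (R : realType).
Variables (P : probability Omega R) (mu : {sigma_finite_measure set Z -> \bar R}).
Variable z : nat -> Omega -> Z.
Hypothesis mz : forall i, measurable_fun setT (z i).
Hypothesis pz : has_poisson_pgfl P mu z.

Let measurable_no_point c : measurable c -> measurable (no_point z c).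
Proof.
move=> mc; rewrite no_pointE; apply: measurableC; apply: bigcupT_measurable => k.
exact: measurable_preimageT.
Qed.

Section one_point.
Variables (T : nat -> set Z) (C : nat -> set Z).
Hypotheses (mT : forall r, measurable (T r)) (mC : forall r, measurable (C r)).
Hypothesis Coo : forall r, mu (C r) < +oo.
Hypothesis tested_oo : forall y, mu (tested T C y) < +oo.
Hypothesis TC : forall r y, T r y -> ~ C r y.

Let mpair i : measurable_fun setT (fun w => (z i w, w)).
Proof. exact: measurable_fun_pair. Qed.

Let X i : {RV P >-> (Z * Omega)%type} := mfun_Sub (mem_set (mpair i)).

Let m : {measure set (Z * Omega) -> \bar R} := mseries (fun i => distribution P (X i)) 0.

Let mE A : m A = \sum_(i <oo) P ((fun w => (z i w, w)) @^-1` A).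
Proof. by []. Qed.

(** Both sides of the Mecke formula for fixed sets are given by the generating
    functional; it remains to let the set depend on the point, which is
    [mecke_formula] for the sum over [i] of the laws of [(z i w, w)]. *)
Lemma mecke_one_point E : measurable E ->
  \sum_(i <oo) P [set w | E (z i w) /\ no_point z (tested T C (z i w)) w] =
  \int[mu]_(y in E) (survival mu id (tested T C y) y)%:E.
Proof.
move=> mE'; have /sigma_finiteP[F [FT ndF Foo]] := sigma_finiteT mu.
rewrite -(@mecke_formula _ _ _ _ _ _ _ m mu mu z id id T C F)//.
- by move=> k; have [] := Foo k.
- by move=> k y _; exact: tested_oo.
- by move=> k; have [] := Foo k.
- by move=> k r y _; exact: TC.
- move=> k D c mD DF mc coo Dc.
  have Dk : mu D < +oo.
    by have [mF ?] := Foo k; apply: (le_lt_trans (le_measure _ _ _ DF)); rewrite ?inE.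
  rewrite mE setIidl//.
  have Dc0 : D `&` c = set0 by apply/seteqP; split => // y [Dy /(Dc _ Dy)].
  exact: (pgfl_one_point mz pz mD mc Dc0 Dk coo).
- by move=> y _; rewrite -FT.
Qed.
End one_point.

Section two_points.
Variables (A : nat -> set Z) (T : nat -> set (Z * Z)) (C : nat -> set Z).
Hypotheses (mA : forall q, measurable (A q)) (mT : forall r, measurable (T r))
  (mC : forall r, measurable (C r)).
(** The sets [A q] put the first point of a pair on one side and the second
    one on the other: on the pairs that one of them separates, the two points
    lie in disjoint sets, as is required to compute with generating
    functionals. *)
Definition precedes : set (Z * Z) := [set y | exists q, A q y.1 /\ ~ A q y.2].
Hypothesis Coo : forall r, mu (C r) < +oo.
Hypothesis tested_oo : forall y, precedes y -> mu (tested T C y) < +oo.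
Hypothesis TC : forall r y, precedes y -> T r y -> ~ C r y.2.

Let mtriple i j : measurable_fun setT (fun w => ((z i w, z j w), w)).
Proof. by apply: measurable_fun_pair => //; exact: measurable_fun_pair. Qed.

Let X i j : {RV P >-> (Z * Z * Omega)%type} := mfun_Sub (mem_set (mtriple i j)).

Let m : {measure set (Z * Z * Omega) -> \bar R} :=
  mseries (fun i => mseries (fun j => distribution P (X i j)) 0) 0.

Let mE D : m D = \sum_(i <oo) \sum_(j <oo) P ((fun w => ((z i w, z j w), w)) @^-1` D).
Proof. by []. Qed.

Section box.
Variables (q : nat) (F : set Z).
Hypotheses (mF : measurable F) (Foo : mu F < +oo).
Variable c : set Z.
Hypotheses (mc : measurable c) (coo : mu c < +oo).
Let D1 := (A q `&` F) `\` c.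
Let D2 := (F `\` A q) `\` c.
Let mD1 : measurable D1.
Proof. by apply: measurableD => //; exact: measurableI. Qed.
Let mD2 : measurable D2.
Proof. by apply: measurableD => //; exact: measurableD. Qed.
Let D1oo : mu D1 < +oo.
Proof. by apply: (le_lt_trans (le_measure _ _ _ _)) Foo; rewrite ?inE// => y [[]]. Qed.
Let D2oo : mu D2 < +oo.
Proof. by apply: (le_lt_trans (le_measure _ _ _ _)) Foo; rewrite ?inE// => y [[]]. Qed.

Let mD : measurable ((D1 `*` D2) `*` no_point z c).
Proof. by apply: measurableX; [exact: measurableX|exact: measurable_no_point]. Qed.

Let mfst : measurable_fun setT (fst : Z * Z * Omega -> Z * Z).
Proof. exact: measurable_fst. Qed.

Let m' : {measure set (Z * Z) -> \bar R} :=
  mscale (NngNum (expR_ge0 (fine (mu c)))) (measure_function_pushforward__canonical__measure_function_Measure (mrestr m mD) mfst).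

Let m'E W : m' W = (expR (fine (mu c)))%:E *
  m (fst @^-1` W `&` (D1 `*` D2) `*` no_point z c).
Proof. by []. Qed.

Let mDD : measurable (D1 `*` D2). Proof. exact: measurableX. Qed.

Let pgfl_box (B1 B2 : set Z) : measurable B1 -> measurable B2 ->
  m ((B1 `*` B2) `*` no_point z c `&` (D1 `*` D2) `*` no_point z c) =
  mu (B1 `&` D1) * mu (B2 `&` D2) * (expR (- fine (mu c)))%:E.
Proof.
move=> mB1 mB2; rewrite -(pgfl_two_points mz pz)//.
- rewrite mE; apply: eq_eseriesr => i _; apply: eq_eseriesr => j _.
  congr (P _); apply/seteqP; split => w /=; tauto.
- exact: measurableI.
- exact: measurableI.
- by apply/seteqP; split => // y [[_ [[]]]] ? _ _ [_ [[]]].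
- by apply/seteqP; split => // y [[_ [_]]].
- by apply/seteqP; split => // y [[_ [_]]].
- apply: (le_lt_trans (le_measure _ _ _ _)) D1oo; rewrite ?inE//; exact: measurableI.
- apply: (le_lt_trans (le_measure _ _ _ _)) D2oo; rewrite ?inE//; exact: measurableI.
Qed.

(** As functions of [E] both sides are finite measures on a box; they agree on
    rectangles by the moments of points in disjoint sets. *)
Lemma campbell_box (E : set (Z * Z)) : measurable E ->
  E `<=` (A q `&` F) `*` (F `\` A q) -> (forall y, E y -> ~ c y.2) ->
  m (E `*` no_point z c) =
  (mu \x mu) (E `&` fst @^-1` (~` c)) * (expR (- fine (mu c)))%:E.
Proof.
move=> mEE EAF Ec; set E' := E `&` _.
have mE' : measurable E'.
  apply: measurableI => //; apply: measurable_preimageT => //.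
  exact: measurableC.
have E'D : E' `<=` D1 `*` D2.
  move=> y [Ey /= yc]; have [[? ?] [? ?]] := EAF _ Ey; have := Ec _ Ey.
  by rewrite /D1 /D2; split.
have uniq1 : forall X : set (Z * Z), measurable X ->
    (mfrestr mD1 D1oo \x mfrestr mD2 D2oo) X = m' X.
  apply: product_measure_unique => B1 B2 mB1 mB2.
  rewrite m'E (_ : fst @^-1` (B1 `*` B2) `&` _ = (B1 `*` B2) `*` no_point z c `&` (D1 `*` D2) `*` no_point z c); last first.
    by apply/seteqP; split => -[[y1 y2] w] /=; tauto.
  rewrite pgfl_box// /mfrestr /mrestr muleC -!muleA -EFinM -expRD addNr expR0 mule1.
  by [].
have uniq2 : forall X : set (Z * Z), measurable X ->
    (mfrestr mD1 D1oo \x mfrestr mD2 D2oo) X = mrestr (mu \x mu) mDD X.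
  apply: product_measure_unique => B1 B2 mB1 mB2.
  transitivity ((mu \x mu) ((B1 `&` D1) `*` (B2 `&` D2))); last first.
    by rewrite product_measure1E//; exact: measurableI.
  by rewrite setXI.
have e' : m' E' = (mu \x mu) E'.
  by rewrite -uniq1// uniq2// /mrestr setIidl.
have -> : m (E `*` no_point z c) = m (E' `*` no_point z c).
  rewrite !mE; apply: eq_eseriesr => i _; apply: eq_eseriesr => j _.
  congr (P _); apply/seteqP; split => w /= [Ew h]; split => //; last by case: Ew.
  by split => //=; exact: h.
rewrite -e' m'E (_ : fst @^-1` E' `&` _ = E' `*` no_point z c); last first.
  apply/seteqP; split => [[y w] [/= E'y [_ ?]]//|[y w] [/= E'y h]].
  by split => //=; split => //; exact: E'D.
by rewrite muleC muleA -EFinM -expRD addNr expR0 mul1e.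
Qed.

End box.

Lemma mecke_two_points E : measurable E -> E `<=` precedes ->
  \sum_(i <oo) \sum_(j <oo)
    P [set w | E (z i w, z j w) /\ no_point z (tested T C (z i w, z j w)) w] =
  \int[mu \x mu]_(y in E) (survival mu fst (tested T C y) y)%:E.
Proof.
move=> mEE Eprec; have /sigma_finiteP[F [FT ndF Foo]] := sigma_finiteT mu.
pose qk (n : nat) : (nat * nat)%type := if (choice.unpickle n : option (nat * nat)%type) is Some qk then qk else (0%N, 0%N).
pose G n := (A (qk n).1 `&` F (qk n).2) `*` (F (qk n).2 `\` A (qk n).1).
have mG n : measurable (G n).
  rewrite /G; case: (qk n) => q k /=; have [mFk _] := Foo k.
  by apply: measurableX; [exact: measurableI|exact: measurableD].
have Gprec n : G n `<=` precedes.
  by rewrite /G; case: (qk n) => q k y /= [[? ?] [? ?]]; exists q.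
rewrite -(@mecke_formula _ _ _ _ _ _ _ m (mu \x mu) mu z fst snd T C G)//.
- by move=> n y /Gprec; exact: tested_oo.
- move=> n; rewrite /G; case: (qk n) => q k /=; have [mFk Fk] := Foo k.
  rewrite product_measure1E//; [|exact: measurableI|exact: measurableD].
  rewrite lte_mul_pinfty//.
    rewrite ge0_fin_numE//.
    by apply: (le_lt_trans (le_measure _ _ _ _)) Fk; rewrite ?inE//; exact: measurableI.
  by apply: (le_lt_trans (le_measure _ _ _ _)) Fk; rewrite ?inE//; exact: measurableD.
- by move=> n r y /Gprec; exact: TC.
- move=> n D c mD; rewrite /G; case: (qk n) => q k /= DG mc coo Dc.
  by have [mFk Fk] := Foo k; exact: (campbell_box mFk Fk mc coo mD DG).
- move=> y /Eprec[q [Ay nAy]].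
  have [k1 _ Fk1] : (\bigcup_k F k) y.1 by rewrite -FT.
  have [k2 _ Fk2] : (\bigcup_k F k) y.2 by rewrite -FT.
  exists (choice.pickle (q, maxn k1 k2)) => //; rewrite /G /qk choice.pickleK /=.
  have F1 := (subsetPset _ _ (ndF _ _ (leq_maxl k1 k2))) _ Fk1.
  have F2 := (subsetPset _ _ (ndF _ _ (leq_maxr k1 k2))) _ Fk2.
  by [].
Qed.

End two_points.
End mecke_points.

(** * Lebesgue measure and sigma-finite products *)

Section sigma_finite_product.
Context d1 d2 (T1 : measurableType d1) (T2 : measurableType d2) (R : realType).
Variables (m1 : {sigma_finite_measure set T1 -> \bar R}).
Variables (m2 : {sigma_finite_measure set T2 -> \bar R}).

(** An alias of the product that carries a sigma-finite structure for arbitrary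
    sigma-finite factors: on the product itself, inference finds the structure
    of a product of sub-probabilities. *)
Definition sf_prod : set (T1 * T2) -> \bar R := m1 \x m2.

HB.instance Definition _ := Measure.copy sf_prod (m1 \x m2).

Let sf_prod_sigma_finite : sigma_finite setT sf_prod.
Proof.
have /sigma_finiteP[F [TF ndF Foo]] := sigma_finiteT m1.
have /sigma_finiteP[G [TG ndG Goo]] := sigma_finiteT m2.
exists (fun n => F n `*` G n).
  apply/seteqP; split => // -[x y] _.
  have [n _ Fx] : (\bigcup_n F n) x by rewrite -TF.
  have [k _ Gy] : (\bigcup_n G n) y by rewrite -TG.
  exists (maxn n k) => //; split => /=.
    by move: x Fx; exact/subsetPset/ndF/leq_maxl.
  by move: y Gy; exact/subsetPset/ndG/leq_maxr.
move=> k; have [? ?] := Foo k; have [? ?] := Goo k.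
split; first exact: measurableX.
by rewrite /sf_prod product_measure1E// lte_mul_pinfty// ge0_fin_numE.
Qed.

HB.instance Definition _ := Measure_isSigmaFinite.Build _ _ _ sf_prod
  sf_prod_sigma_finite.

End sigma_finite_product.

Section leb.
Context (R : realType).

(** Lebesgue measure over [R] with the display of [R] as the target of random
    variables, so that it can be multiplied with their laws. *)
Definition leb : set R -> \bar R := @lebesgue_measure R.

Let leb0 : leb set0 = 0. Proof. exact: measure0. Qed.
Let leb_ge0 A : 0 <= leb A. Proof. exact: measure_ge0. Qed.
Let leb_sigma_additive : semi_sigma_additive leb.
Proof. exact: (@measure_semi_sigma_additive _ _ _ (@lebesgue_measure R)). Qed.
HB.instance Definition _ :=
  isMeasure.Build _ _ _ leb leb0 leb_ge0 leb_sigma_additive.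

Let leb_sigma_finite : sigma_finite setT leb.
Proof. exact: (@sigma_finiteT _ _ _ (@lebesgue_measure R)). Qed.
HB.instance Definition _ :=
  Measure_isSigmaFinite.Build _ _ _ leb leb_sigma_finite.

Lemma integral_leb (f : R -> \bar R) : measurable_fun setT f ->
  (forall y, 0 <= f y) -> \int[leb]_y f y = \int[@lebesgue_measure R]_y f y.
Proof.
move=> mf f0.
have mid : measurable_fun [set: measurableTypeR R] (id : measurableTypeR R -> R).
  by move=> _ B mB; rewrite setTI.
have := @ge0_integral_pushforward _ _ (measurableTypeR R) R R id mid (@lebesgue_measure R) setT f measurableT.
by rewrite preimage_setT; apply => // y _.
Qed.

Lemma integral_leb_in (D : set R) (f : R -> \bar R) : measurable D ->
  measurable_fun setT f -> (forall y, 0 <= f y) ->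
  \int[leb]_(y in D) f y = \int[@lebesgue_measure R]_(y in D) f y.
Proof.
move=> mD mf f0; rewrite [LHS]integral_mkcond [RHS]integral_mkcond.
apply: integral_leb; last by move=> y; rewrite patchE; case: ifP.
by apply/(measurable_restrictT _ mD); exact: measurable_funTS.
Qed.

Lemma leb_prodE (B : set (R * R)) : measurable B ->
  sf_prod leb leb B = (@lebesgue_measure R \x @lebesgue_measure R) B.
Proof.
move=> mB; apply: integral_leb => [|y]; last exact: measure_ge0.
exact: (@measurable_fun_xsection _ _ R R R leb).
Qed.

Lemma ge0_integral_leb_shift (f : R -> \bar R) (a : R) :
  measurable_fun setT f -> (forall y, 0 <= f y) ->
  \int[leb]_y f (y + a)%R = \int[leb]_y f y.
Proof.
move=> mf f0; rewrite !integral_leb//; last first.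
  by apply: measurableT_comp => //; exact: measurable_shift.
exact: ge0_lebesgue_integral_shift.
Qed.

Lemma integral_leb_expRN (a : R) : (0 < a)%R ->
  \int[leb]_(t in `[0%R, +oo[) (expR (- a * t))%:E = (a^-1)%:E.
Proof.
move=> a0; rewrite integral_leb_in ?integral_expRN//.
by apply/measurable_EFinP; apply: measurableT_comp.
Qed.

End leb.

(** * The Poisson process of leaves *)

Section left_end.
Context (R : realType).

Definition left_end (K : grain R) : R := inf (compacts_set K).

Lemma compacts_lbound (K : compacts R) : has_lbound (compacts_set K).
Proof.
have [M [Mreal KM]] := compact_bounded (@compactsP _ K).
have M1 : (M < M + 1)%R by rewrite ltrDl.
exists (- (M + 1))%R => y Ky.
by have := KM _ M1 y Ky; rewrite /= ler_norml => /andP[].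
Qed.

(** The infimum is below [r] when the set meets ]-oo, r[, an event of the Fell
    sigma-algebra. *)
Lemma measurable_left_end : measurable_fun [set: grain R] left_end.
Proof.
have mhit (G : set R) : open G ->
    measurable ([set K | compacts_set K `&` G !=set0] : set (grain R)).
  by move=> oG; apply: fell_subbase_measurable; left; exists G.
apply: (measurability (@RGenInftyO.G R)); first exact: RGenInftyO.measurableE.
move=> _ [_ [r ->] <-]; rewrite setTI.
(* The infimum of the empty set is 0. *)
rewrite (_ : _ @^-1` _ = [set K | compacts_set K `&` `]-oo, r[%classic !=set0]
    `|` (~` [set K | compacts_set K `&` setT !=set0] `&` [set _ | (0 < r)%R])).
  apply: measurableU; first exact: mhit.
  apply: measurableI; first by apply: measurableC; apply: mhit; exact: openT.
  case: (0 < r)%R; rewrite ?set_true ?set_false; first exact: measurableT.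
  exact: measurable0.
apply/seteqP; split => K /=.
- rewrite in_itv/= => Kr; have [[y Ky]|K0] := pselect (compacts_set K !=set0).
    left; have [u Ku ur] := inf_lt (ex_intro _ y Ky) Kr.
    by exists u; split => //=; rewrite in_itv.
  right; split; first by rewrite setIT.
  suff K00 : compacts_set K = set0 by move: Kr; rewrite /left_end K00 inf0.
  by apply/seteqP; split => // y Ky; case: K0; exists y.
- move=> [[y [Ky]]|[K0 r0]]; rewrite /= !in_itv/=.
    by apply: le_lt_trans; apply: ge_inf => //; exact: compacts_lbound.
  suff K00 : compacts_set K = set0 by rewrite /left_end K00 inf0.
  by apply/seteqP; split => // y Ky; case: K0; rewrite setIT; exists y.
Qed.

End left_end.

Section leaf_process.
Context (R : realType).
Local Notation leb2 := (sf_prod (@leb R) (@leb R)).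

Lemma ge0_integral_leb2_shift (f : R * R -> \bar R) (a : R) :
  measurable_fun setT f -> (forall y, 0 <= f y) ->
  \int[leb2]_p f (p.1 + a, p.2)%R = \int[leb2]_p f p.
Proof.
move=> mf f0; pose phi (p : R * R) : R * R := (p.1 + a, p.2)%R.
have mphi : measurable_fun setT phi.
  apply: measurable_fun_pair => //.
  by apply: (measurableT_comp (measurable_shift a)).
transitivity (\int[@leb R]_s \int[@leb R]_l f (l + a, s)%R).
  exact: (@fubini_tonelli2 _ _ R R R (@leb R) (@leb R) (fun p => f (phi p)) (measurableT_comp mf mphi)).
transitivity (\int[@leb R]_s \int[@leb R]_l f (l, s)); last exact/esym/fubini_tonelli2.
apply: eq_integral => s _; apply: (@ge0_integral_leb_shift R (fun l => f (l, s))) => //.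
exact: measurableT_comp.
Qed.

(** A leaf that is an interval is recorded by its left end, its arrival time
    and its length. *)
Definition leaf_intensity (nu : probability R R) :
  {sigma_finite_measure set (R * R * R)%type -> \bar R} := sf_prod (leb2) nu.

Context d (Omega : measurableType d) (P : probability Omega R).
Variables (Q : probability (grain R) R).
Variables (x t : nat -> {RV P >-> R}) (S : nat -> {RV P >-> grain R}).

Definition leaf_point (i : nat) (w : Omega) : R * R * R :=
  ((x i w + left_end (S i w), t i w), leaf_length (S i w))%R.

Lemma measurable_leaf_point i : measurable_fun setT (leaf_point i).
Proof.
apply: measurable_fun_pair; last first.
  by apply: (measurableT_comp (@measurable_leaf_length R)).
apply: measurable_fun_pair => //; apply: measurable_funD => //.
by apply: (measurableT_comp (@measurable_left_end R)).
Qed.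

Hypothesis HDL : dead_leaves_model Q x t S.

(** Lebesgue measure being invariant under translation, moving each location by
    the left end of its grain does not change the law of the locations. *)
Lemma leaf_point_has_pgfl :
  has_poisson_pgfl P (leaf_intensity (leaf_law Q)) leaf_point.
Proof.
have [[pp1 pp2] lawS indS indxS] := HDL.
have mxt i : measurable_fun setT (fun w => (x i w, t i w)).
  exact: measurable_fun_pair.
have pp : poisson_process P (leb2) (fun i w => (x i w, t i w)).
  split; last exact: pp2.
  by move=> B k mB Boo; have := pp1 B k mB; rewrite -leb_prodE//; apply.
have mphi : measurable_fun setT (fun y : R * R * grain R =>
    ((y.1.1 + left_end y.2, y.1.2), leaf_length y.2)%R : R * R * R).
  have mS2 : measurable_fun setT (snd : R * R * grain R -> grain R) by exact: measurable_snd.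
  apply: measurable_fun_pair; last first.
    exact: (measurableT_comp (@measurable_leaf_length R)).
  apply: measurable_fun_pair; last exact: measurableT_comp.
  apply: measurable_funD; first exact: measurableT_comp.
  exact: (measurableT_comp (@measurable_left_end R)).
apply: (@has_poisson_pgfl_map _ _ _ _ _ _ R P (leb2 \x Q) _ (fun i w => ((x i w, t i w), S i w)) _ mphi).
- move=> h mh h0.
  transitivity (\int[leaf_law Q]_l \int[leb2]_p h (p, l)); first exact: fubini_tonelli2.
  transitivity (\int[Q]_K \int[leb2]_p h (p, leaf_length K)).
    rewrite ge0_integral_pushforward//.
      exact: (@measurable_fun_fubini_tonelli_G _ _ _ _ _ _ h mh h0).
    by move=> l _; exact: integral_ge0.
  transitivity (\int[Q]_K \int[leb2]_p h ((p.1 + left_end K, p.2), leaf_length K)%R).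
    apply: eq_integral => K _; apply/esym.
    apply: (@ge0_integral_leb2_shift (fun p => h (p, leaf_length K))) => //.
    exact: measurableT_comp.
  apply/esym; exact: (@fubini_tonelli2 _ _ _ _ _ leb2 Q _ (measurableT_comp mh mphi) (fun y => h0 _)).
- apply: has_poisson_pgfl_marking => //; exact: poisson_has_pgfl.
Qed.

End leaf_process.

(** * Shadows and visible edges *)

Section shadows.
Context (R : realType).
Local Notation Z := (R * R * R)%type.

Definition edge (e : bool) (y : Z) : R := (y.1.1 + (if e then y.2 else 0))%R.

(** The leaves that hide the point [v] of a leaf arriving at time [s]. *)
Definition shadow (s v : R) : set Z :=
  [set y | (0 <= y.1.2 < s)%R /\ (y.1.1 < v < y.1.1 + y.2)%R].

Lemma measurable_edge e : measurable_fun setT (edge e).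
Proof.
have m1 : measurable_fun [set: Z] fst by exact: measurable_fst.
apply: measurable_funD; first exact: measurableT_comp.
by case: e; [exact: measurable_snd|exact: measurable_cst].
Qed.

Definition length (h : R) : R := Num.max h 0%R.
Definition union_length (z h : R) : R := (length h + Num.min `|z| (length h))%R.

Lemma length_ge0 h : (0 <= length h)%R. Proof. by rewrite le_max lexx orbT. Qed.

Lemma union_length_ge0 z h : (0 <= union_length z h)%R.
Proof. by rewrite addr_ge0// ?length_ge0// le_min normr_ge0 length_ge0. Qed.

Lemma measurable_length : measurable_fun setT length.
Proof. exact: measurable_maxr. Qed.

Lemma measurable_union_length2 :
  measurable_fun setT (fun zh : R * R => union_length zh.1 zh.2).
Proof.
have ml : measurable_fun setT (fun zh : R * R => length zh.2).
  exact: (measurableT_comp measurable_length).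
apply: measurable_funD => //; apply: measurable_minr => //.
exact: measurableT_comp.
Qed.

Lemma measurable_union_length z : measurable_fun setT (union_length z).
Proof. exact: (measurableT_comp measurable_union_length2 (measurable_pair1 z)). Qed.

(** The left ends of the intervals of length [h] that contain [v] in their
    interior are those in ]v - h, v[. *)
Lemma leb_covering v h : leb `](v - h)%R, v[%classic = (length h)%:E.
Proof.
rewrite /leb lebesgue_measure_itv/= lte_fin /length.
have [h0|h0] := ltP h 0%R.
  by rewrite ifF; [|apply/negbTE; rewrite -leNgt; lra].
case: ifPn => [_|]; first by rewrite -EFinB; congr EFin; lra.
by rewrite -leNgt => ?; congr EFin; lra.
Qed.

Lemma leb_union_covering u v h :
  leb (`](u - h)%R, u[%classic `|` `](v - h)%R, v[%classic) = (union_length (v - u) h)%:E.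
Proof.
wlog uv : u v / (u <= v)%R => [hwlog|].
  by have [/hwlog//|/ltW/hwlog] := leP u v; rewrite setUC /union_length distrC.
rewrite /union_length ger0_norm ?subr_ge0// EFinD.
have [h0|h0] := leP h 0%R.
  rewrite !set_itv_ge ?setU0 ?measure0; last 2 first.
  - by rewrite -leNgt bnd_simp; lra.
  - by rewrite -leNgt bnd_simp; lra.
  by rewrite /length (max_idPr h0) min_r ?subr_ge0// adde0.
have lh : length h = h by rewrite /length max_l// ltW.
have [uvh|uvh] := leP u (v - h)%R.
  rewrite measureU//=; last first.
    by apply/seteqP; split => // y; rewrite /= !in_itv/=; lra.
  by rewrite !leb_covering lh min_r//; lra.
rewrite (_ : _ `|` _ = `](u - h)%R, v[%classic); last first.
  by apply/seteqP; split => y; rewrite /= !in_itv/=; lra.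
rewrite /leb lebesgue_measure_itv/= lte_fin ifT; last lra.
by rewrite lh min_l -?EFinD; [congr EFin; lra|lra].
Qed.

Variable nu : probability R R.

Definition union_mean (z : R) : R := fine (\int[nu]_h (union_length z h)%:E).

Variable lam : R.
Hypothesis lamE : \int[nu]_h (length h)%:E = lam%:E.

Lemma union_meanE z : \int[nu]_h (union_length z h)%:E = (union_mean z)%:E.
Proof.
rewrite fineK// ge0_fin_numE; last first.
  by apply: integral_ge0 => h _; rewrite lee_fin union_length_ge0.
apply: (@le_lt_trans _ _ (\int[nu]_h ((length h)%:E + (length h)%:E))).
  apply: ge0_le_integral => //.
  - by move=> h _; rewrite lee_fin union_length_ge0.
  - by apply/measurable_EFinP; exact: measurable_union_length.
  - by apply: emeasurable_funD; apply/measurable_EFinP; exact: measurable_length.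
  - move=> h _; rewrite -EFinD lee_fin lerD2l.
    by rewrite ge_min lexx orbT.
rewrite ge0_integralD//.
- by rewrite lamE -EFinD ltry.
- by move=> h _; rewrite lee_fin length_ge0.
- by apply/measurable_EFinP; exact: measurable_length.
- by move=> h _; rewrite lee_fin length_ge0.
- by apply/measurable_EFinP; exact: measurable_length.
Qed.

Lemma le_lam_union_mean z : (lam <= union_mean z)%R.
Proof.
rewrite -lee_fin -lamE -union_meanE; apply: ge0_le_integral => //.
- by move=> h _; rewrite lee_fin length_ge0.
- by apply/measurable_EFinP; exact: measurable_length.
- by apply/measurable_EFinP; exact: measurable_union_length.
- by move=> h _; rewrite lee_fin lerDl le_min normr_ge0 length_ge0.
Qed.

Lemma measurable_union_mean : measurable_fun setT union_mean.
Proof.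
apply: measurableT_comp => //.
apply: (@measurable_fun_fubini_tonelli_F _ _ R R R nu (fun zh => (union_length zh.1 zh.2)%:E)).
  by apply/measurable_EFinP; exact: measurable_union_length2.
by move=> ?; rewrite lee_fin union_length_ge0.
Qed.

Lemma measurable_shadow s v : measurable (shadow s v).
Proof.
have m1 : measurable_fun [set: Z] fst by exact: measurable_fst.
have mt : measurable_fun [set: Z] (fun y => y.1.2) by exact: measurableT_comp.
have ml : measurable_fun [set: Z] (fun y => y.1.1) by exact: measurableT_comp.
rewrite (_ : shadow s v = (fun y => y.1.2) @^-1` `[0%R, s[%classic `&`
  ((fun y => y.1.1) @^-1` `]-oo, v[%classic `&` edge true @^-1` `]v, +oo[%classic)).
  apply: measurableI; first exact: measurable_preimageT.
  apply: measurableI; apply: measurable_preimageT => //; exact: measurable_edge.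
apply/seteqP; split => y; rewrite /shadow /edge /= !in_itv/= andbT.
  by move=> [-> /andP[-> ->]].
by move=> [-> [-> ->]].
Qed.

(** Cut at the time [s]: before it a leaf misses both [u] and [v], between
    [s] and [s'] it only has to miss [v]. *)
Lemma leaf_intensity_shadowU s s' u v : (0 <= s <= s')%R ->
  leaf_intensity nu (shadow s u `|` shadow s' v) =
  (s * union_mean (v - u) + (s' - s) * lam)%:E.
Proof.
move=> /andP[s0 ss']; set A := _ `|` _.
have mA : measurable A by apply: measurableU; exact: measurable_shadow.
transitivity (\int[leaf_intensity nu]_y (\1_A y)%:E); first by rewrite integral_indic// setIT.
transitivity (\int[nu]_h \int[sf_prod (@leb R) (@leb R)]_p (\1_A (p, h))%:E).
  apply: (@fubini_tonelli2 _ _ _ _ _ (sf_prod (@leb R) (@leb R)) nu (fun y => (\1_A y)%:E)).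
    by apply/measurable_EFinP; exact: measurable_indic.
  by move=> y; rewrite lee_fin.
transitivity (\int[nu]_h (s%:E * (union_length (v - u) h)%:E + (s' - s)%:E * (length h)%:E)).
  apply: eq_integral => h _.
  pose U := `](u - h)%R, u[%classic `|` `](v - h)%R, v[%classic.
  pose V := `](v - h)%R, v[%classic.
  have mU : measurable U by apply: measurableU; exact: measurable_itv.
  have mUs : measurable (U `*` `[0%R, s[%classic).
    by apply: measurableX => //; exact: measurable_itv.
  have mVs : measurable (V `*` `[s, s'[%classic).
    by apply: measurableX; exact: measurable_itv.
  transitivity (\int[sf_prod (@leb R) (@leb R)]_p
     (\1_(U `*` `[0%R, s[%classic `|` V `*` `[s, s'[%classic) p)%:E).
    apply: eq_integral => -[l t] _; congr (_%:E); rewrite !indicE; congr ((nat_of_bool _)%:R).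
    apply/idP/idP => /set_mem AA; apply/mem_set; move: AA; rewrite /A /U /V /shadow /= !in_itv/=.
    - by move=> [[? ?]|[? ?]]; have [ts|ts] := ltP t s; (left + right); split; lra.
    - by move=> [[[?|?] ?]|[? ?]]; (left + right); split; lra.
  rewrite integral_indic//; last exact: measurableU.
  rewrite setIT measureU//; last first.
    by apply/seteqP; split => // -[l t] [[_ /=]]; rewrite !in_itv/= => ? [_]; lra.
  transitivity (leb U * leb `[0%R, s[%classic + leb V * leb `[s, s'[%classic).
    by congr (_ + _); apply: product_measure1E => //; exact: measurable_itv.
  rewrite leb_union_covering leb_covering.
  by rewrite /leb !lebesgue_measure_itv/= !lte_fin muleC [X in _ + X]muleC; congr (_ * _ + _ * _); case: ifPn; rewrite -?leNgt => ?; rewrite -?EFinB; congr EFin; lra.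
rewrite ge0_integralD//.
- rewrite !ge0_integralZl//.
  + by rewrite lamE union_meanE.
  + by apply/measurable_EFinP; exact: measurable_length.
  + by move=> h _; rewrite lee_fin length_ge0.
  + by rewrite lee_fin subr_ge0.
  + by apply/measurable_EFinP; exact: measurable_union_length.
  + by move=> h _; rewrite lee_fin union_length_ge0.
- by move=> h _; rewrite mule_ge0// lee_fin union_length_ge0.
- by apply: measurable_funeM; apply/measurable_EFinP; exact: measurable_union_length.
- by move=> h _; rewrite mule_ge0// lee_fin ?subr_ge0// length_ge0.
- by apply: measurable_funeM; apply/measurable_EFinP; exact: measurable_length.
Qed.

End shadows.

Section tests.
Context (R : realType) d (Y : measurableType d).
Local Notation Z := (R * R * R)%type.
Variables (s v : bool -> Y -> R).
Hypotheses (ms : forall b, measurable_fun setT (s b)).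
Hypotheses (mv : forall b, measurable_fun setT (v b)).

Definition decode_test (n : nat) : bool * (rat * rat * rat) :=
  odflt (true, (0%R, 0%R, 0%R)) (choice.unpickle n).

(** Rational tests: if [v b y] lies in ]a, c[ and [s b y] is larger than [q],
    then a leaf that arrives in [0, q[ and covers [a, c] is in the shadow. *)
Definition shadow_test (n : nat) : set Y :=
  let: (b, (q, a, c)) := decode_test n in
  [set y | (ratr q < s b y)%R /\ (ratr a < v b y < ratr c)%R].

Definition shadow_window (n : nat) : set Z :=
  let: (b, (q, a, c)) := decode_test n in
  [set y | [/\ (0 <= y.1.2 < ratr q)%R, (y.1.1 <= ratr a)%R,
               (ratr a < ratr c :> R)%R & (ratr c <= y.1.1 + y.2)%R]].

Lemma measurable_shadow_test n : measurable (shadow_test n).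
Proof.
rewrite /shadow_test; case: (decode_test n) => b [[q a] c].
rewrite (_ : [set _ | _] = s b @^-1` `]ratr q, +oo[%classic `&` v b @^-1` `]ratr a, ratr c[%classic).
  by apply: measurableI; apply: measurable_preimageT => //; exact: measurable_itv.
by apply/seteqP; split => y /=; rewrite !in_itv/= andbT.
Qed.

Lemma measurable_shadow_window n : measurable (shadow_window n).
Proof.
rewrite /shadow_window; case: (decode_test n) => b [[q a] c].
have m1 : measurable_fun [set: Z] fst by exact: measurable_fst.
have mt : measurable_fun [set: Z] (fun y => y.1.2) by exact: measurableT_comp.
have ml : measurable_fun [set: Z] (fun y => y.1.1) by exact: measurableT_comp.
rewrite (_ : [set _ | _] = (fun y => y.1.2) @^-1` `[0%R, ratr q[%classic `&`
  ((fun y => y.1.1) @^-1` `]-oo, ratr a]%classic `&`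
   (edge true @^-1` `[ratr c, +oo[%classic `&` [set _ | (ratr a < ratr c :> R)%R]))).
  apply: measurableI; first by apply: measurable_preimageT => //; exact: measurable_itv.
  apply: measurableI; first by apply: measurable_preimageT => //; exact: measurable_itv.
  apply: measurableI.
    by apply: measurable_preimageT; [exact: measurable_edge|exact: measurable_itv].
  by case: (ratr a < ratr c)%R; rewrite ?set_true ?set_false; [exact: measurableT|exact: measurable0].
apply/seteqP; split => y; rewrite /edge /= !in_itv/= andbT.
  by move=> [-> -> -> ->].
by move=> [-> [-> [-> ->]]].
Qed.

Lemma tested_shadow y :
  tested shadow_test shadow_window y =
  shadow (s true y) (v true y) `|` shadow (s false y) (v false y).
Proof.
suff H p : (tested shadow_test shadow_window y) p <-> exists b, shadow (s b y) (v b y) p.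
  apply/seteqP; split => p.
    by move=> /H[[|]]; [left|right].
  by move=> [h|h]; apply/H; [exists true|exists false].
split.
  move=> [n]; rewrite /shadow_test /shadow_window /=.
  case: (decode_test n) => b [[q a] c] /= [qs av] [t0q la ac cr].
  by exists b; rewrite /shadow /=; lra.
move=> [b [t0s lvr]].
have /rat_in_itvoo[q] : (p.1.2 < s b y)%R by lra.
have /rat_in_itvoo[a] : (p.1.1 < v b y)%R by lra.
have /rat_in_itvoo[c] : (v b y < p.1.1 + p.2)%R by lra.
rewrite !in_itv/= => cv av qv.
exists (choice.pickle (b, (q, a, c))); rewrite /= /shadow_test /shadow_window /decode_test choice.pickleK/=.
  by lra.
by split; lra.
Qed.

Variables (nu : probability R R) (lam : R).
Hypothesis lamE : \int[nu]_h (length h)%:E = lam%:E.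

(** A shadow grows with its time, so that two shadows are contained in two of
    equal nonnegative times. *)
Lemma leaf_intensity_shadow_lty s1 s2 v1 v2 :
  leaf_intensity nu (shadow s1 v1 `|` shadow s2 v2) < +oo.
Proof.
pose M := Num.max 0%R (Num.max s1 s2).
have M0 : (0 <= M)%R by rewrite le_max lexx.
apply: (@le_lt_trans _ _ (leaf_intensity nu (shadow M v1 `|` shadow M v2))); last first.
  by rewrite (leaf_intensity_shadowU lamE) ?M0 ?lexx// ltry.
apply: le_measure; rewrite ?inE; try by apply: measurableU; exact: measurable_shadow.
have M1 : (s1 <= M)%R by rewrite /M !le_max lexx !orbT.
have M2 : (s2 <= M)%R by rewrite /M !le_max lexx !orbT.
by apply: setUSS => y [ys yv]; split => //; lra.
Qed.

Lemma shadow_window_lty n : leaf_intensity nu (shadow_window n) < +oo.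
Proof.
have := measurable_shadow_window n.
rewrite /shadow_window; case: (decode_test n) => b [[q a] c] mW.
apply: le_lt_trans (leaf_intensity_shadow_lty (ratr q) 0%R ((ratr a + ratr c) / 2)%R 0%R).
apply: le_measure; rewrite ?inE//; first by apply: measurableU; exact: measurable_shadow.
by move=> y [? ? ? ?]; left; split; lra.
Qed.

End tests.

Section mecke_leaves.
Context (R : realType) d (Omega : measurableType d) (P : probability Omega R).
Local Notation Z := (R * R * R)%type.
Variables (nu : probability R R) (lam : R).
Hypothesis lamE : \int[nu]_h (length h)%:E = lam%:E.
Variable z : nat -> Omega -> Z.
Hypothesis mz : forall i, measurable_fun setT (z i).
Hypothesis pz : has_poisson_pgfl P (leaf_intensity nu) z.

Let m1 : measurable_fun [set: Z] fst. Proof. exact: measurable_fst. Qed.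
Let mtime : measurable_fun [set: Z] (fun y => y.1.2).
Proof. exact: measurableT_comp. Qed.

Lemma mecke_one_leaf (e e' : bool) (E : set Z) : measurable E ->
  E `<=` [set y | (0 <= y.1.2)%R] ->
  \sum_(i <oo) P [set w | E (z i w) /\
    no_point z (shadow (z i w).1.2 (edge e (z i w)) `|`
                shadow (z i w).1.2 (edge e' (z i w))) w] =
  \int[leaf_intensity nu]_(y in E)
    (expR (- (y.1.2 * union_mean nu (edge e' y - edge e y))))%:E.
Proof.
move=> mE E0.
pose s (b : bool) (y : Z) : R := y.1.2.
pose v (b : bool) (y : Z) : R := edge (if b then e else e') y.
have ms b : measurable_fun setT (s b) by [].
have mv b : measurable_fun setT (v b) by case: b; exact: measurable_edge.
have testE y := tested_shadow s v y.
under eq_eseriesr do under eq_set do rewrite -(testE (z _ _)).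
rewrite (mecke_one_point mz pz (measurable_shadow_test ms mv) (@measurable_shadow_window R)) //.
- apply: eq_integral => y; rewrite inE => Ey; have y0 := E0 _ Ey.
  have y00 : (0 <= y.1.2 <= y.1.2)%R by rewrite lexx andbT.
  rewrite -[RHS]mul1e; congr ((_ * expR (- _))%:E).
    rewrite testE indicE mem_set//.
    by move=> [] [/andP[_]]; rewrite ltxx.
  have sE : leaf_intensity nu (shadow (s true y) (v true y) `|` shadow (s false y) (v false y)) = _
    := leaf_intensity_shadowU lamE (edge e y) (edge e' y) y00.
  rewrite testE; transitivity (fine (y.1.2 * union_mean nu (edge e' y - edge e y) + (y.1.2 - y.1.2) * lam)%:E); first by congr fine; exact: sE.
 by rewrite /= subrr mul0r addr0.
- by move=> r; exact: (shadow_window_lty lamE).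
- by move=> y; rewrite testE; exact: (leaf_intensity_shadow_lty lamE).
- move=> r y; rewrite /shadow_test /shadow_window; case: (decode_test r) => b [[q a] c].
  by move=> [qs _] [? _ _ _]; move: qs; rewrite /s; lra.
Qed.

(** An edge of each of two leaves: the earlier leaf must not cover the edge of
    the later one. *)
Lemma mecke_two_leaves (e e' : bool) (E : set (Z * Z)) : measurable E ->
  E `<=` [set y | (0 <= y.1.1.2 < y.2.1.2)%R] ->
  \sum_(i <oo) \sum_(j <oo) P [set w | E (z i w, z j w) /\
    no_point z (shadow (z i w).1.2 (edge e (z i w)) `|`
                shadow (z j w).1.2 (edge e' (z j w))) w] =
  \int[leaf_intensity nu \x leaf_intensity nu]_(y in E)
    (\1_(~` [set y : Z * Z | (y.1.1.1 < edge e' y.2 < y.1.1.1 + y.1.2)%R]) y *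
     expR (- (y.1.1.2 * union_mean nu (edge e' y.2 - edge e y.1) +
              (y.2.1.2 - y.1.1.2) * lam)))%:E.
Proof.
move=> mE E0.
pose s (b : bool) (y : Z * Z) : R := (if b then y.1.1.2 else y.2.1.2).
pose v (b : bool) (y : Z * Z) : R := if b then edge e y.1 else edge e' y.2.
have ms b : measurable_fun setT (s b).
  by case: b; apply: (measurableT_comp mtime); [exact: measurable_fst|exact: measurable_snd].
have mv b : measurable_fun setT (v b).
  by case: b; apply: (measurableT_comp (measurable_edge _)); [exact: measurable_fst|exact: measurable_snd].
have testE y := tested_shadow s v y.
pose A n : set Z := [set y | (y.1.2 < ratr (odflt 0%R (choice.unpickle n)))%R].
have mA n : measurable (A n).
  rewrite (_ : A n = (fun y => y.1.2) @^-1` `]-oo, ratr (odflt 0%R (choice.unpickle n))[%classic).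
    by apply: measurable_preimageT => //; exact: measurable_itv.
  by apply/seteqP; split => y; rewrite /A /= in_itv.
have AE y : precedes A y -> (y.1.1.2 < y.2.1.2)%R.
  by move=> [n []]; rewrite /A /= => ? /negP; rewrite -leNgt; exact: lt_le_trans.
transitivity (\sum_(i <oo) \sum_(j <oo) P [set w | E (z i w, z j w) /\
    no_point z (tested (shadow_test s v) (@shadow_window R) (z i w, z j w)) w]).
  by apply: eq_eseriesr => i _; apply: eq_eseriesr => j _; congr (P _); apply/seteqP; split => w; rewrite /= testE.
rewrite (mecke_two_points mz pz mA (measurable_shadow_test ms mv) (@measurable_shadow_window R)) //.
- apply: eq_integral => y; rewrite inE => Ey; have /= /andP[y0 yy] := E0 _ Ey.
  have y01 : (0 <= y.1.1.2 <= y.2.1.2)%R by rewrite y0 ltW.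
  congr ((_ * expR (- _))%:E).
    rewrite testE !indicE; congr ((nat_of_bool _)%:R).
    apply/idP/idP => /set_mem h; apply/mem_set => h'; apply: h.
      by right; split => //; rewrite /=; lra.
    by case: h' => [[/andP[_]]|[_]//]; rewrite ltxx.
  have sE : leaf_intensity nu (shadow (s true y) (v true y) `|` shadow (s false y) (v false y)) = _
    := leaf_intensity_shadowU lamE (edge e y.1) (edge e' y.2) y01.
  by rewrite testE; apply: (congr1 fine sE).
- by move=> r; exact: (shadow_window_lty lamE).
- by move=> y _; rewrite testE; exact: (leaf_intensity_shadow_lty lamE).
- move=> r y /AE yy; rewrite /shadow_test /shadow_window; case: (decode_test r) => b [[q a] c].
  by move=> [qs _] [? _ _ _]; case: b qs; rewrite /s; lra.
- move=> y /E0/= /andP[_ /rat_in_itvoo[q]]; rewrite in_itv/= => /andP[qy1 qy2].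
  have Aq : A (choice.pickle q) = [set y : Z | (y.1.2 < ratr q)%R].
    by rewrite /A choice.pickleK.
  exists (choice.pickle q); rewrite Aq; split; first exact: qy1.
  by apply/negP; rewrite -leNgt; exact: ltW.
Qed.

End mecke_leaves.

(** * Integration over one and two leaves *)

Section leaf_integrals.
Context (R : realType).
Local Notation Z := (R * R * R)%type.
Local Notation leb := (@leb R).
Local Notation leb2 := (sf_prod leb leb).
Variables (nu : probability R R).

(** A change of variables on leaves, after which the edge [e] is where the left
    end was before: see [edge_slide]. *)
Definition slide (e : bool) (y : Z) : Z := ((y.1.1 - (if e then y.2 else 0), y.1.2), y.2)%R.

Lemma edge_slide e y : edge e (slide e y) = y.1.1.
Proof. by rewrite /edge /slide /= subrK. Qed.

Lemma measurable_slide e : measurable_fun setT (slide e).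
Proof.
have m1 : measurable_fun [set: Z] fst by exact: measurable_fst.
have m2 : measurable_fun [set: Z] snd by exact: measurable_snd.
apply: measurable_fun_pair => //; apply: measurable_fun_pair; last exact: measurableT_comp.
apply: measurable_funB; first exact: measurableT_comp.
by case: e; [exact: measurable_snd|exact: measurable_cst].
Qed.

Lemma ge0_integral_slide e (f : Z -> \bar R) :
  measurable_fun setT f -> (forall y, 0 <= f y) ->
  \int[leaf_intensity nu]_y f (slide e y) = \int[leaf_intensity nu]_y f y.
Proof.
move=> mf f0; pose a (h : R) : R := (- (if e then h else 0))%R.
transitivity (\int[nu]_h \int[leb2]_p f ((p.1 + a h, p.2), h)%R).
  exact: (@fubini_tonelli2 _ _ _ _ _ leb2 nu _ (measurableT_comp mf (measurable_slide e)) (fun y => f0 _)).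
transitivity (\int[nu]_h \int[leb2]_p f (p, h)); last exact/esym/(@fubini_tonelli2 _ _ _ _ _ leb2 nu).
apply: eq_integral => h _; apply: (@ge0_integral_leb2_shift R (fun p => f (p, h))) => //.
exact: measurableT_comp.
Qed.

Lemma ge0_integral_leaf (f : Z -> \bar R) :
  measurable_fun setT f -> (forall y, 0 <= f y) ->
  \int[leaf_intensity nu]_y f y = \int[leb]_l \int[nu]_h \int[leb]_s f ((l, s), h).
Proof.
move=> mf f0.
transitivity (\int[leb2]_p \int[nu]_h f (p, h)); first exact: (@fubini_tonelli1 _ _ _ _ _ leb2 nu).
transitivity (\int[leb]_l \int[leb]_s \int[nu]_h f ((l, s), h)).
  apply: (@fubini_tonelli1 _ _ _ _ _ leb leb (fun p => \int[nu]_h f (p, h))).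
    exact: (@measurable_fun_fubini_tonelli_F _ _ _ _ _ nu f mf f0).
  by move=> p; exact: integral_ge0.
apply: eq_integral => l _; apply: (@fubini_tonelli _ _ _ _ _ leb nu (fun sh => f ((l, sh.1), sh.2))) => //.
apply: (measurableT_comp mf); apply: measurable_fun_pair => //.
exact: measurable_fun_pair.
Qed.

Lemma leb_set1 (a : R) : leb [set a] = 0.
Proof. exact: lebesgue_measure_set1. Qed.

Let measurable_exp_tail (A : set R) (a c : R) : measurable A ->
  measurable_fun setT (fun s : R => (\1_A s * expR (- (c * (s - a))))%:E).
Proof.
move=> mA; apply/measurable_EFinP; apply: measurable_funM; first exact: measurable_indic.
apply: measurableT_comp => //; apply: measurable_funN; apply: measurable_funM => //.
exact: measurable_funB.
Qed.

Lemma integral_leb_exp_tail (a c : R) : (0 < c)%R ->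
  \int[leb]_s (\1_`[a, +oo[%classic s * expR (- (c * (s - a))))%:E = (c^-1)%:E.
Proof.
move=> c0; rewrite -(integral_leb_expRN c0) [RHS]integral_mkcond.
rewrite -(ge0_integral_leb_shift a (measurable_exp_tail _ _ _)); last 2 first.
- exact: measurable_itv.
- by move=> y; rewrite lee_fin mulr_ge0// expR_ge0.
apply: eq_integral => s _; rewrite patchE indicE !mem_setE !in_itv/= !andbT lerDr addrK mulNr.
by case: ifP => _; rewrite ?mul1r ?mul0r.
Qed.

Lemma integral_leb_exp_otail (a c : R) : (0 < c)%R ->
  \int[leb]_s (\1_`]a, +oo[%classic s * expR (- (c * (s - a))))%:E = (c^-1)%:E.
Proof.
move=> c0; rewrite -(integral_leb_exp_tail a c0); apply: ge0_ae_eq_integral => //.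
- by apply: measurable_exp_tail; exact: measurable_itv.
- by apply: measurable_exp_tail; exact: measurable_itv.
exists [set a]; split => //; first exact: leb_set1.
move=> s; apply: contra_notP => /eqP sa _; congr (_ * _)%:E; rewrite !indicE.
by rewrite !mem_setE !in_itv/= !andbT lt_neqAle eq_sym sa.
Qed.

Variable lam : R.
Hypothesis lamE : \int[nu]_h (length h)%:E = lam%:E.
Hypothesis lam0 : (0 < lam)%R.

Local Notation um := (union_mean nu).

Lemma union_mean_gt0 z : (0 < um z)%R.
Proof. exact: lt_le_trans (le_lam_union_mean lamE z). Qed.

Lemma union_mean0 : um 0%R = lam.
Proof.
apply: EFin_inj; rewrite -(union_meanE lamE) -lamE; apply: eq_integral => h _.
by rewrite /union_length normr0 min_l ?addr0// length_ge0.
Qed.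

Lemma union_meanN z : um (- z)%R = um z.
Proof.
by congr fine; apply: eq_integral => h _; rewrite /union_length normrN.
Qed.

Let m1 : measurable_fun [set: Z] fst. Proof. exact: measurable_fst. Qed.
Let ml : measurable_fun [set: Z] (fun y => y.1.1). Proof. exact: measurableT_comp. Qed.
Let ms : measurable_fun [set: Z] (fun y => y.1.2). Proof. exact: measurableT_comp. Qed.
Let mh : measurable_fun [set: Z] snd. Proof. exact: measurable_snd. Qed.

Definition one_leaf (e e' : bool) (D : set (R * R)) : set Z :=
  [set y | (0 <= y.1.2)%R /\ D (edge e y, edge e' y)].

Lemma measurable_one_leaf e e' D : measurable D -> measurable (one_leaf e e' D).
Proof.
move=> mD; rewrite (_ : one_leaf _ _ _ = (fun y : Z => y.1.2) @^-1` `[0%R, +oo[%classic `&`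
    (fun y => (edge e y, edge e' y)) @^-1` D); last first.
  by apply/seteqP; split => y; rewrite /one_leaf /= in_itv/= andbT.
apply: measurableI; apply: measurable_preimageT => //.
  by apply: measurable_fun_pair; exact: measurable_edge.
Qed.

(** Sliding each leaf by its edge [e] turns the location into the position of
    that edge and keeps the intensity; the arrival time is then integrated
    out. *)
Lemma one_leaf_integral e e' D : measurable D ->
  \int[leaf_intensity nu]_(y in one_leaf e e' D)
    (expR (- (y.1.2 * um (edge e' y - edge e y))))%:E =
  \int[leb]_u \int[nu]_h
    (\1_D (u, u + (e'%:R - e%:R) * h) * (um ((e'%:R - e%:R) * h))^-1)%:E.
Proof.
move=> mD.
pose f (y : Z) : \bar R := (\1_(one_leaf e e' D) y * expR (- (y.1.2 * um (edge e' y - edge e y))))%:E.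
have mf : measurable_fun setT f.
  apply/measurable_EFinP; apply: measurable_funM.
    by apply: measurable_indic; exact: measurable_one_leaf.
  apply: measurableT_comp => //; apply: measurable_funN; apply: measurable_funM => //.
  apply: (measurableT_comp (measurable_union_mean nu)).
  by apply: measurable_funB; exact: measurable_edge.
have f0 y : 0 <= f y by rewrite lee_fin mulr_ge0 ?expR_ge0.
transitivity (\int[leaf_intensity nu]_y f y).
  rewrite integral_mkcond; apply: eq_integral => y _; rewrite patchE /f [\1_(_ _ _ D) _]indicE.
  by case: ifP => _; rewrite ?mul1r ?mul0r.
rewrite -(ge0_integral_slide e mf f0) ge0_integral_leaf; last 2 first.
- exact: (measurableT_comp mf (measurable_slide e)).
- by move=> y; exact: f0.
apply: eq_integral => u _; apply: eq_integral => h _.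
set v := (u + (e'%:R - e%:R) * h)%R.
have ee' s : edge e' (slide e ((u, s), h)) = v.
  rewrite /edge /slide /v /=; case: (e); case: (e') => /=; lra.
transitivity (\int[leb]_s ((\1_D (u, v))%:E *
    (\1_`[0%R, +oo[%classic s * expR (- (um (v - u) * (s - 0))))%:E)).
  apply: eq_integral => s _; rewrite /f ee' edge_slide/= -EFinM mulrA; congr (_ * _)%:E.
    rewrite !indicE -natrM mulnb; congr ((nat_of_bool _)%:R).
    rewrite [in RHS]mem_setE in_itv/= andbT.
    apply/idP/idP.
      by move=> /set_mem[/= s0]; rewrite ee' edge_slide => Duv; apply/andP; split => //; exact/mem_set.
    by move=> /andP[/set_mem Duv s0]; apply/mem_set; rewrite /one_leaf /= ee' edge_slide.
  by rewrite subr0 mulrC.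
rewrite ge0_integralZl ?lee_fin//; last by apply: measurable_exp_tail; exact: measurable_itv.
by rewrite integral_leb_exp_tail ?union_mean_gt0// (_ : (v - u = (e'%:R - e%:R) * h)%R)// /v; ring.
Qed.

(** The lengths of an earlier leaf with edge [e] at 0 that does not cover [z]. *)
Definition missing (e : bool) (z : R) : set R :=
  ~` [set h | (- (if e then h else 0) < z < h - (if e then h else 0))%R].

Definition two_leaves (e e' : bool) (D : set (R * R)) : set (Z * Z) :=
  [set y | (0 <= y.1.1.2 < y.2.1.2)%R /\ D (edge e y.1, edge e' y.2)].

Let f1 : measurable_fun [set: Z * Z] fst. Proof. exact: measurable_fst. Qed.
Let f2 : measurable_fun [set: Z * Z] snd. Proof. exact: measurable_snd. Qed.
Let ms1 : measurable_fun [set: Z * Z] (fun y => y.1.1.2).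
Proof. exact: (measurableT_comp ms). Qed.
Let ms2 : measurable_fun [set: Z * Z] (fun y => y.2.1.2).
Proof. exact: (measurableT_comp ms). Qed.

Lemma measurable_two_leaves e e' D : measurable D -> measurable (two_leaves e e' D).
Proof.
move=> mD; rewrite (_ : two_leaves _ _ _ = (fun y : Z * Z => y.1.1.2) @^-1` `[0%R, +oo[%classic `&`
    ((fun y : Z * Z => y.2.1.2 - y.1.1.2)%R @^-1` `]0%R, +oo[%classic `&`
    (fun y => (edge e y.1, edge e' y.2)) @^-1` D)); last first.
  apply/seteqP; split => y; rewrite /two_leaves /= !in_itv/= !andbT subr_gt0.
    by move=> [/andP[-> ->]].
  by move=> [-> [-> ?]].
apply: measurableI; first exact: measurable_preimageT.
apply: measurableI.
  by apply: measurable_preimageT; [exact: measurable_funB|exact: measurable_itv].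
apply: measurable_preimageT => //; apply: measurable_fun_pair.
  exact: (measurableT_comp (measurable_edge e)).
exact: (measurableT_comp (measurable_edge e')).
Qed.

Let measurable_covering e' :
  measurable [set y : Z * Z | (y.1.1.1 < edge e' y.2 < y.1.1.1 + y.1.2)%R].
Proof.
have me : measurable_fun [set: Z * Z] (fun y => edge e' y.2).
  exact: (measurableT_comp (measurable_edge e')).
rewrite (_ : [set _ | _] = (fun y : Z * Z => edge e' y.2 - edge false y.1)%R @^-1` `]0%R, +oo[%classic `&`
    (fun y : Z * Z => edge true y.1 - edge e' y.2)%R @^-1` `]0%R, +oo[%classic).
  apply: measurableI; apply: measurable_preimageT; try exact: measurable_itv.
    by apply: measurable_funB => //; exact: (measurableT_comp (measurable_edge false)).
  by apply: measurable_funB => //; exact: (measurableT_comp (measurable_edge true)).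
apply/seteqP; split => y; rewrite /= !in_itv/= !andbT !subr_gt0 [edge false _]addr0.
  by move=> /andP[].
by move=> [? ?]; apply/andP.
Qed.

(** After sliding both leaves the variables are the two positions [u], [v],
    the two times and the length of the earlier leaf. The later time
    contributes [lam^-1], the earlier one [(um (v - u))^-1], and the length
    the probability that the earlier leaf misses [v]. *)
Lemma two_leaves_integral e e' D : measurable D ->
  \int[leaf_intensity nu \x leaf_intensity nu]_(y in two_leaves e e' D)
    (\1_(~` [set y : Z * Z | (y.1.1.1 < edge e' y.2 < y.1.1.1 + y.1.2)%R]) y *
     expR (- (y.1.1.2 * um (edge e' y.2 - edge e y.1) + (y.2.1.2 - y.1.1.2) * lam)))%:E =
  \int[leb]_u \int[leb]_v ((\1_D (u, v) / (lam * um (v - u)))%:E * nu (missing e (v - u))).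
Proof.

move=> mD; set C := [set y : Z * Z | _].
pose f (y : Z * Z) : \bar R := (\1_(two_leaves e e' D) y * (\1_(~` C) y *
  expR (- (y.1.1.2 * um (edge e' y.2 - edge e y.1) + (y.2.1.2 - y.1.1.2) * lam))))%:E.
have me b : measurable_fun [set: Z * Z] (fun y => edge b y.1).
  exact: (measurableT_comp (measurable_edge b)).
have me' b : measurable_fun [set: Z * Z] (fun y => edge b y.2).
  exact: (measurableT_comp (measurable_edge b)).
have mf : measurable_fun setT f.
  apply/measurable_EFinP; apply: measurable_funM.
    by apply: measurable_indic; exact: measurable_two_leaves.
  apply: measurable_funM; first by apply: measurable_indic; apply: measurableC; exact: measurable_covering.
  apply: measurableT_comp => //; apply: measurable_funN; apply: measurable_funD.
    apply: measurable_funM => //; apply: (measurableT_comp (measurable_union_mean nu)).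
    exact: measurable_funB.
  by apply: measurable_funM => //; exact: measurable_funB.
have f0 y : 0 <= f y by rewrite lee_fin !mulr_ge0 ?expR_ge0.
transitivity (\int[leaf_intensity nu \x leaf_intensity nu]_y f y).
  rewrite integral_mkcond; apply: eq_integral => y _; rewrite patchE /f [\1_(_ _ _ D) _]indicE.
  by case: ifP => _; rewrite ?mul1r ?mul0r.
pose phi (l1 s1 h1 l2 : R) : \bar R := (\1_D (l1, l2) * \1_(missing e (l2 - l1)) h1 * lam^-1 *
  (\1_`[0%R, +oo[%classic s1 * expR (- (um (l2 - l1) * (s1 - 0)))))%:E.
have fE l1 s1 h1 l2 s2 h2 : f (slide e ((l1, s1), h1), slide e' ((l2, s2), h2)) =
    (lam%:E * phi l1 s1 h1 l2) * (\1_`]s1, +oo[%classic s2 * expR (- (lam * (s2 - s1))))%:E.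
  rewrite /f /phi !edge_slide/= -!EFinM; congr EFin.
  rewrite (_ : (- (s1 * _ + _) = - (um (l2 - l1) * (s1 - 0)) + - (lam * (s2 - s1)))%R); last ring.
  rewrite expRD; set X := expR _; set W := expR _.
  transitivity (\1_D (l1, l2) * \1_(missing e (l2 - l1)) h1 * \1_`[0%R, +oo[%classic s1 * \1_`]s1, +oo[%classic s2 * (X * W))%R; last by field; rewrite gt_eqF.
  rewrite mulrA; congr (_ * _)%R; rewrite !indicE -!natrM !mulnb; congr ((nat_of_bool _)%:R).
  rewrite !mem_setE !in_itv/= !andbT.
  apply/idP/idP.
    move=> /andP[/set_mem[/= /andP[s10 s12]]]; rewrite !edge_slide => Dl /set_mem Ce.
    rewrite s10 s12 !andbT; apply/andP; split; first exact/mem_set.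
    by apply/mem_set => hh; apply: Ce; rewrite /C /= edge_slide /=; move: hh; case: (e) => /=; lra.
  move=> /andP[/andP[/andP[/set_mem Dl /set_mem Me] s10] s12]; apply/andP; split.
    by apply/mem_set; rewrite /two_leaves /= !edge_slide s10 s12.
  by apply/mem_set => hh; apply: Me; move: hh; rewrite /C /= edge_slide; case: (e) => /=; lra.
have mphi : measurable_fun setT (fun y : (R * R) * (R * R) => phi y.1.1 y.2.2 y.1.2 y.2.1).
  have p1 : measurable_fun [set: (R * R) * (R * R)] (fun y => y.1.1) by exact: measurableT_comp.
  have p2 : measurable_fun [set: (R * R) * (R * R)] (fun y => y.1.2) by exact: measurableT_comp.
  have q1 : measurable_fun [set: (R * R) * (R * R)] (fun y => y.2.1) by exact: measurableT_comp.
  have q2 : measurable_fun [set: (R * R) * (R * R)] (fun y => y.2.2) by exact: measurableT_comp.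
  apply/measurable_EFinP; apply: measurable_funM.
    apply: measurable_funM => //; apply: measurable_funM.
      apply: (measurableT_comp (measurable_indic mD)).
      exact: measurable_fun_pair.
    pose p (y : (R * R) * (R * R)) : R := (y.2.1 - y.1.1 + (if e then y.1.2 else 0))%R.
    have mp : measurable_fun setT p.
      apply: measurable_funD; first exact: measurable_funB.
      by case: (e) => //; exact: measurable_cst.
    rewrite (_ : (fun _ => _) = \1_(~` (p @^-1` `]0%R, +oo[%classic `&`
        (fun y => y.1.2 - p y)%R @^-1` `]0%R, +oo[%classic))).
      apply: measurable_indic; apply: measurableC; apply: measurableI.
        by apply: measurable_preimageT => //; exact: measurable_itv.
      by apply: measurable_preimageT; [exact: measurable_funB|exact: measurable_itv].
    apply/funext => y; rewrite !indicE; congr ((nat_of_bool _)%:R).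
    apply/idP/idP => /set_mem h; apply/mem_set => h'; apply: h; move: h'; rewrite /= !in_itv/= !andbT /p; case: (e) => /=; lra.
  apply: measurable_funM.
    by apply: (measurableT_comp (measurable_indic (measurable_itv _))).
  apply: measurableT_comp => //; apply: measurable_funN; apply: measurable_funM.
    by apply: (measurableT_comp (measurable_union_mean nu)); exact: measurable_funB.
  by apply: measurable_funB => //; exact: measurable_cst.
have phi0 l1 s1 h1 l2 : 0 <= phi l1 s1 h1 l2.
  by rewrite lee_fin !mulr_ge0 ?expR_ge0 ?invr_ge0// ltW.
transitivity (\int[leaf_intensity nu]_y1 \int[leaf_intensity nu]_y2 f (y1, y2)).
  exact: (@fubini_tonelli1 _ _ _ _ _ (leaf_intensity nu) (leaf_intensity nu)).
transitivity (\int[leaf_intensity nu]_y1 \int[leaf_intensity nu]_y2 f (y1, slide e' y2)).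
  apply: eq_integral => y1 _; rewrite (ge0_integral_slide e' (f := fun y2 => f (y1, y2)))//.
  exact: measurableT_comp.
have mfs : measurable_fun setT (fun y : Z * Z => f (slide e y.1, slide e' y.2)).
  apply: (measurableT_comp mf); apply: measurable_fun_pair.
    exact: (measurableT_comp (measurable_slide e)).
  exact: (measurableT_comp (measurable_slide e')).
transitivity (\int[leaf_intensity nu]_y1 \int[leaf_intensity nu]_y2 f (slide e y1, slide e' y2)).
  apply/esym; apply: (@ge0_integral_slide e (fun y1 => \int[leaf_intensity nu]_y2 f (y1, slide e' y2))).
    have mfG : measurable_fun setT (fun y : Z * Z => f (y.1, slide e' y.2)).
      apply: (measurableT_comp mf); apply: measurable_fun_pair => //.
      exact: (measurableT_comp (measurable_slide e')).
    exact: (@measurable_fun_fubini_tonelli_F _ _ Z Z R (leaf_intensity nu) _ mfG (fun y => f0 _)).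
  by move=> y; exact: integral_ge0.
transitivity (\int[leaf_intensity nu]_y1 \int[leb]_l2 phi y1.1.1 y1.1.2 y1.2 l2).
  apply: eq_integral => -[[l1 s1] h1] _; rewrite ge0_integral_leaf//; last first.
    exact: (measurableT_comp mfs (measurable_pair1 _)).
  apply: eq_integral => l2 _; rewrite /=.
  transitivity (\int[nu]_h2 phi l1 s1 h1 l2); last by rewrite integral_cst//= probability_setT mule1.
  apply: eq_integral => h2 _; under eq_integral do rewrite fE.
  rewrite ge0_integralZl//; last 2 first.
  - by apply: measurable_exp_tail; exact: measurable_itv.
  - by rewrite mule_ge0// lee_fin ltW.
  rewrite integral_leb_exp_otail// /phi -!EFinM; congr EFin.
  by rewrite mulrC mulrA mulVf ?mul1r// gt_eqF.
rewrite (@ge0_integral_leaf (fun y1 => \int[leb]_l2 phi y1.1.1 y1.1.2 y1.2 l2)); last 2 first.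
- apply: (@measurable_fun_fubini_tonelli_F _ _ Z R R leb (fun y => phi y.1.1.1 y.1.1.2 y.1.2 y.2)) => //.
  pose g (y : Z * R) : (R * R) * (R * R) := ((y.1.1.1, y.1.2), (y.2, y.1.1.2)).
  have mg : measurable_fun setT g.
    have g1 : measurable_fun [set: Z * R] fst by exact: measurable_fst.
    apply: measurable_fun_pair; apply: measurable_fun_pair; try exact: measurable_snd.
    - exact: (measurableT_comp ml).
    - exact: (measurableT_comp mh).
    - exact: (measurableT_comp ms).
  exact: (measurableT_comp mphi mg).
- by move=> y; exact: integral_ge0.
apply: eq_integral => l1 _.
have mphi' h1 : measurable_fun setT (fun y : R * R => phi l1 y.2 h1 y.1).
  exact: (measurableT_comp mphi (measurable_pair1 (l1, h1))).
have kE l2 h1 : \int[leb]_s1 phi l1 s1 h1 l2 =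
    ((\1_D (l1, l2) / (lam * um (l2 - l1)))%:E * (\1_(missing e (l2 - l1)) h1)%:E).
  rewrite /phi; under eq_integral do rewrite EFinM.
  rewrite ge0_integralZl//; last 2 first.
  - by apply: measurable_exp_tail; exact: measurable_itv.
  - by rewrite lee_fin !mulr_ge0 ?invr_ge0// ltW.
  rewrite integral_leb_exp_tail ?union_mean_gt0// -!EFinM; congr EFin; field.
  by rewrite !gt_eqF ?union_mean_gt0.
transitivity (\int[nu]_h1 \int[leb]_l2 \int[leb]_s1 phi l1 s1 h1 l2).
  apply: eq_integral => h1 _.
  apply: (@fubini_tonelli _ _ _ _ _ leb leb (fun y => phi l1 y.1 h1 y.2)) => //.
  have msw : measurable_fun [set: R * R] (fun y => (y.2, y.1)) by exact: measurable_fun_pair.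
  exact: (measurableT_comp (mphi' h1) msw).
transitivity (\int[leb]_l2 \int[nu]_h1 \int[leb]_s1 phi l1 s1 h1 l2).
  apply: (@fubini_tonelli _ _ _ _ _ nu leb (fun y => \int[leb]_s1 phi l1 s1 y.1 y.2)) => //; last by move=> y; exact: integral_ge0.
  apply: (@measurable_fun_fubini_tonelli_F _ _ (R * R)%type R R leb (fun y => phi l1 y.2 y.1.1 y.1.2)) => //.
  pose g (y : R * R * R) : (R * R) * (R * R) := ((l1, y.1.1), (y.1.2, y.2)).
  have mg : measurable_fun setT g.
    by apply: measurable_fun_pair; apply: measurable_fun_pair.
  exact: (measurableT_comp mphi mg).
apply: eq_integral => l2 _; under eq_integral do rewrite kE.
have mm : measurable (missing e (l2 - l1)).
  apply: measurableC; pose p (h : R) : R := (if e then h else 0)%R.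
  have mp : measurable_fun setT p by rewrite /p; case: (e) => //; exact: measurable_cst.
  rewrite (_ : [set _ | _] = (fun h => l2 - l1 + p h)%R @^-1` `]0%R, +oo[%classic `&`
      (fun h => h - p h - (l2 - l1))%R @^-1` `]0%R, +oo[%classic).
    apply: measurableI; apply: measurable_preimageT; try exact: measurable_itv.
      exact: measurable_funD.
    by apply: measurable_funB => //; exact: measurable_funB.
  by apply/seteqP; split => h; rewrite /= !in_itv/= !andbT /p; case: (e) => /=; lra.
rewrite ge0_integralZl//; last 2 first.
- by apply/measurable_EFinP; exact: measurable_indic.
- by rewrite lee_fin !mulr_ge0 ?invr_ge0// mulr_ge0// ltW// union_mean_gt0.
by rewrite integral_indic// setIT.
Qed.

End leaf_integrals.

(** * Expected numbers of points *)

Section counting_sums.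
Context (R : realType).

Lemma counting_esum (T : choiceType) (A : set T) :
  @counting T R A = \esum_(i in A) 1.
Proof.
have cardE (B : {fset T}) : \sum_(i <- B) (1 : \bar R) = (#|` B|%:R)%:E.
  by rewrite sumEFin big_const_seq count_predT iter_addr_0.
rewrite /counting; case: asboolP => fA.
  by rewrite esum_fset// fsbig_finite//= cardE.
apply/esym/eq_infty => r; apply: esum_ge.
have /archi_boundP/ltW rn : (0 <= Num.max r 0)%R by rewrite le_max lexx orbT.
have [B BA nB] := infinite_set_fset (Num.bound (Num.max r 0%R)) fA.
exists [set` B]; first by split => //; exact: finite_fset.
rewrite fsbig_finite//= ?set_fsetK cardE lee_fin.
by apply: (@le_trans _ _ (Num.max r 0%R)); rewrite ?le_max ?lexx// (le_trans rn)// ler_nat.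
Qed.

Lemma counting_inj (T T' : choiceType) (A : set T) (B : set T') (e : T -> T') :
  set_bij A B e -> @counting T' R B = @counting T R A.
Proof. by move=> bij; rewrite !counting_esum; exact: (reindex_esum _ _ _ _ bij). Qed.

Lemma esum_bool (a : bool -> \bar R) : (forall b, 0 <= a b) ->
  \esum_(b in [set: bool]) a b = \sum_(b : bool) a b.
Proof.
move=> a0; rewrite (esumID [set true])// !setTI esum_set1//.
rewrite (_ : ~` _ = [set false]) ?esum_set1// ?big_bool//.
by apply/seteqP; split => -[] //= h; exfalso; exact: h.
Qed.

Lemma esum_nat_bool (a : nat * bool -> \bar R) : (forall q, 0 <= a q) ->
  \esum_(q in [set: nat * bool]) a q = \sum_(i <oo) \sum_(b : bool) a (i, b).
Proof.
move=> a0; rewrite nneseries_esumT => [|n]; last exact: sume_ge0.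
transitivity (\esum_(i in [set: nat]) \esum_(b in [set: bool]) a (i, b)).
  rewrite esum_esum//; congr esum; last by apply/funext => -[].
  by apply/seteqP; split.
by apply: eq_esum => i _; rewrite esum_bool.
Qed.

Lemma esum_nat_bool2 (a : nat * (nat * (bool * bool)) -> \bar R) : (forall q, 0 <= a q) ->
  \esum_(q in [set: nat * (nat * (bool * bool))]) a q =
  \sum_(i <oo) \sum_(j <oo) \sum_(b : bool) \sum_(b' : bool) a (i, (j, (b, b'))).
Proof.
move=> a0; rewrite nneseries_esumT => [|n]; last first.
  by apply: nneseries_ge0 => j _ _; rewrite sume_ge0// => b _; exact: sume_ge0.
transitivity (\esum_(i in [set: nat]) \esum_(q in [set: nat * (bool * bool)]) a (i, q)).
  rewrite esum_esum//; congr esum; last by apply/funext => -[].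
  by apply/seteqP; split.
apply: eq_esum => i _; rewrite nneseries_esumT => [|n]; last first.
  by rewrite sume_ge0// => b _; exact: sume_ge0.
transitivity (\esum_(j in [set: nat]) \esum_(q in [set: bool * bool]) a (i, (j, q))).
  rewrite esum_esum//; congr esum; last by apply/funext => -[].
  by apply/seteqP; split.
apply: eq_esum => j _.
transitivity (\esum_(b in [set: bool]) \esum_(b' in [set: bool]) a (i, (j, (b, b')))).
  rewrite esum_esum//; congr esum; last by apply/funext => -[].
  by apply/seteqP; split.
rewrite esum_bool => [|b]; last exact: esum_ge0.
by apply: eq_bigr => b _; rewrite esum_bool.
Qed.

Lemma counting_indic (T : choiceType) (A : set T) :
  @counting T R A = \esum_(i in [set: T]) (\1_A i)%:E.
Proof.
rewrite counting_esum esum_mkcond; apply: eq_esum => i _.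
by rewrite indicE; case: ifP.
Qed.

End counting_sums.

Section integral_null.
Context d (T : measurableType d) (R : realType) (m : {measure set T -> \bar R}).

(** The integral of a nonnegative function is the supremum of the integrals of
    the simple functions below it, measurable or not: it does not change on a
    null set. *)
Lemma ge0_integral_null_eq (N : set T) (f g : T -> \bar R) :
  measurable N -> m N = 0 -> measurable_fun setT g ->
  (forall y, 0 <= f y) -> (forall y, 0 <= g y) ->
  (forall y, ~ N y -> f y = g y) -> \int[m]_y f y = \int[m]_y g y.
Proof.
move=> mN N0 mg f0 g0 fg.
pose off (h : T -> \bar R) := h \_ (~` N).
have offE h : measurable_fun setT h -> (forall y, 0 <= h y) ->
    \int[m]_y h y = \int[m]_y off h y.
  move=> mh h0; rewrite /off -integral_mkcond.
  by rewrite (@ge0_negligible_integral _ _ _ m setT N h)// setTD.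
have off0 h : (forall y, 0 <= h y) -> forall y, 0 <= off h y.
  by move=> h0 y; rewrite /off patchE; case: ifP => _; [exact: h0|exact: lexx].
have moff h : measurable_fun setT h -> measurable_fun setT (off h).
  by move=> mh; apply/(measurable_restrictT _ (measurableC mN)); exact: measurable_funTS.
apply/eqP; rewrite eq_le; apply/andP; split.
  rewrite (ge0_integralTE m f0); apply: ge_ereal_sup => _ [h /= hf <-].
  rewrite -integralT_nnsfun offE//; last 2 first.
  - by apply/measurable_EFinP.
  - by move=> y; rewrite lee_fin.
  apply: ge0_le_integral => //.
  - by move=> y _; apply: off0 => ?; rewrite lee_fin.
  - by apply: moff; apply/measurable_EFinP.
  move=> y _; rewrite /off patchE; case: ifPn => [/set_mem Ny|_]; last exact: g0.
  by rewrite -fg//; exact: hf.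
rewrite offE// (ge0_integralTE m f0) (ge0_integralTE m (off0 _ g0)).
apply: le_ereal_sup => _ [h /= hg <-]; exists h => // y.
apply: (le_trans (hg y)); rewrite /off patchE; case: ifPn => [/set_mem Ny|_]; last exact: f0.
by rewrite fg.
Qed.

End integral_null.

Section expected_counts.
Context d (Omega : measurableType d) (R : realType) (P : probability Omega R).
Variables (N : set Omega).
Hypotheses (mN : measurable N) (N0 : P N = 0).

Lemma integral_sum_bool (U : bool -> set Omega) : (forall b, measurable (U b)) ->
  \int[P]_w (\sum_(b : bool) (\1_(U b) w)%:E) = \sum_(b : bool) P (U b).
Proof.
move=> mU; rewrite ge0_integral_sum//.
  by apply: eq_bigr => b _; rewrite integral_indic// setIT.
by move=> b; apply/measurable_EFinP; exact: measurable_indic.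
Qed.

(** Outside a null set the count is the sum of the indicators of the events
    that an index contributes, because the map from the contributing indices
    to the points is a bijection. The expectation of that sum is computed
    termwise; the count itself is not known to be measurable, hence
    [ge0_integral_null_eq]. *)
Lemma expected_count (T : choiceType) (C : Omega -> set T)
    (U : nat * bool -> set Omega) (e : Omega -> nat * bool -> T) :
  (forall q, measurable (U q)) ->
  (forall w, ~ N w -> set_bij [set q | U q w] (C w) (e w)) ->
  \int[P]_w counting (C w) = \sum_(i <oo) \sum_(b : bool) P (U (i, b)).
Proof.
move=> mU bij.
pose s i w : \bar R := \sum_(b : bool) (\1_(U (i, b)) w)%:E.
have ms i : measurable_fun setT (s i).
  by apply: emeasurable_sum => b; apply/measurable_EFinP; exact: measurable_indic.
have s0 i w : 0 <= s i w by apply: sume_ge0 => b _; rewrite lee_fin.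
rewrite (@ge0_integral_null_eq _ _ _ P N _ (fun w => \sum_(i <oo) s i w))//.
- rewrite integral_nneseries//.
  by apply: eq_eseriesr => i _; exact: integral_sum_bool.
- by apply: ge0_emeasurable_sum => //.
- by move=> w; rewrite counting_esum; exact: esum_ge0.
- by move=> w; exact: nneseries_ge0.
- move=> w /bij b; rewrite (counting_inj R b) counting_indic.
  rewrite -(@esum_nat_bool R (fun q => (\1_(U q) w)%:E)) => [|q]; last by rewrite lee_fin.
  by apply: eq_esum => q _; rewrite !indicE; congr ((nat_of_bool _)%:R%:E); apply/idP/idP => /set_mem h; apply/mem_set.
Qed.

Lemma expected_count2 (T : choiceType) (C : Omega -> set T)
    (U : nat * (nat * (bool * bool)) -> set Omega)
    (e : Omega -> nat * (nat * (bool * bool)) -> T) :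
  (forall q, measurable (U q)) ->
  (forall w, ~ N w -> set_bij [set q | U q w] (C w) (e w)) ->
  \int[P]_w counting (C w) =
  \sum_(i <oo) \sum_(j <oo) \sum_(b : bool) \sum_(b' : bool) P (U (i, (j, (b, b')))).
Proof.
move=> mU bij.
pose s i j b w : \bar R := \sum_(b' : bool) (\1_(U (i, (j, (b, b')))) w)%:E.
have ms i j b : measurable_fun setT (s i j b).
  by apply: emeasurable_sum => b'; apply/measurable_EFinP; exact: measurable_indic.
have s0 i j b w : 0 <= s i j b w by apply: sume_ge0 => b' _; rewrite lee_fin.
have mS i j : measurable_fun setT (fun w => \sum_(b : bool) s i j b w).
  exact: emeasurable_sum.
have S0 i j w : 0 <= \sum_(b : bool) s i j b w by exact: sume_ge0.
rewrite (@ge0_integral_null_eq _ _ _ P N _ (fun w => \sum_(i <oo) \sum_(j <oo) \sum_(b : bool) s i j b w))//.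
- rewrite integral_nneseries//.
    apply: eq_eseriesr => i _; rewrite integral_nneseries//.
    apply: eq_eseriesr => j _; rewrite ge0_integral_sum//.
    by apply: eq_bigr => b _; exact: integral_sum_bool.
  by move=> i; apply: ge0_emeasurable_sum.
  by move=> i w _; exact: nneseries_ge0.
- apply: ge0_emeasurable_sum => // [i w _ _|i _]; first exact: nneseries_ge0.
  exact: ge0_emeasurable_sum.
- by move=> w; rewrite counting_esum; exact: esum_ge0.
- by move=> w; apply: nneseries_ge0 => i _ _; exact: nneseries_ge0.
- move=> w /bij b; rewrite (counting_inj R b) counting_indic.
  rewrite -(@esum_nat_bool2 R (fun q => (\1_(U q) w)%:E)) => [|q]; last by rewrite lee_fin.
  by apply: eq_esum => q _; rewrite !indicE; congr ((nat_of_bool _)%:R%:E); apply/idP/idP => /set_mem h; apply/mem_set.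
Qed.

End expected_counts.

(** * The tessellation and its edges *)

Section interval_grains.
Context (R : realType).

Lemma interior_segment (a b : R) : (`[a, b]%classic)° = `]a, b[%classic.
Proof. exact: interior_itv_bnd. Qed.

Lemma boundary_segment (a b : R) : (a < b)%R -> boundary `[a, b]%classic = [set a; b].
Proof.
move=> ab; rewrite /boundary interior_segment.
rewrite (_ : closure _ = `[a, b]%classic); last first.
  by apply/esym/closure_id; exact: itv_closed.
apply/seteqP; split => y; rewrite /= !in_itv/=.
  move=> [/andP[ay yb]] /negP; rewrite negb_and -!leNgt => /orP[ya|yb'].
    by left; apply/eqP; rewrite eq_le ay ya.
  by right; apply/eqP; rewrite eq_le yb yb'.
move=> [->|->]; rewrite lexx ltxx ?andbF/= ?ltW//; split => //.
Qed.

Definition is_segment (K : grain R) : Prop :=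
  (0 < leaf_length K)%R /\
  compacts_set K = `[left_end K, (left_end K + leaf_length K)%R]%classic.

(** A connected compact subset of the line contains its extrema and all points
    between them. *)
Lemma connected_is_segment (K : grain R) : connected (compacts_set K) ->
  (0 < leaf_length K)%R -> is_segment K.
Proof.
move=> /connected_intervalP itvK K0; split => //.
have Kne : compacts_set K !=set0.
  apply/set0P/eqP => Ke; move: K0; rewrite /leaf_length Ke measure0.
  by rewrite ltxx.
have idc : {within compacts_set K, continuous (fun y : R => y)}.
  by apply: continuous_subspaceT => y; exact: cvg_id.
have [a /set_mem Ka amin] := compact_EVT_min Kne (@compactsP _ K) idc.
have [b /set_mem Kb bmax] := compact_EVT_max Kne (@compactsP _ K) idc.
have KE : compacts_set K = `[a, b]%classic.
  apply/seteqP; split => y; rewrite /= in_itv/=.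
    by move=> Ky; rewrite amin ?bmax//; exact/mem_set.
  by move=> yab; exact: (itvK _ _ Ka Kb).
have ab : (a <= b)%R by apply: amin; exact/mem_set.
have aE : left_end K = a by rewrite /left_end KE inf_itv// bnd_simp.
have lE : leaf_length K = (b - a)%R.
  rewrite /leaf_length KE lebesgue_measure_itv/= lte_fin.
  case: ltP => // ba; have -> : a = b by apply/eqP; rewrite eq_le ab ba.
  by rewrite subrr.
by rewrite aE lE addrC subrK.
Qed.

End interval_grains.

Section exposed_edges.
Context (R : realType) d (Omega : measurableType d).
Local Notation Z := (R * R * R)%type.

Definition exposed (z : nat -> Omega -> Z) (e : bool) (i : nat) : set Omega :=
  [set w | (0 <= (z i w).1.2)%R /\ no_point z (shadow (z i w).1.2 (edge e (z i w))) w].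

Lemma measurable_shadow_graph e :
  measurable [set y : Z * Z | shadow y.1.1.2 (edge e y.1) y.2].
Proof.
have m1 : measurable_fun [set: Z] fst by exact: measurable_fst.
have ms : measurable_fun [set: Z] (fun y => y.1.2) by exact: measurableT_comp.
have f1 : measurable_fun [set: Z * Z] fst by exact: measurable_fst.
have f2 : measurable_fun [set: Z * Z] snd by exact: measurable_snd.
have me : measurable_fun [set: Z * Z] (fun y => edge e y.1).
  exact: (measurableT_comp (measurable_edge e)).
have ms1 : measurable_fun [set: Z * Z] (fun y => y.1.1.2) by exact: (measurableT_comp ms).
have ms2 : measurable_fun [set: Z * Z] (fun y => y.2.1.2) by exact: (measurableT_comp ms).
rewrite (_ : [set _ | _] = (fun y : Z * Z => y.2.1.2) @^-1` `[0%R, +oo[%classic `&`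
  ((fun y : Z * Z => y.1.1.2 - y.2.1.2)%R @^-1` `]0%R, +oo[%classic `&`
  ((fun y : Z * Z => edge e y.1 - edge false y.2)%R @^-1` `]0%R, +oo[%classic `&`
   (fun y : Z * Z => edge true y.2 - edge e y.1)%R @^-1` `]0%R, +oo[%classic))).
  apply: measurableI; first exact: measurable_preimageT.
  apply: measurableI.
    by apply: measurable_preimageT; [exact: measurable_funB|exact: measurable_itv].
  apply: measurableI; apply: measurable_preimageT; try exact: measurable_itv.
    by apply: measurable_funB => //; exact: (measurableT_comp (measurable_edge false)).
  by apply: measurable_funB => //; exact: (measurableT_comp (measurable_edge true)).
apply/seteqP; split => y; rewrite /shadow /= !in_itv/= !andbT !subr_gt0 [edge false _]addr0.
  by move=> [/andP[-> ->] /andP[-> ]].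
by move=> [-> [-> [-> ]]].
Qed.

Lemma measurable_exposed (z : nat -> Omega -> Z) e i :
  (forall i, measurable_fun setT (z i)) -> measurable (exposed z e i).
Proof.
move=> mz.
have ms : measurable_fun setT (fun w => (z i w).1.2).
  apply: measurableT_comp => //; exact: measurableT_comp.
rewrite (_ : exposed z e i = (fun w => (z i w).1.2) @^-1` `[0%R, +oo[%classic `\`
   \bigcup_k (fun w => (z i w, z k w)) @^-1` [set y : Z * Z | shadow y.1.1.2 (edge e y.1) y.2]).
  apply: measurableD; first exact: measurable_preimageT.
  apply: bigcupT_measurable => k; apply: measurable_preimageT; last exact: measurable_shadow_graph.
  exact: measurable_fun_pair.
apply/seteqP; split => w; rewrite /exposed /no_point /= in_itv/= andbT.
  by move=> [-> h]; split => // -[k _]; exact: h.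
by move=> [-> h]; split => // k sk; apply: h; exists k.
Qed.

Variables (P : probability Omega R) (Q : probability (grain R) R).
Variables (x t : nat -> {RV P >-> R}) (S : nat -> {RV P >-> grain R}).
Local Notation z := (leaf_point x t S).

(** The boundary of an interval grain consists of its two ends, and its
    interior misses a point exactly when the leaf is not in the shadow. *)
Lemma tessellation_boundaryE w : (forall i, is_segment (S i w)) ->
  tessellation_boundary (x ^~ w) (t ^~ w) (S ^~ w) =
  [set p | exists i e, exposed z e i w /\ edge e (z i w) = p].
Proof.
move=> segS.
have bdE i : translate (boundary (compacts_set (S i w))) (x i w) = [set edge false (z i w); edge true (z i w)].
  have [l0 ->] := segS i; rewrite boundary_segment ?ltrDl//.
  rewrite /edge /leaf_point /translate image_setU !image_set1/= addr0 addrC.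
  by congr ([set _] `|` [set _]); rewrite addrC addrA.
have intE i p : translate (compacts_set (S i w))° (x i w) p <->
    ((z i w).1.1 < p < (z i w).1.1 + (z i w).2)%R.
  have [l0 ->] := segS i; rewrite interior_segment /leaf_point /translate /=; split.
    by move=> [a]; rewrite in_itv/= => al <-; lra.
  by move=> h; exists (p - x i w)%R; [rewrite in_itv/=; lra|rewrite subrK].
apply/seteqP; split => p.
  move=> [i /= ti]; rewrite bdE => -[iE nE].
  have [e eE] : exists e, edge e (z i w) = p by case: iE => ->; eexists.
  exists i, e; split => //; split => // k [tk ck]; apply: nE.
  by exists k => //; apply/intE; rewrite -eE.
move=> [i [e [[ti ne] <-]]]; exists i => //; split.
  by rewrite bdE; case: e {ne}; [right|left].
by move=> [k /= tk /intE ck]; apply: (ne k); split.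
Qed.

Lemma pointsE w : points (dead_leaves_points x t S) w =
  tessellation_boundary (x ^~ w) (t ^~ w) (S ^~ w).
Proof.
apply/seteqP; split => p; rewrite /points /dead_leaves_points /counting_process /=; set Phi := tessellation_boundary _ _ _.
  move=> h; have [//|Np] := pselect (Phi p); move: h.
  rewrite (_ : _ `&` _ = set0) ?counting_esum ?esum_set0 ?ltxx//.
  by apply/seteqP; split => // q [Pq /= qp]; apply: Np; rewrite -qp.
move=> Pp; rewrite (_ : _ `&` _ = [set p]); last by apply/seteqP; split => [q []//|q /= ->].
by rewrite counting_esum esum_set1.
Qed.

Definition distinct_edges (w : Omega) : Prop := forall i j e e',
  exposed z e i w -> exposed z e' j w -> (i, e) <> (j, e') ->
  edge e (z i w) <> edge e' (z j w).

Lemma edge_points_bij w (A : set R) : (forall i, is_segment (S i w)) -> distinct_edges w ->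
  set_bij [set q | exposed z q.2 q.1 w /\ A (edge q.2 (z q.1 w))]
    (tessellation_boundary (x ^~ w) (t ^~ w) (S ^~ w) `&` A)
    (fun q => edge q.2 (z q.1 w)).
Proof.
move=> segS dist; rewrite tessellation_boundaryE//; split.
- by move=> [i e] [/= ee ?]; split => //; exists i, e.
- move=> [i e] [j e'] /set_mem[/= ei _] /set_mem[/= ej _].
  by apply: contra_eq => /eqP ne; apply/eqP; exact: dist.
- move=> p [[i [e [ei <-]]] Ap]; exists (i, e) => //.
Qed.

Lemma edge_pairs_bij w (D : set (R * R)) : (forall i, is_segment (S i w)) -> distinct_edges w ->
  set_bij [set q : nat * (nat * (bool * bool)) |
      [/\ exposed z q.2.2.1 q.1 w, exposed z q.2.2.2 q.2.1 w,
          (q.1, q.2.2.1) <> (q.2.1, q.2.2.2) &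
          D (edge q.2.2.1 (z q.1 w), edge q.2.2.2 (z q.2.1 w))]]
    [set p | [/\ D p, p.1 != p.2, points (dead_leaves_points x t S) w p.1 &
        points (dead_leaves_points x t S) w p.2]]
    (fun q => (edge q.2.2.1 (z q.1 w), edge q.2.2.2 (z q.2.1 w))).
Proof.
move=> segS dist; rewrite pointsE tessellation_boundaryE//; split.
- move=> [i [j [e e']]] [/= ei ej ne Dij]; split => //=.
  + by apply/eqP; exact: dist.
  + by exists i, e.
  + by exists j, e'.
- have inj i j e e' : exposed z e i w -> exposed z e' j w -> edge e (z i w) = edge e' (z j w) -> (i, e) = (j, e').
    by move=> ei ej; apply: contra_eq => /eqP ne; apply/eqP; exact: dist.
  move=> [i [j [e e']]] [k [l [f f']]] /set_mem[/= ei ej _ _] /set_mem[/= ek el _ _].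
  by move=> [/(inj _ _ _ _ ei ek)[-> ->] /(inj _ _ _ _ ej el)[-> ->]].
- move=> [p1 p2] [/= Dp pp [i [e [ei ip]]] [j [e' [ej jp]]]].
  exists (i, (j, (e, e'))); rewrite /= ?ip ?jp//; split => // -[ij ee].
  by move: pp; rewrite -ip -jp ij ee eqxx.
Qed.

End exposed_edges.

(** * Arrival times are almost surely different *)

Lemma nneseries_eq0 (R : realType) (u : nat -> \bar R) : (forall n, 0 <= u n) ->
  \sum_(n <oo) u n = 0 -> forall n, u n = 0.
Proof.
move=> u0 su n; apply/eqP; rewrite eq_le u0 andbT -su.
apply: le_trans (nneseries_lim_ge n.+1 (fun k _ _ => u0 k)).
by rewrite big_nat_recr//= leeDr// sume_ge0.
Qed.

Section no_ties.
Context d (Omega : measurableType d) (R : realType) (P : probability Omega R).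

Definition double_points T (z : nat -> Omega -> T) (B : set T) : set Omega :=
  \bigcup_i \bigcup_(j in [set j | i <> j]) [set w | B (z i w) /\ B (z j w)].

Lemma measurable_double_points dT (T : measurableType dT) (z : nat -> Omega -> T) B :
  (forall i, measurable_fun setT (z i)) -> measurable B -> measurable (double_points z B).
Proof.
move=> mz mB; apply: bigcupT_measurable => i; apply: bigcup_measurable => j _.
by apply: measurableI; exact: measurable_preimageT.
Qed.

(** What remains of a Poisson variable of mean [m] when the values 0 and 1 are
    excluded has probability 1 - (1 + m) exp(- m), hence at most m ^+ 2. *)
Lemma double_points_le dT (T : measurableType dT) (m : {measure set T -> \bar R})
    (z : nat -> Omega -> T) B :
  (forall i, measurable_fun setT (z i)) -> poisson_process P m z ->
  measurable B -> m B < +oo -> P (double_points z B) <= (fine (m B) ^+ 2)%:E.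
Proof.
move=> mz [pp _] mB Boo; set U := double_points z B.
have mU : measurable U by exact: measurable_double_points.
pose A0 := \bigcap_i [set w | ~ B (z i w)].
have mA0 : measurable A0.
  by apply: bigcapT_measurable => i; exact: (measurable_preimageT (mz i) (measurableC mB)).
have count_fin (A : set nat) k : @counting nat R A = k%:R%:E -> finite_set A /\ #|` fset_set A| = k.
  by rewrite /counting; case: asboolP => // fA [] /eqP; rewrite eqr_nat => /eqP.
have count0 w : point_count R z B w = 0%:R%:E -> A0 w.
  move=> /count_fin[fA /cardfs0_eq/(congr1 (fun X : {fset nat} => [set` X]))].
  rewrite fset_setK// set_fset0 => A_0 i _ Bi.
  by have : [set i | B (z i w)] i by []; rewrite A_0.
have count1 w : point_count R z B w = 1%:R%:E -> ~ (U `|` A0) w.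
  move=> /count_fin[fA /eqP/cardfs1P[i /(congr1 (fun X : {fset nat} => [set` X]))]].
  rewrite fset_setK// set_fset1 => Ai [].
    move=> [j _ [k /= jk [Bj Bk]]]; apply: jk.
    have : [set i | B (z i w)] j by [].
    have : [set i | B (z i w)] k by [].
    by rewrite Ai => -> ->.
  have : [set i | B (z i w)] i by rewrite Ai.
  by move=> Bi /(_ i Logic.I).
have A0count w : A0 w -> point_count R z B w = 0%:R%:E.
  move=> h; rewrite /point_count (_ : [set i | _] = set0); last first.
    by apply/seteqP; split => // i; exact: h.
  by rewrite counting_esum esum_set0.
have count1' w : ~ (U `|` A0) w -> point_count R z B w = 1%:R%:E.
  move=> h; have [i Bi] : exists i, B (z i w).
    by apply: contrapT => n; apply: h; right => i _ Bi; apply: n; exists i.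
  rewrite /point_count (_ : [set i | _] = [set i]) ?counting_esum ?esum_set1//.
  apply/seteqP; split => [j Bj|j /= ->//]; apply: contrapT => ji; apply: h; left.
  by exists j => //; exists i.
have P0 : P A0 = (expR (- fine (m B)))%:E.
  rewrite (_ : A0 = [set w | point_count R z B w = 0%:R%:E]); last first.
    by apply/seteqP; split.
  by rewrite pp// expr0 fact0 divr1 mul1r.
have P1 : P (~` (U `|` A0)) = (fine (m B) * expR (- fine (m B)))%:E.
  rewrite (_ : ~` _ = [set w | point_count R z B w = 1%:R%:E]); last first.
    by apply/seteqP; split.
  by rewrite pp// expr1 divr1.
have UA0 : U `&` A0 = set0.
  by apply/seteqP; split => // w [[i _ [j _ [Bi _]]] /(_ i Logic.I)].
have PU : P (U `|` A0) = P U + P A0 by rewrite measureU.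
have := probability_setC P (measurableU _ _ mU mA0).
rewrite P1 PU P0 => h1.
have Pfin : P U \is a fin_num by rewrite fin_num_measure.
have : (fine (m B) * expR (- fine (m B)) = 1 - (fine (P U) + expR (- fine (m B))))%R.
  by apply: EFin_inj; rewrite h1 EFinB EFinD fineK.
rewrite -[P U]fineK// lee_fin.
have m0 : (0 <= fine (m B))%R by rewrite fine_ge0.
have := expR_ge1Dx (- fine (m B)); have := expR_ge0 (- fine (m B)).
set c := fine (m B) in m0 *; set E := expR _; nra.
Qed.

Definition ties (x t : nat -> Omega -> R) : set Omega :=
  [set w | exists i j, [/\ i <> j, (0 <= t i w)%R & t i w = t j w]].

Local Notation leb2 := (sf_prod (@leb R) (@leb R)).

Lemma ties_negligible (x t : nat -> Omega -> R) :
  (forall i, measurable_fun setT (x i)) -> (forall i, measurable_fun setT (t i)) ->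
  poisson_process P leb2 (fun i w => (x i w, t i w)) -> P.-negligible (ties x t).
Proof.
move=> mx mt pp.
pose V M : set (R * R) := `[(- M%:R)%R, M%:R%R]%classic `*` `[0%R, M%:R%R[%classic.
pose E M : set Omega := \bigcup_i \bigcup_(j in [set j | i <> j])
  [set w | [/\ V M (x i w, t i w), V M (x j w, t j w) & t i w = t j w]].
have mxt i : measurable_fun setT (fun w => (x i w, t i w)) by exact: measurable_fun_pair.
have mV M : measurable (V M) by apply: measurableX; exact: measurable_itv.
have mE M : measurable (E M).
  apply: bigcupT_measurable => i; apply: bigcup_measurable => j _.
  rewrite (_ : [set _ | _] = (fun w => (x i w, t i w)) @^-1` V M `&`
     ((fun w => (x j w, t j w)) @^-1` V M `&` (fun w => t i w - t j w)%R @^-1` [set 0%R])).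
    apply: measurableI; first exact: measurable_preimageT.
    apply: measurableI; first exact: measurable_preimageT.
    by apply: measurable_preimageT => //; exact: measurable_funB.
  apply/seteqP; split => w /=; first by move=> [? ? tij]; do 2 split => //; rewrite tij subrr.
  by move=> [? [? /eqP]]; rewrite subr_eq0 => /eqP.
have E0 M : P (E M) = 0.
  pose cell n k : set (R * R) := `[(- M%:R)%R, M%:R%R]%classic `*` `[(k%:R / n.+1%:R)%R, (k.+1%:R / n.+1%:R)%R[%classic.
  have cellE n k : leb2 (cell n k) = (2 * M%:R / n.+1%:R)%:E.
    transitivity (leb `[(- M%:R)%R, (M%:R : R)%R]%classic * leb `[(k%:R / n.+1%:R)%R, (k.+1%:R / n.+1%:R : R)%R[%classic).
      by apply: product_measure1E; exact: measurable_itv.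
    rewrite /leb !lebesgue_measure_itv/= !lte_fin ltr_pM2r ?invr_gt0// ltr_nat ltnSn -!EFinB.
    have -> : (k.+1%:R / n.+1%:R - k%:R / n.+1%:R = n.+1%:R^-1 :> R)%R by rewrite -mulrBl -natrB// subSnn mul1r.
    case: ltP => M0; rewrite -?EFinM ?mul0e; congr EFin; first by rewrite opprK -mulr2n mulr_natl.
    have -> : (M%:R = 0 :> R)%R by have := ler0n R M; lra.
    by rewrite mulr0 mul0r.
  have mcell n k : measurable (cell n k) by apply: measurableX; exact: measurable_itv.
  pose D n k := double_points (fun i w => (x i w, t i w)) (cell n k).
  have mD n k : measurable (D n k) by exact: measurable_double_points.
  have le n : P (E M) <= ((4 * M%:R ^+ 3) / n.+1%:R)%:E.
    apply: (@le_trans _ _ (P (\big[setU/set0]_(k < M * n.+1) D n k))).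
      apply: le_measure; rewrite ?inE//; first exact: bigsetU_measurable.
      move=> w [i _ [j /= ij [[/= Vi ti] [/= Vj tj] tij]]].
      have ti0 : (0 <= t i w * n.+1%:R)%R by move: ti; rewrite in_itv/= => /andP[? _]; exact: mulr_ge0.
      have /andP[k1 k2] := trunc_itv ti0; set k := Num.Def.trunc _ in k1 k2.
      have n0 : (0 < n.+1%:R :> R)%R by [].
      have kM : (k < M * n.+1)%N.
        rewrite -(ltr_nat R) (le_lt_trans k1)// natrM ltr_pM2r//.
        by move: ti; rewrite in_itv/= => /andP[].
      rewrite -bigcup_mkord; exists k => //; exists i => //; exists j => //.
      have ck : (k%:R / n.+1%:R <= t i w < k.+1%:R / n.+1%:R)%R.
        by rewrite ler_pdivrMr// ltr_pdivlMr// k1 k2.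
      by split; split => //=; rewrite in_itv/= -?tij.
    apply: (le_trans (le_mu_bigsetU _ (fun k _ => mD n k))).
    apply: (@le_trans _ _ (\sum_(k < M * n.+1) ((2 * M%:R / n.+1%:R) ^+ 2)%:E)).
      apply: lee_sum => k _; have := @double_points_le _ _ leb2 _ (cell n k) mxt pp (mcell n k).
      by rewrite [X in X < _]cellE [X in fine X]cellE => /(_ (ltry _)).
    rewrite sumEFin lee_fin sumr_const card_ord -[(_ *+ (M * _))%R]mulr_natl natrM.
    rewrite le_eqVlt; apply/orP; left; apply/eqP; field.
    by rewrite addrC natr1 pnatr_eq0.
  have Pfin : P (E M) \is a fin_num by rewrite fin_num_measure.
  apply/eqP; rewrite eq_le measure_ge0 andbT -[P (E M)]fineK// lee_fin leNgt; apply/negP => p0.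
  have c0 : (0 <= 4 * M%:R ^+ 3 / fine (P (E M)))%R by rewrite divr_ge0 ?mulr_ge0 ?exprn_ge0// ltW.
  have /andP[_ nn] := trunc_itv c0; set n := Num.Def.trunc _ in nn.
  have := le n; rewrite -[P (E M)]fineK// lee_fin ler_pdivlMr// => h.
  by move: nn; rewrite ltr_pdivrMr// [ltRHS]mulrC ltNge h.
have EN : P.-negligible (\bigcup_M E M).
  apply: (@negligible_bigcup _ _ _ P) => M; exists (E M); split; [exact: mE|exact: E0|exact: subset_refl].
apply: (@negligibleS _ _ _ P _ _ _ EN) => w [i [j [ij ti tij]]].
pose b : R := Num.max `|x i w|%R (Num.max `|x j w|%R (t i w)).
have b0 : (0 <= b)%R by rewrite /b le_max normr_ge0.
have /andP[_ bM] := trunc_itv b0; set M := (Num.Def.trunc b).+1 in bM.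
have /andP[b1 /andP[b2 b3]] : [&& `|x i w| <= b, `|x j w| <= b & t i w <= b]%R.
  by rewrite /b !le_max !lexx !orbT.
exists M => //; exists i => //; exists j => //; split => //; rewrite /V; split; rewrite /= in_itv/= -?tij ?ti ?(le_lt_trans b3)//.
- by rewrite -ler_norml (le_trans b1)// ltW.
- by rewrite -ler_norml (le_trans b2)// ltW.
Qed.

End no_ties.

(** * Moments of the dead leaves tessellation *)

Section leaf_law_facts.
Context (R : realType) (Q : probability (grain R) R).
Local Notation nu := (leaf_law Q).
Local Notation lam := (fine (leaf_mean Q)).

Lemma leaf_length_ge0 (K : grain R) : (0 <= leaf_length K)%R.
Proof. exact: fine_ge0. Qed.

Lemma ge0_integral_leaf_law (f : R -> \bar R) : measurable_fun setT f ->
  (forall h, 0 <= f h) -> \int[nu]_h f h = \int[Q]_K f (leaf_length K).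
Proof. by move=> mf f0; rewrite ge0_integral_pushforward// => y _; exact: f0. Qed.

Lemma length_leaf_length (K : grain R) : length (leaf_length K) = leaf_length K.
Proof. by rewrite /length max_l// leaf_length_ge0. Qed.

Lemma union_mean_cover z : (0 <= z)%R -> union_mean nu z = leaf_mean_cover Q z.
Proof.
move=> z0; rewrite /union_mean /leaf_mean_cover ge0_integral_leaf_law.
- rewrite unlock; congr fine; apply: eq_integral => K _.
  by rewrite /union_length length_leaf_length ger0_norm.
- by apply/measurable_EFinP; exact: measurable_union_length.
- by move=> h; rewrite lee_fin union_length_ge0.
Qed.

Hypothesis Hmean : leaf_mean Q < +oo.

Lemma integral_length_leaf_law : \int[nu]_h (length h)%:E = lam%:E.
Proof.
have E : \int[nu]_h (length h)%:E = leaf_mean Q.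
  rewrite ge0_integral_leaf_law.
  - rewrite /leaf_mean unlock; apply: eq_integral => K _.
    by rewrite length_leaf_length.
  - by apply/measurable_EFinP; exact: measurable_length.
  - by move=> h; rewrite lee_fin length_ge0.
rewrite E fineK// ge0_fin_numE// -E; apply: integral_ge0 => h _.
by rewrite lee_fin length_ge0.
Qed.

Hypothesis HF0 : leaf_cdf Q 0%R = 0%R.

Lemma leaf_law_npos : nu `]-oo, 0%R]%classic = 0.
Proof. by rewrite -[LHS]fineK ?fin_num_measure// [fine _]HF0. Qed.

Lemma leaf_mean_gt0 : (0 < lam)%R.
Proof.
have l0 : (0 <= lam)%R.
  rewrite -lee_fin -integral_length_leaf_law; apply: integral_ge0 => h _.
  by rewrite lee_fin length_ge0.
rewrite lt_neqAle l0 andbT; apply/eqP => lam0.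
have ml : measurable_fun [set: R] (fun h => (length h)%:E : \bar R).
  by apply/measurable_EFinP; exact: measurable_length.
have : ae_eq nu setT (fun h => (length h)%:E) (cst 0).
  apply/(ae_eq_integral_abs nu measurableT ml).
  transitivity (\int[nu]_h (length h)%:E); last by rewrite integral_length_leaf_law -lam0.
  by apply: eq_integral => h _; rewrite gee0_abs// lee_fin length_ge0.
move=> lae; have : nu.-negligible `]0%R, +oo[%classic.
  apply: negligibleS lae => h /=; rewrite in_itv/= andbT => h0 /(_ Logic.I) [].
  by rewrite /length max_l ?ltW//; move=> h00; move: h0; rewrite h00 ltxx.
move=> /(measure_negligible (measurable_itv _)) n1.
have := @probability_setT _ _ _ nu.
rewrite (_ : [set: R] = `]-oo, 0%R]%classic `|` `]0%R, +oo[%classic); last first.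
  by apply/seteqP; split => // h _; rewrite /= !in_itv/= andbT; case: (leP h 0%R); [left|right].
rewrite measureU0//.
by move=> n2; have := leaf_law_npos; rewrite [LHS]n2 => /eqP; rewrite eqe oner_eq0.
Qed.

Hypothesis Hconn : {ae Q, forall K : grain R, connected (compacts_set K)}.

Lemma grain_segment_negligible : Q.-negligible [set K | ~ is_segment K].
Proof.
have m0 : Q.-negligible [set K | (leaf_length K <= 0)%R].
  exists (@leaf_length R @^-1` `]-oo, 0%R]%classic); split.
  - by apply: measurable_preimageT; [exact: measurable_leaf_length|exact: measurable_itv].
  - exact: leaf_law_npos.
  - by move=> K /=; rewrite in_itv.
apply: negligibleS (negligibleU Hconn m0) => K /= nK.
have [cK|] := pselect (connected (compacts_set K)); last by left.
by right; rewrite leNgt; apply/negP => K0; apply: nK; exact: connected_is_segment.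
Qed.

End leaf_law_facts.

Lemma negligible_preimage d (Omega : measurableType d) d' (T : measurableType d') (R : realType)
    (P : {measure set Omega -> \bar R}) (Q : set T -> \bar R) (X : Omega -> T) (A : set T) :
  measurable_fun setT X -> (forall B, measurable B -> P (X @^-1` B) = Q B) ->
  Q.-negligible A -> P.-negligible (X @^-1` A).
Proof.
move=> mX lawX [N [mN N0 AN]]; exists (X @^-1` N); split.
- exact: measurable_preimageT.
- by rewrite lawX.
- by move=> w /AN.
Qed.

Section moments.
Context (R : realType) d (Omega : measurableType d) (P : probability Omega R).
Variables (Q : probability (grain R) R).
Variables (x t : nat -> {RV P >-> R}) (S : nat -> {RV P >-> grain R}).
Hypotheses (HDL : dead_leaves_model Q x t S)
  (Hconn : {ae Q, forall K : grain R, connected (compacts_set K)})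
  (HF0 : leaf_cdf Q 0%R = 0%R) (Hmean : leaf_mean Q < +oo).
Local Notation z := (leaf_point x t S).
Local Notation nu := (leaf_law Q).
Local Notation lam := (fine (leaf_mean Q)).
Local Notation um := (union_mean nu).
Local Notation leb := (@leb R).

Let lamE := integral_length_leaf_law Hmean.
Let lam0 := leaf_mean_gt0 Hmean HF0.
Let pz := leaf_point_has_pgfl HDL.
Let mz : forall i, measurable_fun setT (z i) := measurable_leaf_point x t S.

Definition swap_set (D : set (R * R)) : set (R * R) := [set p | D (p.2, p.1)].

Lemma measurable_swap_set D : measurable D -> measurable (swap_set D).
Proof.
move=> mD; apply: (@measurable_preimageT _ _ _ _ (fun p : R * R => (p.2, p.1)) D) => //.
exact: measurable_fun_pair.
Qed.

Definition one_leaf_event e e' D i : set Omega :=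
  [set w | one_leaf e e' D (z i w)] `&` (exposed z e i `&` exposed z e' i).

Definition two_leaves_event e e' D i j : set Omega :=
  [set w | two_leaves e e' D (z i w, z j w)] `&` (exposed z e i `&` exposed z e' j).

Lemma measurable_two_leaves_event e e' D i j : measurable D ->
  measurable (two_leaves_event e e' D i j).
Proof.
move=> mD; apply: measurableI; last by apply: measurableI; exact: measurable_exposed.
apply: (@measurable_preimageT _ _ _ _ (fun w => (z i w, z j w))); first exact: measurable_fun_pair.
exact: measurable_two_leaves.
Qed.

Lemma no_pointU (T : Type) (y : nat -> Omega -> T) (A B : set T) w :
  no_point y (A `|` B) w <-> no_point y A w /\ no_point y B w.
Proof.
split => [h|[hA hB] k [|]]; [|exact: hA|exact: hB].
by split => k ?; apply: (h k); [left|right].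
Qed.

Lemma sum_one_leaf_event e e' D : measurable D ->
  \sum_(i <oo) P (one_leaf_event e e' D i) =
  \int[leb]_u \int[nu]_h
    (\1_D (u, u + (e'%:R - e%:R) * h) * (um ((e'%:R - e%:R) * h))^-1)%:E.
Proof.
move=> mD; rewrite -(one_leaf_integral lamE lam0)//.
rewrite -(mecke_one_leaf lamE mz pz); last 2 first.
- exact: measurable_one_leaf.
- by move=> y [].
apply: eq_eseriesr => i _; congr (P _); apply/seteqP; split => w.
  by move=> [ol [[? ?] [? ?]]]; split => //; apply/no_pointU.
by move=> [/= ol /no_pointU[n1 n2]]; have [? _] := ol; split; [exact: ol|split; split].
Qed.

Lemma sum_two_leaves_event e e' D : measurable D ->
  \sum_(i <oo) \sum_(j <oo) P (two_leaves_event e e' D i j) =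
  \int[leb]_u \int[leb]_v ((\1_D (u, v) / (lam * um (v - u)))%:E * nu (missing e (v - u))).
Proof.
move=> mD; rewrite -(two_leaves_integral lamE lam0 e e')//.
rewrite -(mecke_two_leaves lamE mz pz); last 2 first.
- exact: measurable_two_leaves.
- by move=> y [].
apply: eq_eseriesr => i _; apply: eq_eseriesr => j _; congr (P _); apply/seteqP; split => w.
  by move=> [ol [[? ?] [? ?]]]; split => //; apply/no_pointU.
move=> [/= tl /no_pointU[n1 n2]]; have [/andP[/= t1 t2] _] := tl.
by split; [exact: tl|split; split => //; exact: le_trans (ltW t2)].
Qed.

(** Two different leaves have no exposed edge in common: their displacement
    would vanish, which is a null event for the continuous displacement. *)
Lemma common_edge_null e e' i j :
  P (two_leaves_event e e' [set p | p.1 = p.2] i j) = 0.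
Proof.
have mD : measurable [set p : R * R | p.1 = p.2].
  rewrite (_ : [set _ | _] = (fun p : R * R => p.1 - p.2)%R @^-1` [set 0%R]).
    by apply: measurable_preimageT => //; exact: measurable_funB.
  by apply/seteqP; split => p /=; [move=> ->; rewrite subrr|move/eqP; rewrite subr_eq0 => /eqP].
have : \sum_(i <oo) \sum_(j <oo) P (two_leaves_event e e' [set p | p.1 = p.2] i j) = 0.
  rewrite sum_two_leaves_event//; apply: integral0_eq => u _.
  pose h v := ((lam * um (v - u))^-1)%:E * nu (missing e (v - u)).
  transitivity (\int[leb]_(v in [set u]) h v); last first.
    by apply: null_set_integral => //; [exact: measurable_fun_set1|exact: leb_set1].
  rewrite [RHS]integral_mkcond; apply: eq_integral => v _; rewrite patchE indicE.
  rewrite (_ : ((u, v) \in _) = (v \in [set u])).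
    by case: ifP => _; rewrite ?mul1r ?mul0r ?mul0e.
  by apply/idP/idP => /set_mem /= e1; apply/mem_set.
move=> /nneseries_eq0 h1; apply: (nneseries_eq0 _ (h1 _ i)) => // n.
exact: nneseries_ge0.
Qed.

(** Three null events are excluded: a grain that is not a segment, two equal
    arrival times, and two leaves with a common visible edge. *)
Lemma generic_sample : exists N : set Omega, [/\ measurable N, P N = 0 &
  forall w, ~ N w -> [/\ forall i, is_segment (S i w), ~ ties x t w & distinct_edges x t S w]].
Proof.
pose A1 := \bigcup_i (S i @^-1` [set K | ~ is_segment K]).
pose E i j e e' := two_leaves_event e e' [set p | p.1 = p.2] i j.
pose A3 := \bigcup_i \bigcup_j ((E i j true true `|` E i j true false) `|`
                                (E i j false true `|` E i j false false)).
have [ppxt lawS _ _] := HDL.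
have n1 : P.-negligible A1.
  apply: negligible_bigcup => i.
  apply: (@negligible_preimage _ _ _ _ R P Q (S i)) => //; last exact: grain_segment_negligible.
  by move=> B mB; exact: lawS.
have n2 : P.-negligible (ties x t).
  apply: ties_negligible => //.
  split; last exact: ppxt.2.
  by move=> B k mB Boo; have := ppxt.1 B k mB; rewrite -leb_prodE//; apply.
have mdiag : measurable [set p : R * R | p.1 = p.2].
  rewrite (_ : [set _ | _] = (fun p : R * R => p.1 - p.2)%R @^-1` [set 0%R]).
    by apply: measurable_preimageT => //; exact: measurable_funB.
  by apply/seteqP; split => p /=; [move=> ->; rewrite subrr|move/eqP; rewrite subr_eq0 => /eqP].
have nE i j e e' : P.-negligible (E i j e e').
  by exists (E i j e e'); split => //; [exact: measurable_two_leaves_event|exact: common_edge_null].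
have n3 : P.-negligible A3.
  by apply: negligible_bigcup => i; apply: negligible_bigcup => j; apply: negligibleU; exact: negligibleU.
have [N [mN N0 AN]] := negligibleU n1 (negligibleU n2 n3).
exists N; split => // w Nw.
have seg i : is_segment (S i w).
  by apply: contrapT => ns; apply: Nw; apply: AN; left; exists i.
have nt : ~ ties x t w by move=> tw; apply: Nw; apply: AN; right; left.
split => // i j e e' ei ej ne eq_ij; apply: Nw; apply: AN; right; right.
have tE k : (z k w).1.2 = t k w by [].
have [ij|ij] := pselect (i = j).
  exfalso; subst j; have [l0 _] := seg i.
  have zl : (0 < (z i w).2)%R by [].
  move: eq_ij ne; rewrite /edge.
  by case: (e); case: (e') => //= /eqP; rewrite (inj_eq (addrI _)) ?(gt_eqF zl) ?(lt_eqF zl).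
have [t0 _] := ei; have [t0' _] := ej.
have tij : t i w <> t j w by move=> tij; apply: nt; exists i, j.
have [tlt|tlt|//] := ltgtP (t i w) (t j w).
  exists i => //; exists j => //.
  have Ew : E i j e e' w by split; [split => //=; rewrite tE in t0; rewrite t0|].
  by move: Ew; case: (e); case: (e') => Ew; [left; left|left; right|right; left|right; right].
exists j => //; exists i => //.
have Ew : E j i e' e w by split; [split => //=; rewrite tE in t0'; rewrite t0'|].
by move: Ew; case: (e); case: (e') => Ew; [left; left|right; left|left; right|right; right].
Qed.

Let eta := dead_leaves_points x t S.

Definition pair_event D (q : nat * (nat * (bool * bool))) : set Omega :=
  [set w | [/\ exposed z q.2.2.1 q.1 w, exposed z q.2.2.2 q.2.1 w,
          (q.1, q.2.2.1) <> (q.2.1, q.2.2.2) &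
          D (edge q.2.2.1 (z q.1 w), edge q.2.2.2 (z q.2.1 w))]].

Lemma measurable_pair_event D q : measurable D -> measurable (pair_event D q).
Proof.
move=> mD; case: q => i [j [e e']].
have [ne|ne] := pselect ((i, e) = (j, e')).
  by rewrite (_ : pair_event D _ = set0)//; apply/seteqP; split => // w [] /= _ _ /(_ ne).
rewrite (_ : pair_event D _ = (fun w => (edge e (z i w), edge e' (z j w))) @^-1` D `&`
   (exposed z e i `&` exposed z e' j)); last first.
  by apply/seteqP; split => [w []//|w [/= ? []]].
apply: measurableI; last by apply: measurableI; exact: measurable_exposed.
by apply: measurable_preimageT => //; apply: measurable_fun_pair; apply: (measurableT_comp (measurable_edge _)).
Qed.

(** Two edges of different leaves are ordered by the arrival times of their
    leaves, which almost surely differ. *)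
Lemma probability_pair_event D i j e e' : measurable D ->
  P (pair_event D (i, (j, (e, e')))) =
  P (two_leaves_event e e' D i j) + P (two_leaves_event e' e (swap_set D) j i) +
  (if (i == j) && (e != e') then P (one_leaf_event e e' D i) else 0).
Proof.
move=> mD; have mD' := measurable_swap_set mD.
have [N [mN N0 Ng]] := generic_sample.
have [ij|ij] := eqVneq i j.
  subst j; have tl0 e1 e2 D1 : two_leaves_event e1 e2 D1 i i = set0.
    by apply/seteqP; split => // w [[/= /andP[_]]]; rewrite ltxx.
  rewrite !tl0 !measure0 !add0e/=; have [<-|ne] := eqVneq e e' => /=.
    rewrite (_ : pair_event _ _ = set0) ?measure0//.
    by apply/seteqP; split => // w [] /= _ _ /(_ erefl).
  congr (P _); apply/seteqP; split => w.
    by move=> [/= ei ej _ Dij]; split => //; split => //=; have [] := ei.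
  by move=> [[/= ? ?] [? ?]]; split => //= -[ee]; move: ne; rewrite ee eqxx.
rewrite /= adde0; set A := two_leaves_event e e' D i j; set B := two_leaves_event _ _ _ _ _.
have mA : measurable A by exact: measurable_two_leaves_event.
have mB : measurable B by exact: measurable_two_leaves_event.
have mAB : measurable (A `|` B) by exact: measurableU.
have AB0 : A `&` B = set0.
  apply/seteqP; split => // w [[[/= /andP[_ h1] _] _] [[/= /andP[_ h2] _] _]].
  by have := lt_trans h1 h2; rewrite ltxx.
rewrite -measureU//; apply/eqP; rewrite eq_le; apply/andP; split.
  rewrite -[leRHS](measureU0 (mu := P) mAB mN N0).
  apply: le_measure; rewrite ?inE; [exact: measurable_pair_event|exact: measurableU|].
  move=> w [/= ei ej ne Dij]; have [Nw|/Ng[_ nt _]] := pselect (N w); [by right|left].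
  have [t0 _] := ei; have [t0' _] := ej.
  have tij : t i w <> t j w by move=> tij; apply: nt; exists i, j; split => //; exact/eqP.
  have [tlt|tlt|//] := ltgtP (t i w) (t j w).
    by left; split; [split => //=; apply/andP|].
  by right; split; [split => //=; apply/andP|].
apply: le_measure; rewrite ?inE//; first exact: measurable_pair_event.
by move=> w [] [[/= ? ?] [? ?]]; split => //= -[/eqP]; rewrite (negbTE ij).
Qed.

Lemma factorial_moment2_sum D : measurable D ->
  factorial_moment2 P eta D = \sum_(e : bool) \sum_(e' : bool)
    (\sum_(i <oo) \sum_(j <oo) P (two_leaves_event e e' D i j) +
     \sum_(i <oo) \sum_(j <oo) P (two_leaves_event e' e (swap_set D) i j) +
     (if e != e' then \sum_(i <oo) P (one_leaf_event e e' D i) else 0)).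
Proof.
move=> mD; have [N [mN N0 Ng]] := generic_sample.
rewrite /factorial_moment2 (@expected_count2 _ _ _ _ _ mN N0 _ _ (pair_event D)
  (fun w q => (edge q.2.2.1 (z q.1 w), edge q.2.2.2 (z q.2.1 w)))); last 2 first.
- by move=> q; exact: measurable_pair_event.
- by move=> w /Ng[seg nt dist]; exact: edge_pairs_bij.
pose g i j e e' := P (pair_event D (i, (j, (e, e')))).
transitivity (\sum_(e : bool) \sum_(e' : bool) \sum_(i <oo) \sum_(j <oo) g i j e e').
  transitivity (\sum_(i <oo) \sum_(e : bool) \sum_(e' : bool) \sum_(j <oo) g i j e e').
    apply: eq_eseriesr => i _; rewrite nneseries_sum => [|e j _]; last exact: sume_ge0.
    by apply: eq_bigr => e _; rewrite nneseries_sum.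
  rewrite nneseries_sum => [|e j _]; last by apply: sume_ge0 => e' _; exact: nneseries_ge0.
  apply: eq_bigr => e _; rewrite nneseries_sum// => e' j _; exact: nneseries_ge0.
apply: eq_bigr => e _; apply: eq_bigr => e' _.
pose c i j : \bar R := if (i == j) && (e != e') then P (one_leaf_event e e' D i) else 0.
have c0 i j : 0 <= c i j by rewrite /c; case: ifP.
transitivity (\sum_(i <oo) (\sum_(j <oo) P (two_leaves_event e e' D i j) +
    \sum_(j <oo) P (two_leaves_event e' e (swap_set D) j i) + \sum_(j <oo) c i j)).
  apply: eq_eseriesr => i _.
  rewrite -nneseriesD// -nneseriesD//; last by move=> j _ _; exact: adde_ge0.
  by apply: eq_eseriesr => j _; exact: probability_pair_event.
rewrite nneseriesD//; last 2 first.
- by move=> i _ _; apply: adde_ge0; exact: nneseries_ge0.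
- by move=> i _ _; exact: nneseries_ge0.
congr (_ + _).
  rewrite nneseriesD; last 2 first.
  - by move=> i _ _; exact: nneseries_ge0.
  - by move=> i _ _; exact: nneseries_ge0.
  have sw := @nneseries_interchange R (fun i j => P (two_leaves_event e' e (swap_set D) j i))
    xpredT xpredT (fun i j => measure_ge0 P _).
  exact: (congr1 (fun s : \bar R => \sum_(i <oo) \sum_(j <oo) P (two_leaves_event e e' D i j) + s) sw).
transitivity (\sum_(i <oo) (if e != e' then P (one_leaf_event e e' D i) else 0)); last first.
  by case: ifP => // _; rewrite eseries0.
apply: eq_eseriesr => i _; rewrite nneseries_esumT//.
rewrite (esumID [set i])// setTI esum_set1// setTI esum1 ?adde0 /c ?eqxx//.
by move=> j /= ji; rewrite /c; case: eqVneq => // ij; exfalso; apply: ji.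
Qed.

Lemma intensity_sum A : measurable A ->
  \int[P]_w eta w A = \sum_(e : bool) \sum_(i <oo) P (one_leaf_event e e (A `*` A) i).
Proof.
move=> mA; have [N [mN N0 Ng]] := generic_sample.
pose U (q : nat * bool) : set Omega := [set w | exposed z q.2 q.1 w /\ A (edge q.2 (z q.1 w))].
rewrite /eta /dead_leaves_points /counting_process.
rewrite (@expected_count _ _ _ _ _ mN N0 _ _ U (fun w q => edge q.2 (z q.1 w))); last 2 first.
- move=> [i e]; apply: measurableI; first exact: measurable_exposed.
  by apply: measurable_preimageT => //; exact: (measurableT_comp (measurable_edge e)).
- by move=> w /Ng[seg nt dist]; exact: edge_points_bij.
rewrite nneseries_sum//; apply: eq_bigr => e _; apply: eq_eseriesr => i _.
congr (P _); apply/seteqP; split => w; rewrite /U /=.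
  by move=> [ei Ai]; split => //; split => //; have [] := ei.
by move=> [[_ [Ai _]] [ei _]].
Qed.

Local Notation F := (leaf_cdf Q).

Lemma leaf_cdfE a : nu `]-oo, a]%classic = (F a)%:E.
Proof. by rewrite /leaf_cdf fineK// fin_num_measure. Qed.

Let um0 a : (0 < um a)%R. Proof. exact: (union_mean_gt0 lamE lam0). Qed.

Lemma measurable_inv_um : measurable_fun setT (fun a => (um a)^-1)%R.
Proof.
rewrite (_ : (fun a => _) = (fun a => expR (- ln (um a)))%R).
  apply: measurableT_comp => //; apply: measurable_funN.
  exact: (measurableT_comp (@measurable_ln R) (measurable_union_mean nu)).
by apply/funext => a; rewrite expRN lnK// posrE.
Qed.

Lemma leaf_cdf_ge0 a : (0 <= F a)%R.
Proof. by rewrite fine_ge0. Qed.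

Lemma measurable_leaf_cdf : measurable_fun setT F.
Proof.
apply: measurableT_comp => //.
have mB : measurable [set p : R * R | (p.2 <= p.1)%R].
  rewrite (_ : [set _ | _] = (fun p : R * R => p.1 - p.2)%R @^-1` `[0%R, +oo[%classic).
    by apply: measurable_preimageT; [exact: measurable_funB|exact: measurable_itv].
  by apply/seteqP; split => p; rewrite /= in_itv/= andbT subr_ge0.
have := measurable_fun_xsection nu mB; congr (measurable_fun _ _).
apply/funext => a; congr (nu _); apply/seteqP; split => h; rewrite /xsection /= ?inE/= ?in_itv//=.
Qed.

(** The probability that a leaf with its edge [e] at 0 does not cover [a]: a
    leaf lies to the right of its left edge and to the left of its right edge,
    so it can only cover the points of one sign. *)
Definition miss_prob (e : bool) (a : R) : R :=
  if e then (if (a < 0)%R then F (- a)%R else 1%R) else (if (0 < a)%R then F a else 1%R).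

Lemma miss_probE e a : nu (missing e a) = (miss_prob e a)%:E.
Proof.
rewrite /miss_prob; case: e.
  case: ltP => a0.
    rewrite -leaf_cdfE; congr (nu _); apply/seteqP; split => h; rewrite /missing /= in_itv/= subrr; lra.
  rewrite -(probability_setT nu); congr (nu _); apply/seteqP; split => h //= _; rewrite /missing /=; lra.
case: ltP => a0.
  rewrite -leaf_cdfE; congr (nu _); apply/seteqP; split => h; rewrite /missing /= in_itv/=; lra.
rewrite -(probability_setT nu); congr (nu _); apply/seteqP; split => h //= _; rewrite /missing /=; lra.
Qed.

Lemma miss_prob_ge0 e a : (0 <= miss_prob e a)%R.
Proof. by rewrite /miss_prob; case: e; case: ifP => // _; exact: leaf_cdf_ge0. Qed.

Lemma miss_probN e a : miss_prob e (- a) = miss_prob (~~ e) a.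
Proof. by rewrite /miss_prob; case: e => /=; rewrite ?oppr_lt0 ?oppr_gt0 ?opprK. Qed.

Lemma miss_prob_sum a : a != 0%R -> (miss_prob true a + miss_prob false a = 1 + F `|a|)%R.
Proof.
move=> a0; rewrite /miss_prob; case: ltgtP a0 => // [a0|a0] _.
  by rewrite ltr0_norm// addrC.
by rewrite gtr0_norm.
Qed.

Lemma measurable_miss_prob e : measurable_fun setT (miss_prob e).
Proof.
case: e; apply: measurable_fun_ifT => //.
- by apply: measurable_fun_ltr.
- by apply: (measurableT_comp measurable_leaf_cdf).
- by apply: measurable_fun_ltr.
- exact: measurable_leaf_cdf.
Qed.

Definition displacement_integral (D : set (R * R)) (k : R -> R) : \bar R :=
  \int[leb]_u \int[leb]_v (\1_D (u, v) * k (v - u))%:E.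

Lemma measurable_displacement (D : set (R * R)) (k : R -> R) : measurable D -> measurable_fun setT k ->
  measurable_fun setT (fun p : R * R => (\1_D p * k (p.2 - p.1)%R)%:E).
Proof.
move=> mD mk; apply/measurable_EFinP; apply: measurable_funM; first exact: measurable_indic.
by apply: (measurableT_comp mk); exact: measurable_funB.
Qed.

Lemma displacement_integralD (D : set (R * R)) (k1 k2 : R -> R) : measurable D ->
  measurable_fun setT k1 -> measurable_fun setT k2 ->
  (forall a, 0 <= k1 a)%R -> (forall a, 0 <= k2 a)%R ->
  displacement_integral D k1 + displacement_integral D k2 =
  displacement_integral D (fun a => k1 a + k2 a)%R.
Proof.
move=> mD mk1 mk2 k10 k20; rewrite /displacement_integral.
have m1 := measurable_displacement mD mk1; have m2 := measurable_displacement mD mk2.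
have p1 (p : R * R) : 0 <= (\1_D p * k1 (p.2 - p.1)%R)%:E :> \bar R by rewrite lee_fin mulr_ge0.
have p2 (p : R * R) : 0 <= (\1_D p * k2 (p.2 - p.1)%R)%:E :> \bar R by rewrite lee_fin mulr_ge0.
rewrite -ge0_integralD//; last 4 first.
- by move=> u _; apply: integral_ge0 => v _; exact: (p1 (u, v)).
- exact: (@measurable_fun_fubini_tonelli_F _ _ _ _ _ leb _ m1 p1).
- by move=> u _; apply: integral_ge0 => v _; exact: (p2 (u, v)).
- exact: (@measurable_fun_fubini_tonelli_F _ _ _ _ _ leb _ m2 p2).
apply: eq_integral => u _; rewrite -ge0_integralD//; last 2 first.
- exact: (measurableT_comp m1 (measurable_pair1 u)).
- exact: (measurableT_comp m2 (measurable_pair1 u)).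
by apply: eq_integral => v _; rewrite -EFinD mulrDr.
Qed.

Lemma displacement_integral_swap (D : set (R * R)) (k : R -> R) : measurable D -> measurable_fun setT k ->
  (forall a, 0 <= k a)%R ->
  displacement_integral (swap_set D) k = displacement_integral D (fun a => k (- a)%R).
Proof.
move=> mD mk k0; rewrite /displacement_integral.
have mD' := measurable_swap_set mD.
transitivity (\int[leb]_v \int[leb]_u (\1_(swap_set D) (u, v) * k (v - u))%:E).
  apply: (@fubini_tonelli _ _ _ _ _ leb leb (fun p => (\1_(swap_set D) p * k (p.2 - p.1)%R)%:E)).
    exact: measurable_displacement.
  by move=> p; rewrite lee_fin mulr_ge0.
apply: eq_integral => u _; apply: eq_integral => v _; by rewrite opprB.
Qed.

Lemma displacement_integral_ae (D : set (R * R)) (k1 k2 : R -> R) : measurable D ->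
  measurable_fun setT k1 -> measurable_fun setT k2 ->
  (forall a, 0 <= k1 a)%R -> (forall a, 0 <= k2 a)%R ->
  (exists c, forall a, a != c -> k1 a = k2 a) ->
  displacement_integral D k1 = displacement_integral D k2.
Proof.
move=> mD mk1 mk2 k10 k20 [c kk]; apply: eq_integral => u _.
have m1 := measurable_displacement mD mk1; have m2 := measurable_displacement mD mk2.
apply: ge0_ae_eq_integral => //.
- exact: (measurableT_comp m1 (measurable_pair1 u)).
- exact: (measurableT_comp m2 (measurable_pair1 u)).
- by move=> v _; rewrite lee_fin mulr_ge0.
- by move=> v _; rewrite lee_fin mulr_ge0.
exists [set (u + c)%R]; split => //; first exact: leb_set1.
move=> v; apply: contra_notP => vc _; rewrite kk// subr_eq addrC.
by apply/eqP.
Qed.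

Lemma two_leaves_displacement e e' D : measurable D ->
  \sum_(i <oo) \sum_(j <oo) P (two_leaves_event e e' D i j) =
  displacement_integral D (fun a => miss_prob e a / (lam * um a))%R.
Proof.
move=> mD; rewrite sum_two_leaves_event//; apply: eq_integral => u _; apply: eq_integral => v _.
by rewrite miss_probE -EFinM; congr EFin; rewrite -!mulrA; congr (_ * _)%R; rewrite mulrC.
Qed.

(** The displacement of two edges of the same leaf is its length, up to sign. *)
Definition same_leaf_integral (D : set (R * R)) : \bar R :=
  \int[leb]_u \int[nu]_h (\1_D (u, u + h) * (um h)^-1)%:E.

Lemma measurable_same_leaf D : measurable D ->
  measurable_fun setT (fun p : R * R => (\1_D (p.1, p.1 + p.2)%R * (um p.2)^-1)%:E).
Proof.
move=> mD; apply/measurable_EFinP; apply: measurable_funM.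
  apply: (measurableT_comp (measurable_indic mD)); apply: measurable_fun_pair => //.
  exact: measurable_funD.
exact: (measurableT_comp measurable_inv_um).
Qed.

Lemma same_leaf_integral_swap D : measurable D ->
  same_leaf_integral (swap_set D) = \int[leb]_u \int[nu]_h (\1_D (u, u - h) * (um h)^-1)%:E.
Proof.
move=> mD; have mD' := measurable_swap_set mD; rewrite /same_leaf_integral.
have um0' a : (0 <= (um a)^-1)%R by rewrite invr_ge0 ltW.
transitivity (\int[nu]_h \int[leb]_u (\1_(swap_set D) (u, u + h) * (um h)^-1)%:E).
  apply: (@fubini_tonelli _ _ _ _ _ leb nu (fun p => (\1_(swap_set D) (p.1, p.1 + p.2)%R * (um p.2)^-1)%:E)).
    exact: measurable_same_leaf.
  by move=> p; rewrite lee_fin mulr_ge0.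
have mS : measurable_fun setT (fun p : R * R => (\1_D (p.1, p.1 - p.2)%R * (um p.2)^-1)%:E).
  apply/measurable_EFinP; apply: measurable_funM.
    apply: (measurableT_comp (measurable_indic mD)); apply: measurable_fun_pair => //.
    exact: measurable_funB.
  exact: (measurableT_comp measurable_inv_um).
transitivity (\int[nu]_h \int[leb]_u (\1_D (u, u - h) * (um h)^-1)%:E); last first.
  apply/esym; apply: (@fubini_tonelli _ _ _ _ _ leb nu (fun p => (\1_D (p.1, p.1 - p.2)%R * (um p.2)^-1)%:E)) => //.
  by move=> p; rewrite lee_fin mulr_ge0.
apply: eq_integral => h _.
rewrite -(@ge0_integral_leb_shift R (fun u => (\1_D (u, u - h) * (um h)^-1)%:E) h).
- apply: eq_integral => u _; by rewrite addrK.
- exact: (measurableT_comp mS (measurable_pair2 h)).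
- by move=> u; rewrite lee_fin mulr_ge0.
Qed.

Lemma measurable_inv_lam_um : measurable_fun setT (fun a => (lam * um a)^-1)%R.
Proof.
rewrite (_ : (fun a => _) = (fun a => lam^-1 * (um a)^-1)%R).
  by apply: measurable_funM => //; exact: measurable_inv_um.
by apply/funext => a; rewrite invfM.
Qed.

Definition pair_kernel (a : R) : R := (4 * (1 + F `|a|) / (lam * um a))%R.

Lemma pair_kernel_ge0 a : (0 <= pair_kernel a)%R.
Proof.
by rewrite mulr_ge0 ?invr_ge0 ?mulr_ge0 ?addr_ge0 ?leaf_cdf_ge0// ltW.
Qed.

Lemma measurable_pair_kernel : measurable_fun setT pair_kernel.
Proof.
apply: measurable_funM; last exact: measurable_inv_lam_um.
apply: measurable_funM => //; apply: measurable_funD => //.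
exact: (measurableT_comp measurable_leaf_cdf).
Qed.

Lemma edge_pair_sum (f : bool -> \bar R) (s s' : \bar R) :
  \sum_(e : bool) \sum_(e' : bool)
    (f e + f (~~ e') + (if e != e' then (if e then s' else s) else 0)) =
  ((f true + f false) + (f true + f true) + ((f false + f false) + (f false + f true))) + (s + s').
Proof.
rewrite !big_bool /=; move: (f true) (f false) => a b.
move: (a + b) (a + a) (b + b) (b + a) => x1 x2 x3 x4.
transitivity ((x1 + (x2 + s')) + ((x3 + s) + x4)); first by rewrite !adde0.
by rewrite [x1 + (x2 + s')]addeA [x3 + s + x4]addeAC addeACA [s' + s]addeC.
Qed.

(** Among the eight terms of the sum over pairs of edges of two leaves, four
    are integrals with the kernel of a left edge and four with that of a right
    edge of the earlier leaf, since exchanging the two points replaces a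
    displacement by its opposite. The probabilities of the two kernels add up
    to 1 + F. *)
Lemma factorial_moment2E D : measurable D ->
  factorial_moment2 P eta D = displacement_integral D pair_kernel +
    (same_leaf_integral D + same_leaf_integral (swap_set D)).
Proof.
move=> mD; have mD' := measurable_swap_set mD; rewrite factorial_moment2_sum//.
pose k e a : R := (miss_prob e a / (lam * um a))%R.
have k0 e a : (0 <= k e a)%R.
  by rewrite mulr_ge0 ?miss_prob_ge0// invr_ge0 mulr_ge0// ltW.
have mk e : measurable_fun setT (k e).
  apply: measurable_funM; first exact: measurable_miss_prob.
  exact: measurable_inv_lam_um.
have swapE e : displacement_integral (swap_set D) (k e) = displacement_integral D (k (~~ e)).
  rewrite (displacement_integral_swap mD (mk e) (k0 e)).
  apply: (congr1 (displacement_integral D)); apply/funext => a.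
  by rewrite /k miss_probN union_meanN.
have ft : \sum_(i <oo) P (one_leaf_event false true D i) = same_leaf_integral D.
  rewrite (sum_one_leaf_event false true mD).
  by apply: eq_integral => u _; apply: eq_integral => h _; rewrite subr0 mul1r.
have tf : \sum_(i <oo) P (one_leaf_event true false D i) = same_leaf_integral (swap_set D).
  rewrite (sum_one_leaf_event true false mD).
  transitivity (\int[leb]_u \int[nu]_h (\1_D (u, u - h) * (um h)^-1)%:E).
    by apply: eq_integral => u _; apply: eq_integral => h _; rewrite sub0r mulN1r union_meanN.
  exact/esym/same_leaf_integral_swap.
transitivity (\sum_(e : bool) \sum_(e' : bool)
    (displacement_integral D (k e) + displacement_integral D (k (~~ e')) +
     (if e != e' then (if e then same_leaf_integral (swap_set D) else same_leaf_integral D) else 0))).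
  apply: eq_bigr => e _; apply: eq_bigr => e' _.
  apply: (f_equal3 (fun a b c : \bar R => a + b + c)).
  - exact: (two_leaves_displacement e e' mD).
  - exact: (etrans (two_leaves_displacement e' e mD') (swapE e')).
  - by case: e; case: e' => //=.
apply: (etrans (edge_pair_sum (fun b => displacement_integral D (k b)) _ _)).
have -> : displacement_integral D pair_kernel =
    displacement_integral D (k true) + displacement_integral D (k false) +
    (displacement_integral D (k true) + displacement_integral D (k true)) +
    ((displacement_integral D (k false) + displacement_integral D (k false)) +
    (displacement_integral D (k false) + displacement_integral D (k true))).
  pose s e1 e2 a := (k e1 a + k e2 a)%R.
  have ms e1 e2 : measurable_fun setT (s e1 e2) by apply: measurable_funD; exact: mk.
  have s0 e1 e2 a : (0 <= s e1 e2 a)%R by apply: addr_ge0; exact: k0.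
  have sE e1 e2 : displacement_integral D (k e1) + displacement_integral D (k e2) =
      displacement_integral D (s e1 e2) := displacement_integralD mD (mk e1) (mk e2) (k0 e1) (k0 e2).
  pose u e1 e2 e3 e4 a := (s e1 e2 a + s e3 e4 a)%R.
  have mu' e1 e2 e3 e4 : measurable_fun setT (u e1 e2 e3 e4) by apply: measurable_funD; exact: ms.
  have u0 e1 e2 e3 e4 a : (0 <= u e1 e2 e3 e4 a)%R by apply: addr_ge0; exact: s0.
  have uE e1 e2 e3 e4 : displacement_integral D (s e1 e2) + displacement_integral D (s e3 e4) =
      displacement_integral D (u e1 e2 e3 e4) :=
    displacement_integralD mD (ms e1 e2) (ms e3 e4) (s0 e1 e2) (s0 e3 e4).
  have tE := displacement_integralD mD (mu' true false true true) (mu' false false false true)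
    (u0 true false true true) (u0 false false false true).
  pose add (a b : \bar R) := a + b.
  apply/esym; apply: (etrans (congr2 add
    (etrans (congr2 add (sE true false) (sE true true)) (uE true false true true))
    (etrans (congr2 add (sE false false) (sE false true)) (uE false false false true)))).
  apply: (etrans tE); apply/esym.
  apply: (displacement_integral_ae mD measurable_pair_kernel).
  - by apply: measurable_funD; exact: mu'.
  - exact: pair_kernel_ge0.
  - by move=> a; apply: addr_ge0; exact: u0.
  exists 0%R => a a0; rewrite /u /s /k /pair_kernel -miss_prob_sum//.
  by move: (miss_prob true a) (miss_prob false a) ((lam * um a)^-1)%R => m1 m2 w; ring.
by [].
Qed.

Lemma dead_leaves_intensity : intensity P eta (2 / lam)%R.
Proof.
move=> A mA; rewrite intensity_sum//.
have mAA : measurable (A `*` A) by exact: measurableX.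
have one e : \sum_(i <oo) P (one_leaf_event e e (A `*` A) i) = (lam^-1)%:E * leb A.
  rewrite (sum_one_leaf_event e e mAA).
  transitivity (\int[leb]_u ((lam^-1)%:E * (\1_A u)%:E)).
    apply: eq_integral => u _.
    transitivity (\int[nu]_h cst ((lam^-1)%:E * (\1_A u)%:E) h).
      apply: eq_integral => h _; rewrite subrr mul0r addr0 (union_mean0 lamE) /cst -EFinM mulrC.
      congr (_ * _)%:E; rewrite !indicE; congr ((nat_of_bool _)%:R).
      by apply/idP/idP => /set_mem h1; apply/mem_set => //; case: h1.
    by rewrite integral_cst// [X in _ * X](probability_setT nu) mule1.
  rewrite ge0_integralZl//.
  - by rewrite integral_indic// setIT.
  - by apply/measurable_EFinP; exact: measurable_indic.
  - by rewrite lee_fin invr_ge0 ltW.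
transitivity (\sum_(e : bool) (lam^-1)%:E * leb A); first by apply: eq_bigr => e _; exact: one.
rewrite big_bool /= -/(leb A); have [m0 m0'] : 0 <= (lam^-1)%:E /\ 0 <= leb A.
  by split => //; rewrite lee_fin invr_ge0 ltW.
have -> : (2 / lam)%:E = (lam^-1)%:E + (lam^-1)%:E by rewrite -EFinD mulr_natl mulr2n.
by rewrite ge0_muleDl.
Qed.

Lemma displacement_integralE (D : set (R * R)) (k k' : R -> R) :
  measurable D -> measurable_fun setT k -> (forall a, 0 <= k a)%R ->
  (forall u v, D (u, v) -> k (v - u) = k' (v - u))%R ->
  displacement_integral D k =
  \int[@lebesgue_measure R]_u \int[@lebesgue_measure R]_(v in xsection D u) (k' (v - u))%:E.
Proof.
move=> mD mk k0 kk'; have mDk := measurable_displacement mD mk.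
have Dk0 (p : R * R) : 0 <= (\1_D p * k (p.2 - p.1)%R)%:E :> \bar R by rewrite lee_fin mulr_ge0.
rewrite /displacement_integral integral_leb; last 2 first.
- exact: (@measurable_fun_fubini_tonelli_F _ _ _ _ _ leb _ mDk Dk0).
- by move=> u; apply: integral_ge0 => v _; exact: (Dk0 (u, v)).
apply: eq_integral => u _; rewrite integral_leb; last 2 first.
- exact: (measurableT_comp mDk (measurable_pair1 u)).
- by move=> v; exact: (Dk0 (u, v)).
rewrite [RHS]integral_mkcond; apply: eq_integral => v _; rewrite patchE indicE.
rewrite (_ : (v \in xsection D u) = ((u, v) \in D)).
  case: ifPn => [/set_mem/kk' ->|_]; first by rewrite mul1r.
  by rewrite mul0r.
exact: mem_xsection.
Qed.

Let um_inv0 a : (0 <= (um a)^-1)%R. Proof. by rewrite invr_ge0 ltW. Qed.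

Lemma same_leaf_integralE (D : set (R * R)) (k' : R -> R) : measurable D ->
  (forall u v, D (u, v) -> (um (v - u))^-1 = k' (v - u))%R ->
  same_leaf_integral D =
  \int[@lebesgue_measure R]_u \int[shifted_leaf_law Q u]_(v in xsection D u) (k' (v - u))%:E.
Proof.
move=> mD kk'; have mS := measurable_same_leaf mD.
have S0 (p : R * R) : 0 <= (\1_D (p.1, p.1 + p.2)%R * (um p.2)^-1)%:E :> \bar R by rewrite lee_fin mulr_ge0.
rewrite /same_leaf_integral integral_leb; last 2 first.
- exact: (@measurable_fun_fubini_tonelli_F _ _ _ _ _ nu _ mS S0).
- by move=> u; apply: integral_ge0 => v _; exact: (S0 (u, v)).
apply: eq_integral => u _.
pose su : {measure set R -> \bar R} :=
  measure_function_pushforward__canonical__measure_function_Measure nu (measurable_shift u).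
transitivity (\int[su]_(v in xsection D u) (k' (v - u))%:E); last by [].
rewrite [RHS]integral_mkcond.
transitivity (\int[su]_v (\1_D (u, v) * (um (v - u))^-1)%:E); last first.
  apply: eq_integral => v _; rewrite patchE indicE.
  rewrite (_ : (v \in xsection D u) = ((u, v) \in D)).
    case: ifPn => [/set_mem/kk' ->|_]; first by rewrite mul1r.
    by rewrite mul0r.
  exact: mem_xsection.
pose g v : \bar R := (\1_D (u, v) * (um (v - u))^-1)%:E.
have mg : measurable_fun setT g.
  apply/measurable_EFinP; apply: measurable_funM.
    exact: (measurableT_comp (measurable_indic mD) (measurable_pair1 u)).
  by apply: (measurableT_comp measurable_inv_um); exact: measurable_funB.
have g0 : {in setT, forall v, 0 <= g v} by move=> v _; rewrite lee_fin mulr_ge0.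
apply/esym; apply: (etrans (@ge0_integral_pushforward _ _ R R R (fun h => h + u)%R
  (measurable_shift u) nu setT g measurableT mg g0)); rewrite preimage_setT.
by apply: eq_integral => h _; rewrite /g /= addrK addrC.
Qed.

(** Lengths being positive, a leaf whose right edge precedes its left edge has
    probability zero. *)
Lemma same_leaf_integral_swap0 (D : set (R * R)) : measurable D ->
  D `<=` [set p | (p.1 < p.2)%R] -> same_leaf_integral (swap_set D) = 0.
Proof.
move=> mD Dlt; have mD' := measurable_swap_set mD; apply: integral0_eq => u _.
have mS := measurableT_comp (measurable_same_leaf mD') (measurable_pair1 u).
transitivity (\int[nu]_(h in `]-oo, 0%R]) (\1_(swap_set D) (u, u + h) * (um h)^-1)%:E); last first.
  apply: null_set_integral => //; [exact: measurable_funTS|exact: leaf_law_npos].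
rewrite [RHS]integral_mkcond; apply: eq_integral => h _; rewrite patchE mem_setE in_itv/=.
case: leP => h0 //; rewrite indicE memNset ?mul0r//.
by move=> /Dlt /=; rewrite gtrDl ltNge ltW.
Qed.

Lemma same_leaf_density (D : set (R * R)) (f : R -> R) : measurable D ->
  measurable_fun setT f -> (forall a, 0 <= f a)%R ->
  (forall A : set R, measurable A -> nu A = \int[leb]_(a in A) (f a)%:E) ->
  same_leaf_integral D = displacement_integral D (fun a => f a / um a)%R.
Proof.
move=> mD mf f0 nuE; apply: eq_integral => u _.
have mS := measurableT_comp (measurable_same_leaf mD) (measurable_pair1 u).
pose g h : \bar R := (\1_D (u, u + h)%R * (um h)^-1)%:E.
have mg : measurable_fun setT g by [].
have g0 h : 0 <= g h by rewrite lee_fin mulr_ge0.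
have mfE : measurable_fun setT (fun a => (f a)%:E) by exact/measurable_EFinP.
have fE0 a : 0 <= (f a)%:E by rewrite lee_fin.
have nuE' (B : set R) : measurable B -> nu B = \int[leb]_(a in id @^-1` B) (f a)%:E by exact: nuE.
have -> : \int[nu]_h g h = \int[leb]_a (g a * (f a)%:E).
  exact: (@ge0_integral_density_map _ _ _ _ _ leb nu id (fun a => (f a)%:E)
    (@measurable_id _ _ setT) mfE fE0 nuE' g mg g0).
rewrite -(@ge0_integral_leb_shift R (fun a => g a * (f a)%:E) (- u)%R).
- apply: eq_integral => v _; rewrite /g -EFinM addrC subrK; congr EFin.
  by rewrite -mulrA [(_^-1 * _)%R]mulrC.
- exact: emeasurable_funM.
- by move=> a; rewrite mule_ge0.
Qed.

(** The two terms in [f] come from the pairs (left edge, right edge) and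
    (right edge, left edge) of one leaf. *)
Lemma factorial_moment2_density (D : set (R * R)) (f : R -> R) : measurable D ->
  measurable_fun setT f -> (forall a, 0 <= f a)%R ->
  (forall A : set R, measurable A -> nu A = \int[leb]_(a in A) (f a)%:E) ->
  factorial_moment2 P eta D =
  displacement_integral D (fun a => pair_kernel a + (f a / um a + f (- a) / um a))%R.
Proof.
move=> mD mf f0 nuE.
have mk : measurable_fun setT (fun a => f a / um a)%R.
  by apply: measurable_funM => //; exact: measurable_inv_um.
have mk' : measurable_fun setT (fun a : R => f (- a) / um a)%R.
  apply: measurable_funM; last exact: measurable_inv_um.
  by apply: (measurableT_comp mf); exact: measurable_funN.
have k0 a : (0 <= f a / um a)%R by rewrite mulr_ge0.
have k0' a : (0 <= f (- a) / um a)%R by rewrite mulr_ge0.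
have swapE : same_leaf_integral (swap_set D) = displacement_integral D (fun a => f (- a) / um a)%R.
  rewrite (same_leaf_density (measurable_swap_set mD) mf f0 nuE).
  rewrite (displacement_integral_swap mD mk k0).
  by apply: (congr1 (displacement_integral D)); apply/funext => a; rewrite union_meanN.
rewrite (factorial_moment2E mD) swapE (same_leaf_density mD mf f0 nuE).
apply: (etrans (congr1 (fun s => displacement_integral D pair_kernel + s)
  (displacement_integralD mD mk mk' k0 k0'))).
apply: (displacement_integralD mD measurable_pair_kernel).
- exact: measurable_funD.
- exact: pair_kernel_ge0.
- by move=> a; exact: addr_ge0.
Qed.

End moments.

(** * The second factorial moment measure and the pair correlation function *)

Section main_parts.
Context (R : realType) d (Omega : measurableType d) (P : probability Omega R).
Variables (Q : probability (grain R) R).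
Variables (x t : nat -> {RV P >-> R}) (S : nat -> {RV P >-> grain R}).
Hypotheses (HDL : dead_leaves_model Q x t S)
  (Hconn : {ae Q, forall K : grain R, connected (compacts_set K)})
  (HF0 : leaf_cdf Q 0%R = 0%R) (Hmean : leaf_mean Q < +oo).
Local Notation mu := (@lebesgue_measure R).
Local Notation nu := (leaf_law Q).
Local Notation F := (leaf_cdf Q).
Local Notation lam := (fine (leaf_mean Q)).
Local Notation lam_ := (leaf_mean_cover Q).
Local Notation eta := (dead_leaves_points x t S).
Local Notation um := (union_mean nu).

Let lam0 := leaf_mean_gt0 Hmean HF0.
Let lamE := integral_length_leaf_law Hmean.
Let um0 a : (0 < um a)%R. Proof. exact: (union_mean_gt0 lamE lam0). Qed.

Lemma factorial_moment2_lt (D : set (R * R)) : measurable D ->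
  D `<=` [set p | (p.1 < p.2)%R] ->
  factorial_moment2 P eta D = displacement_integral D (pair_kernel Q) + same_leaf_integral Q D.
Proof.
move=> mD Dlt; rewrite (factorial_moment2E HDL Hconn HF0 Hmean mD).
by rewrite (same_leaf_integral_swap0 HF0 Hmean mD Dlt) adde0.
Qed.

Lemma factorial_moment2_formula (D : set (R * R)) : measurable D ->
  D `<=` [set p | (p.1 < p.2)%R] ->
  factorial_moment2 P eta D =
    \int[mu]_u \int[mu]_(v in xsection D u)
      (4 * (1 + F (v - u)) / (lam * lam_ (v - u)))%:E
    + \int[mu]_u \int[shifted_leaf_law Q u]_(v in xsection D u)
      ((lam_ (v - u))^-1)%:E.
Proof.
move=> mD Dlt; rewrite factorial_moment2_lt//; congr (_ + _).
  apply: (displacement_integralE (k' := fun a => (4 * (1 + F a) / (lam * lam_ a))%R) mD).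
  - exact: measurable_pair_kernel.
  - exact: pair_kernel_ge0.
  move=> u v /Dlt /= uv; rewrite /pair_kernel ger0_norm ?subr_ge0 ?ltW//.
  by rewrite union_mean_cover// subr_ge0 ltW.
apply: (same_leaf_integralE HF0 Hmean (k' := fun a => (lam_ a)^-1%R) mD) => u v /Dlt /= uv.
by rewrite union_mean_cover// subr_ge0 ltW.
Qed.

Section dirac_length.
Variable l : R.
Hypotheses (l0 : (0 < l)%R) (nul : forall A : set R, measurable A -> nu A = \d_l A).

Let integral_nu (f : R -> R) : measurable_fun setT f -> \int[nu]_h (f h)%:E = (f l)%:E.
Proof.
move=> mf; rewrite (eq_measure_integral [the measure _ _ of \d_l])//; last first.
  by move=> A mA _; exact: nul.
rewrite integral_dirac//; last exact/measurable_EFinP.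
by rewrite diracT mul1e.
Qed.

Let lamEl : lam = l.
Proof.
apply: EFin_inj; rewrite -lamE integral_nu; last exact: measurable_length.
by rewrite /length max_l// ltW.
Qed.

Let umEl a : um a = (l + Num.min `|a| l)%R.
Proof.
apply: EFin_inj; rewrite -(union_meanE lamE) integral_nu; last exact: measurable_union_length.
by rewrite /union_length /length max_l// ltW.
Qed.

Let FE a : F a = ((l <= a)%R%:R)%R.
Proof. by rewrite /leaf_cdf nul// diracE mem_setE in_itv. Qed.

(** The kernel has a jump at displacement [l]: there F jumps from 0 to 1, and
    lam_ stops growing. The two sides of the jump give the two integrals, and
    the jump itself is a null set. *)
Lemma factorial_moment2_dirac (D : set (R * R)) : measurable D ->
  D `<=` [set p | (p.1 < p.2)%R] ->
  factorial_moment2 P eta D =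
    \int[mu]_u \int[mu]_(v in xsection D u)
      (4 * \1_`]0%R, l[%classic (v - u) / (l * (l + (v - u))))%:E
    + \int[mu]_u \int[mu]_(v in xsection D u)
      (4 * l ^- 2 * \1_`]l, +oo[%classic (v - u))%:E
    + \int[mu]_u \int[\d_(l + u)%R]_(v in xsection D u)
      ((2 * l)^-1)%:E.
Proof.
move=> mD Dlt; rewrite factorial_moment2_lt//.
pose A1 : set R := `](- l)%R, l[%classic; pose A2 : set R := ~` `](- l)%R, l]%classic.
have mA1 : measurable A1 by exact: measurable_itv.
have mA2 : measurable A2 by apply: measurableC; exact: measurable_itv.
have mpk := measurable_pair_kernel HF0 Hmean; have pk0 := pair_kernel_ge0 HF0 Hmean.
pose k (A : set R) a := (pair_kernel Q a * \1_A a)%R.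
have mk A : measurable A -> measurable_fun setT (k A).
  by move=> mA; apply: measurable_funM => //; exact: measurable_indic.
have k0 A a : (0 <= k A a)%R by rewrite mulr_ge0.
have -> : displacement_integral D (pair_kernel Q) =
    displacement_integral D (k A1) + displacement_integral D (k A2).
  rewrite (displacement_integralD mD (mk _ mA1) (mk _ mA2) (k0 A1) (k0 A2)).
  apply: (displacement_integral_ae mD mpk) => //.
  - by apply: measurable_funD; exact: mk.
  - by move=> a; apply: addr_ge0; exact: k0.
  exists l => a al; rewrite /k -mulrDr !indicE /A2 in_setC !mem_setE !in_itv/=.
  case: (ltP (- l)%R a) => _ /=; last by rewrite add0r mulr1.
  by case: ltgtP al => //= *; rewrite ?addr0 ?add0r mulr1.
congr (_ + _ + _).
- apply: (displacement_integralE (k' := fun a => (4 * \1_`]0%R, l[%classic a / (l * (l + a)))%R) mD (mk _ mA1) (k0 _)).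
  move=> u v /Dlt /= uv; have a0 : (0 < v - u)%R by rewrite subr_gt0.
  move: (v - u)%R a0 => a a0; rewrite /k !indicE !mem_setE !in_itv/= a0 (lt_trans _ a0) ?oppr_lt0//=.
  have [al|la] := ltP a l; last by rewrite !mulr0 mul0r.
  rewrite !mulr1 /pair_kernel lamEl umEl FE gtr0_norm// leNgt al/= addr0 mulr1.
  by rewrite min_l// ltW.
- apply: (displacement_integralE (k' := fun a => (4 * l ^- 2 * \1_`]l, +oo[%classic a)%R) mD (mk _ mA2) (k0 _)).
  move=> u v /Dlt /= uv; have a0 : (0 < v - u)%R by rewrite subr_gt0.
  move: (v - u)%R a0 => a a0; rewrite /k !indicE /A2 in_setC !mem_setE !in_itv/= (lt_trans _ a0) ?oppr_lt0//= andbT -ltNge.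
  have [la|al] := ltP l a; last by rewrite !mulr0.
  rewrite !mulr1 /pair_kernel lamEl umEl FE gtr0_norm// (ltW la) min_r ?(ltW la)//.
  have -> : (true%:R = 1 :> R)%R by [].
  by field; rewrite ?gt_eqF ?addr_gt0 ?mulr_gt0.
have mS := measurable_same_leaf HF0 Hmean mD.
have S0 (p : R * R) : 0 <= (\1_D (p.1, p.1 + p.2)%R * (um p.2)^-1)%:E :> \bar R.
  by rewrite lee_fin mulr_ge0// invr_ge0 ltW.
rewrite /same_leaf_integral integral_leb; last 2 first.
- exact: (@measurable_fun_fubini_tonelli_F _ _ _ _ _ nu _ mS S0).
- by move=> u; apply: integral_ge0 => v _; exact: (S0 (u, v)).
apply: eq_integral => u _; rewrite integral_nu; last first.
  by apply/measurable_EFinP; exact: (measurableT_comp mS (measurable_pair1 u)).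
rewrite integral_dirac//; last exact: measurable_xsection.
rewrite diracE mem_xsection umEl gtr0_norm// minxx -EFinM indicE addrC.
by rewrite [(l + l)%R](_ : _ = (2 * l)%R)// mulr_natl mulr2n.
Qed.

End dirac_length.

Section density_length.
Variable f : R -> R.
Hypotheses (mf : measurable_fun setT f) (f0 : forall z, (0 <= f z)%R)
  (nuf : forall A : set R, measurable A -> nu A = \int[mu]_(z in A) (f z)%:E).

(** A version of the density that vanishes on the negative lengths. *)
Let f1 (a : R) : R := (f a * \1_`]0%R, +oo[%classic a)%R.

Let mf1 : measurable_fun setT f1.
Proof. by apply: measurable_funM => //; exact: measurable_indic. Qed.

Let f10 a : (0 <= f1 a)%R. Proof. exact: mulr_ge0. Qed.

Let nuf1 (A : set R) : measurable A -> nu A = \int[@leb R]_(a in A) (f1 a)%:E.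
Proof.
move=> mA; have mp : measurable (`]0%R, +oo[%classic : set R) by exact: measurable_itv.
have mn : measurable (`]-oo, 0%R]%classic : set R) by exact: measurable_itv.
transitivity (nu (A `&` `]0%R, +oo[%classic)).
  have {1}-> : A = (A `&` `]0%R, +oo[%classic) `|` (A `&` `]-oo, 0%R]%classic).
    apply/seteqP; split => [a Aa|a [[]|[]]//]; rewrite /= !in_itv/= andbT.
    by case: (ltP 0%R a); [left|right].
  apply: measureU0; [exact: measurableI|exact: measurableI|].
  apply/eqP; rewrite eq_le measure_ge0 andbT -(leaf_law_npos HF0).
  by apply: le_measure; rewrite ?inE//; exact: measurableI.
rewrite integral_leb_in//; last exact/measurable_EFinP.
rewrite nuf; last exact: measurableI.
rewrite [LHS]integral_mkcond [RHS]integral_mkcond; apply: eq_integral => a _.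
rewrite !patchE in_setI /f1 indicE.
by case: (a \in A) => //=; case: (a \in _) => /=; rewrite ?mulr1 ?mulr0.
Qed.

Definition pair_density (a : R) : R :=
  (pair_kernel Q a + (f1 a / um a + f1 (- a) / um a))%R.

Let mk1 : measurable_fun setT (fun a => f1 a / um a)%R.
Proof. by apply: measurable_funM => //; exact: measurable_inv_um. Qed.

Let mk2 : measurable_fun setT (fun a : R => f1 (- a) / um a)%R.
Proof.
apply: measurable_funM; last exact: measurable_inv_um.
by apply: (measurableT_comp mf1); exact: measurable_funN.
Qed.

Lemma measurable_pair_density : measurable_fun setT pair_density.
Proof. by apply: measurable_funD; [exact: measurable_pair_kernel|exact: measurable_funD]. Qed.

Lemma pair_density_ge0 a : (0 <= pair_density a)%R.
Proof.
by rewrite !addr_ge0 ?pair_kernel_ge0// mulr_ge0// invr_ge0 ltW.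
Qed.

Lemma pair_densityE a : (0 < a)%R ->
  pair_density a = (4 * (1 + F a) / (lam * lam_ a) + f a / lam_ a)%R.
Proof.
move=> a0; rewrite /pair_density /pair_kernel gtr0_norm// union_mean_cover ?ltW//.
rewrite /f1 !indicE !mem_setE !in_itv/= !andbT a0 oppr_gt0 ltNge (ltW a0)/=.
by rewrite mulr1 mulr0 mul0r addr0.
Qed.

Lemma factorial_moment2_pair_density (D : set (R * R)) : measurable D ->
  factorial_moment2 P eta D =
  \int[mu]_u \int[mu]_(v in xsection D u) (pair_density (v - u))%:E.
Proof.
move=> mD; rewrite (factorial_moment2_density HDL Hconn HF0 Hmean mD mf1 f10 nuf1).
apply: (displacement_integralE (k := pair_density) mD) => //.
- exact: measurable_pair_density.
- exact: pair_density_ge0.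
Qed.

Definition pair_formula (z : R) : R :=
  (lam * (1 + F z) / lam_ z + lam ^+ 2 * f z / (4 * lam_ z))%R.

Lemma pair_density_formula z : (0 < z)%R ->
  (pair_density z / (2 / lam) ^+ 2)%R = pair_formula z.
Proof.
move=> z0; rewrite pair_densityE// /pair_formula.
have : lam_ z != 0%R by rewrite -union_mean_cover ?ltW// gt_eqF.
move=> lz0; field; rewrite lz0 gt_eqF//.
Qed.

Lemma pair_correlation_exists :
  exists2 rho2 : R -> R, pair_correlation P eta rho2 &
    forall z, (0 < z)%R -> rho2 z = pair_formula z.
Proof.
exists (fun z => pair_density z / (2 / lam) ^+ 2)%R; last exact: pair_density_formula.
exists pair_density, (2 / lam)%R; split => //.
- exact: measurable_pair_density.
- exact: (dead_leaves_intensity HDL).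
- by move=> D mD; exact: factorial_moment2_pair_density.
Qed.

Let integral_shift (r : R -> R) (E : set R) (u : R) : measurable_fun setT r -> measurable E ->
  \int[mu]_(v in [set v | E (v - u)%R]) (r (v - u))%:E = \int[mu]_(a in E) (r a)%:E.
Proof.
move=> mr mE; rewrite [LHS]integral_mkcond [RHS]integral_mkcond.
pose h := (fun a : R => (r a)%:E) \_ E.
have mh : measurable_fun setT h.
  by apply/(measurable_restrictT _ mE)/measurable_EFinP; exact: measurable_funTS.
transitivity (\int[mu]_v h (v + - u)%R).
  apply: eq_integral => v _; rewrite /h !patchE.
  rewrite (_ : (v \in [set v | E (v - u)%R]) = (v - u \in E)%R)//.
rewrite [LHS]integralE [RHS]integralE; congr (_ - _).
- transitivity (\int[mu]_v (h^\+) (v + - u)%R).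
    by apply: eq_integral => v _; rewrite !funeposE.
  have mhp : measurable_fun setT h^\+ by exact: measurable_funepos.
  have hp0 v : 0 <= h^\+ v by exact: funepos_ge0.
  exact: (@ge0_lebesgue_integral_shift R h^\+ (- u)%R mhp hp0).
- transitivity (\int[mu]_v (h^\-) (v + - u)%R).
    by apply: eq_integral => v _; rewrite !funenegE.
  have mhn : measurable_fun setT h^\- by exact: measurable_funeneg.
  have hn0 v : 0 <= h^\- v by exact: funeneg_ge0.
  exact: (@ge0_lebesgue_integral_shift R h^\- (- u)%R mhn hn0).
Qed.

(** On a strip of pairs, integrating a function of the displacement over the
    plane amounts to integrating it over the displacements. *)
Let strip (E : set R) : set (R * R) := [set p | (0 <= p.1 <= 1)%R /\ E (p.2 - p.1)%R].

Let mstrip E : measurable E -> measurable (strip E).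
Proof.
move=> mE; rewrite (_ : strip E = fst @^-1` `[0%R, 1%R]%classic `&` (fun p : R * R => p.2 - p.1)%R @^-1` E).
  by apply: measurableI; apply: measurable_preimageT => //; exact: measurable_funB.
by apply/seteqP; split => p; rewrite /strip /= in_itv.
Qed.

Let strip_integral (r : R -> R) (E : set R) : measurable_fun setT r -> measurable E ->
  \int[mu]_u \int[mu]_(v in xsection (strip E) u) (r (v - u))%:E = \int[mu]_(a in E) (r a)%:E.
Proof.
move=> mr mE; set c := RHS.
transitivity (\int[mu]_(u in `[0%R, 1%R]) cst c u).
  rewrite [RHS]integral_mkcond; apply: eq_integral => u _; rewrite patchE mem_setE in_itv/=.
  case: ifPn => u01.
    rewrite /cst /c -(integral_shift u mr mE); congr integral.
    apply/seteqP; split => v; rewrite /xsection /strip /=; first by move=> /set_mem[].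
    by move=> Ev; apply/mem_set; split.
  rewrite (_ : xsection _ _ = set0) ?integral_set0//.
  by apply/seteqP; split => // v; rewrite /xsection /strip /= => /set_mem[/= h]; rewrite h in u01.
rewrite integral_cst//.
by rewrite [X in _ * X]lebesgue_measure_itv/= lte_fin ltr01 -EFinB subr0 mule1.
Qed.

(** Testing on the pairs with first point in [0, 1] and displacement in [E]
    shows that two densities have the same integrals over all bounded [E]
    contained in ]0, +oo[. The density found above is integrable there, which
    allows for the other one to be of any sign a priori. *)
Lemma pair_correlation_unique (rho2 : R -> R) : pair_correlation P eta rho2 ->
  {ae mu, forall z : R, (0 < z)%R -> rho2 z = pair_formula z}.
Proof.
move=> [r [g [mr ig rD rho2E]]].
have gE : g = (2 / lam)%R.
  have m01 : measurable (`[0%R, 1%R]%classic : set R) by exact: measurable_itv.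
  have := ig _ m01; rewrite (dead_leaves_intensity HDL Hconn HF0 Hmean m01).
  by rewrite lebesgue_measure_itv/= lte_fin ltr01 -EFinB subr0 !mule1 => -[].
pose I n : set R := `]0%R, n%:R%R]%classic.
have mI n : measurable (I n) by exact: measurable_itv.
have mpd := measurable_pair_density.
have mpdE : measurable_fun setT (fun a => (pair_density a)%:E) by exact/measurable_EFinP.
have pd0 a : 0 <= (pair_density a)%:E by rewrite lee_fin pair_density_ge0.
have mfE : measurable_fun setT (fun a => (f a)%:E) by exact/measurable_EFinP.
have fin n : mu.-integrable (I n) (fun a => (pair_density a)%:E).
  apply/integrableP; split; first by apply/measurable_EFinP; exact: measurable_funTS.
  have e1 : \int[mu]_(a in I n) `|(pair_density a)%:E| = \int[mu]_(a in I n) (pair_density a)%:E.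
    by apply: eq_integral => a _; rewrite gee0_abs.
  have e2 : \int[@leb R]_(a in I n) (pair_density a)%:E = \int[mu]_(a in I n) (pair_density a)%:E :=
    integral_leb_in (mI n) mpdE pd0.
  rewrite e1 -e2.
  pose b a : \bar R := ((8 / (lam * lam))%:E + (lam^-1)%:E * (f a)%:E).
  have mb : measurable_fun (I n) b.
    by apply: emeasurable_funD => //; apply: measurable_funeM; exact: measurable_funTS.
  apply: (@le_lt_trans _ _ (\int[@leb R]_(a in I n) b a)).
    apply: ge0_le_integral => //; first exact: measurable_funTS.
    move=> a; rewrite /I /= in_itv/= => /andP[a0 _].
    rewrite pair_densityE// /b -EFinM -EFinD lee_fin -(union_mean_cover Q (ltW a0)).
    have F1 : (F a <= 1)%R.
      by rewrite -lee_fin -leaf_cdfE; exact: probability_le1.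
    have l1 : ((um a)^-1 <= lam^-1)%R by rewrite lef_pV2 ?posrE// (le_lam_union_mean lamE).
    apply: lerD; last by rewrite mulrC ler_wpM2r.
    apply: ler_pM => //.
    - by rewrite mulr_ge0// addr_ge0// leaf_cdf_ge0.
    - by rewrite invr_ge0 mulr_ge0// ltW.
    - lra.
    - by rewrite !invfM ler_wpM2l// invr_ge0 ltW.
  have c0 : 0 <= (8 / (lam * lam))%:E by rewrite lee_fin mulr_ge0// invr_ge0 mulr_ge0// ltW.
  have l0' : 0 <= (lam^-1)%:E by rewrite lee_fin invr_ge0 ltW.
  have fE0 a : 0 <= (f a)%:E by rewrite lee_fin.
  rewrite ge0_integralD//; last 2 first.
  - by move=> a _; exact: mule_ge0.
  - by apply: measurable_funeM; exact: measurable_funTS.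
  rewrite ge0_integralZl//; last exact: measurable_funTS.
  have e3 : \int[@leb R]_(a in I n) (f a)%:E = nu (I n).
    by rewrite nuf//; exact: (integral_leb_in (mI n) mfE fE0).
  rewrite [X in _ + _ * X]e3 lte_add_pinfty//.
    rewrite integral_cst// [X in _ * X]lebesgue_measure_itv/= lte_fin.
    by case: ifP => _; rewrite ?mule0// -EFinB -EFinM ltry.
  by rewrite lte_mul_pinfty// (le_lt_trans (probability_le1 _ _))// ltry.
have ae_n n : ae_eq mu (I n) (fun a => (pair_density a)%:E) (fun a => (r a)%:E).
  have mrn : measurable_fun (I n) (fun a => (r a)%:E).
    by apply/measurable_EFinP; exact: measurable_funTS.
  have test (E : set R) : E `<=` I n -> measurable E ->
      \int[mu]_(a in E) (pair_density a)%:E = \int[mu]_(a in E) (r a)%:E.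
    move=> EI mE; rewrite -(strip_integral mpd mE) -(strip_integral mr mE).
    by rewrite -rD ?factorial_moment2_pair_density//; exact: mstrip.
  have := @integral_ae_eq _ (measurableTypeR R) R mu (I n) (mI n) (fun a => (r a)%:E)
    (fun a => (pair_density a)%:E) (fin n) mrn test.
  by [].
have : mu.-negligible (\bigcup_n [set a | ~ (I n a -> (pair_density a)%:E = (r a)%:E)]).
  by apply: negligible_bigcup => n; exact: ae_n.
apply: negligibleS => z /= /not_implyP[z0 nz]; apply: contrapT => h; apply: nz.
have /andP[_ zn] := trunc_itv (ltW z0).
have rz : (pair_density z)%:E = (r z)%:E.
  apply: contrapT => ne; apply: h; exists (Num.Def.trunc z).+1 => //= h1; apply: ne; apply: h1.
  by rewrite /I /= in_itv/= z0 ltW.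
by rewrite rho2E gE -pair_density_formula//; congr (_ / _)%R; apply/esym/EFin_inj.
Qed.

End density_length.

End main_parts.

Theorem theorem2p2 (R : realType) (d : measure_display)
    (Omega : measurableType d) (P : probability Omega R)
    (Q : probability (grain R) R)
    (x t : nat -> {RV P >-> R}) (S : nat -> {RV P >-> grain R})
    (HDL : dead_leaves_model Q x t S)
    (Hopen : 0 < Q [set K | (compacts_set K)° !=set0])
    (Hconn : {ae Q, forall K : grain R, connected (compacts_set K)})
    (HF0 : leaf_cdf Q 0%R = 0%R)
    (Hmean : leaf_mean Q < +oo) :
  let mu := @lebesgue_measure R in
  let nu := leaf_law Q in
  let F := leaf_cdf Q in
  let lam := fine (leaf_mean Q) in
  let lam_ := leaf_mean_cover Q in
  let eta := dead_leaves_points x t S in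
  let alpha2 := factorial_moment2 P eta in
  [/\ forall D : set (R * R), measurable D ->
        D `<=` [set p | (p.1 < p.2)%R] ->
        alpha2 D =
          \int[mu]_u \int[mu]_(v in xsection D u)
            (4 * (1 + F (v - u)) / (lam * lam_ (v - u)))%:E
          + \int[mu]_u \int[shifted_leaf_law Q u]_(v in xsection D u)
            ((lam_ (v - u))^-1)%:E,
      forall f : R -> R, measurable_fun setT f ->
        (forall z, 0 <= f z)%R ->
        (forall A : set R, measurable A ->
          nu A = \int[mu]_(z in A) (f z)%:E) ->
        let formula z :=
          (lam * (1 + F z) / lam_ z + lam ^+ 2 * f z / (4 * lam_ z))%R in
        (exists2 rho2 : R -> R, pair_correlation P eta rho2 &
           forall z, (0 < z)%R -> rho2 z = formula z) /\
        (forall rho2 : R -> R, pair_correlation P eta rho2 ->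
           {ae mu, forall z : R, (0 < z)%R -> rho2 z = formula z}) &
      forall l : R, (0 < l)%R ->
        (forall A : set R, measurable A -> nu A = \d_l A) ->
        forall D : set (R * R), measurable D ->
        D `<=` [set p | (p.1 < p.2)%R] ->
        alpha2 D =
          \int[mu]_u \int[mu]_(v in xsection D u)
            (4 * \1_`]0%R, l[%classic (v - u) / (l * (l + (v - u))))%:E
          + \int[mu]_u \int[mu]_(v in xsection D u)
            (4 * l ^- 2 * \1_`]l, +oo[%classic (v - u))%:E
          + \int[mu]_u \int[\d_(l + u)%R]_(v in xsection D u)
            ((2 * l)^-1)%:E].
Proof.
move=> mu nu F lam lam_ eta alpha2; split.
- move=> D mD Dlt; exact: (factorial_moment2_formula HDL Hconn HF0 Hmean mD Dlt).
- move=> f mf f0 nuf formula; split.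
    exact: (pair_correlation_exists HDL Hconn HF0 Hmean mf f0 nuf).
  by move=> rho2; exact: (pair_correlation_unique HDL Hconn HF0 Hmean mf f0 nuf).
- move=> l l0 nul D mD Dlt.
  exact: (factorial_moment2_dirac HDL Hconn HF0 Hmean l0 nul mD Dlt).
Qed.
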